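(* Let $\lambda\in\mathbb{R}$, let $\overline{M}_\lambda^{2}$ be the $2$-dimensional space form of curvature $\lambda$, and define the curvature of a convex polygon at a vertex $A$, for every value of $\lambda$, by $$\kappa_A=\frac{2(\pi-\widehat{A})}{\ell_1+\ell_2},$$ where $\widehat{A}$ is the interior angle at $A$ and $\ell_1,\ell_2$ are the lengths of the two sides meeting at $A$. Let $P$ be a compact $\kappa_0$-convex polygon in $\overline{M}_\lambda^{2}$ (that is, a compact convex polygon with $\kappa_A\ge\kappa_0>0$ at every vertex $A$) such that: - if $\lambda>0$, the side lengths $\ell_i$ of $P$ satisfy $\ell_i\le 2\mathfrak{e}<\pi/\sqrt{\lambda}$ for a real number $\mathfrak{e}$; - if $\lambda<0$, one has $\kappa_0>\sqrt{-\lambda}$ and the side lengths satisfy $\ell_i\ge 2\mathfrak{e}>0$ for a real number $\mathfrak{e}$. Then the circumradius $R$ of $P$ satisfies $$R\le \frac{\pi}{2\kappa_0}\quad\text{if }\lambda=0,\qquad \mathrm{ta}_\lambda(R)\le \frac{\mathrm{ta}_\lambda(\mathfrak{e})}{\mathfrak{e}}\,\frac{\pi}{2\kappa_0}\quad\text{if }\lambda\neq 0,$$ and the equality holds if and only if the polygon degenerates onto a $2$-covered segment. Moreover, when $\lambda<0$, $\frac{\mathrm{ta}_\lambda(\mathfrak{e})}{\mathfrak{e}}\frac{\pi}{2\kappa_0}<\frac{\pi}{2\kappa_0}$ for $\mathfrak{e}>0$.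
   Context: The $2$-dimensional space form $\overline{M}_\lambda^{2}$ of curvature $\lambda$ is the simply connected $2$-dimensional Riemannian manifold of constant sectional curvature $\lambda$: the Euclidean plane if $\lambda=0$, the sphere of radius $1/\sqrt{\lambda}$ in $\mathbb{R}^3$ if $\lambda>0$, the hyperbolic plane of curvature $\lambda$ if $\lambda<0$. Define $\mathrm{s}_\lambda(t)=\frac{\sin(\sqrt{\lambda}\,t)}{\sqrt{\lambda}}$ if $\lambda>0$, $\mathrm{s}_\lambda(t)=t$ if $\lambda=0$, $\mathrm{s}_\lambda(t)=\frac{\sinh(\sqrt{|\lambda|}\,t)}{\sqrt{|\lambda|}}$ if $\lambda<0$; $\mathrm{c}_\lambda(t)=\cos(\sqrt{\lambda}\,t)$ if $\lambda>0$, $\mathrm{c}_\lambda(t)=1$ if $\lambda=0$, $\mathrm{c}_\lambda(t)=\cosh(\sqrt{|\lambda|}\,t)$ if $\lambda<0$; and $\mathrm{ta}_\lambda(t)=\mathrm{s}_\lambda(t)/\mathrm{c}_\lambda(t)$. The circumradius of a closed convex curve (in particular of a polygon) in $\overline{M}_\lambda^{2}$ is the minimum value of $R$ such that a disk of radius $R$ in $\overline{M}_\lambda^{2}$ contains the domain bounded by the curve. A $2$-covered segment is a geodesic segment regarded as a degenerate convex polygon with two vertices (its endpoints), two coinciding sides (both equal to the segment), and interior angle $0$ at each vertex.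
   Formalization: Equality is characterized as: P is a 2-covered segment, κ₀ equals its vertex curvature and, if λ≠0, 2𝔢 equals its length; the plain ''if'' fails for non-sharp constants (plane segment of length 1, κ₀=1: R=1/2<π/2). *)

(* Defs.v *)
From HB Require Import structures.
From mathcomp Require Import all_boot all_order all_algebra.
From mathcomp Require Import all_classical all_reals all_analysis.

Set Implicit Arguments.
Unset Strict Implicit.
Unset Printing Implicit Defensive.

Import Order.TTheory GRing.Theory Num.Theory.
Import numFieldNormedType.Exports.

Local Open Scope classical_set_scope.
Local Open Scope ring_scope.

Section SpaceForm.
Variables (R : realType) (lam : R).

Definition cosh (t : R) : R := (expR t + expR (- t)) / 2.
Definition sinh (t : R) : R := (expR t - expR (- t)) / 2.
Definition arcosh (u : R) : R := ln (u + Num.sqrt (u ^+ 2 - 1)).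

Definition s_ (t : R) : R :=
  if 0 < lam then sin (Num.sqrt lam * t) / Num.sqrt lam
  else if lam == 0 then t
  else sinh (Num.sqrt `|lam| * t) / Num.sqrt `|lam|.

Definition c_ (t : R) : R :=
  if 0 < lam then cos (Num.sqrt lam * t)
  else if lam == 0 then 1
  else cosh (Num.sqrt `|lam| * t).

Definition ta_ (t : R) : R := s_ t / c_ t.

(* The three models live in 'rV[R]_3: the sphere of radius 1 / sqrt lam, the
   affine plane x_0 = 1, and the upper sheet of the hyperboloid <x, x> = 1 / lam
   in Minkowski space. [form] is the ambient Euclidean inner product when
   0 <= lam and the Minkowski form of signature (-, +, +) when lam < 0; its
   restriction to tangent vectors is the Riemannian metric. *)
Definition form (x y : 'rV[R]_3) : R :=
  (if lam < 0 then -1 else 1) * (x 0 0 * y 0 0)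
  + x 0 1 * y 0 1 + x 0 2%:R * y 0 2%:R.

Definition space_form : set 'rV[R]_3 :=
  if 0 < lam then [set x : 'rV[R]_3 | form x x = lam^-1]
  else if lam == 0 then [set x : 'rV[R]_3 | x 0 0 = 1]
  else [set x : 'rV[R]_3 | form x x = lam^-1 /\ 0 < x 0 0].

(* Geodesic distance; for lam != 0 it satisfies c_ (dist x y) = lam * <x, y>. *)
Definition dist (x y : 'rV[R]_3) : R :=
  if 0 < lam then acos (lam * form x y) / Num.sqrt lam
  else if lam == 0 then Num.sqrt (form (x - y) (x - y))
  else arcosh (lam * form x y) / Num.sqrt `|lam|.

Definition disk (x : 'rV[R]_3) (r : R) : set 'rV[R]_3 :=
  space_form `&` [set y | dist x y <= r].

(* The minimizing geodesic segment from x to y, as the set of points lying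
   metrically between them. For antipodal points of a sphere this is the
   whole sphere (the union of all minimizing geodesics). *)
Definition segment (x y : 'rV[R]_3) : set 'rV[R]_3 :=
  space_form `&` [set z | dist x z + dist z y = dist x y].

Definition geodesically_convex (D : set 'rV[R]_3) : Prop :=
  forall x y, D x -> D y -> segment x y `<=` D.

(* The geodesic from x to y is t |-> c_ t * x + s_ t * u with u the unit initial
   velocity, so y - c_ (dist x y) * x = s_ (dist x y) * u. *)
Definition direction (x y : 'rV[R]_3) : 'rV[R]_3 := y - c_ (dist x y) *: x.

Definition angle (x y z : 'rV[R]_3) : R :=
  let u := direction x y in
  let w := direction x z in
  acos (form u w / (Num.sqrt (form u u) * Num.sqrt (form w w))).

Section Polygon.
Variables (n : nat) (v : 'I_n -> 'rV[R]_3).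

Definition side (i : 'I_n) : set 'rV[R]_3 := segment (v i) (v (ordS i)).

Definition side_length (i : 'I_n) : R := dist (v i) (v (ordS i)).

(* In a convex polygon the interior angle is at most pi, so it is the
   unoriented angle between the two sides. *)
Definition interior_angle (i : 'I_n) : R :=
  angle (v i) (v (ord_pred i)) (v (ordS i)).

Definition vertex_curvature (i : 'I_n) : R :=
  2 * (pi - interior_angle i) / (side_length (ord_pred i) + side_length i).

Definition is_two_covered_segment (D : set 'rV[R]_3) : Prop :=
  [/\ n = 2%N, (forall i, space_form (v i)), injective v
    & forall i, D = side i].

Definition is_simple_closed : Prop :=
  injective v /\
  (forall i j, i != j ->
     side i `&` side j `<=` [set v i; v (ordS i)] `&` [set v j; v (ordS j)]).

(* v lists the vertices in cyclic order (in either orientation) and D is the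
   domain bounded by the polygonal curve. Since D is a closed subset of the
   space form, D `&` closure (space_form `\` D) is its boundary relative to the
   space form. *)
Definition is_proper_convex_polygon (D : set 'rV[R]_3) : Prop :=
  [/\ (2 < n)%N, (forall i, space_form (v i)), is_simple_closed,
      [/\ D `<=` space_form, compact D & geodesically_convex D]
    & D `&` closure (space_form `\` D) = \bigcup_i side i].

Definition is_convex_polygon (D : set 'rV[R]_3) : Prop :=
  is_two_covered_segment D \/ is_proper_convex_polygon D.

Definition is_kappa_convex_polygon (kappa0 : R) (D : set 'rV[R]_3) : Prop :=
  [/\ is_convex_polygon D, 0 < kappa0
    & forall i, kappa0 <= vertex_curvature i].

End Polygon.

Definition is_circumradius (D : set 'rV[R]_3) (r : R) : Prop :=
  (exists2 x, space_form x & D `<=` disk x r) /\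
  (forall r', (exists2 x, space_form x & D `<=` disk x r') -> r <= r').

End SpaceForm.

(* Main.v *)
From HB Require Import structures.
Require Import Defs.
From mathcomp Require Import all_boot all_order all_algebra.
From mathcomp Require Import all_classical all_reals all_analysis.
From mathcomp Require Import ring lra zify.
(* Again, so that [form], [dist] and [angle] are those of the space form. *)
Import Defs.

Import Order.TTheory GRing.Theory Num.Theory.
Import numFieldNormedType.Exports.
Local Open Scope classical_set_scope.
Local Open Scope ring_scope.

(** Let [rho] be the circumradius of the polygon and [T = ta rho].

    A doubly covered segment of length [d] has [rho = d / 2] and curvature
    [pi / d] at both vertices, so [rho <= pi / (2 kappa0)], with equality
    exactly when the curvature is [kappa0]. Since [t |-> ta t / t] increases for positive
    [lam] and decreases for negative [lam] ([ta_div_lt], [ta_div_gt]), the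
    hypotheses on [e] give [ta (d / 2) / (d / 2) <= ta e / e], with equality
    exactly when [d = 2 e]; multiplying the two estimates settles this case
    ([two_gon], [ta_div_le]).

    For a proper polygon the inequality is strict. Suppose it is not, so that
    [T] is at least the bound. Draw on each side the isosceles triangle whose
    legs have length [rho]: its base angle is
    [phi = acos (ta (l / 2) / T)], where [l] is the length of the side. By
    Jordan's inequality [acos x >= (pi / 2) (1 - x)], and by the monotonicity of
    [ta t / t] the lower bound on [T] turns the curvature condition into
    [A < phi + phi'] at each vertex, where [A] is the interior angle and
    [phi], [phi'] belong to the two adjacent sides ([angle_lt_base_angles]).
    Equality holds here for a polygon that is inscribed in a circle of radius
    [rho] and contains the centre; the strict inequality says that the polygon
    turns too sharply to need a disk of that size.

    The contradiction comes from a discrete comparison in the manner of Schur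
    and Cauchy. Take a triangle [x y z] whose sides have length at most
    [2 rho]. If its angle at [y] is smaller than [phi (x, y) + phi (y, z)],
    then its angle at [x] is at least [phi (x, y) - phi (x, z)] ([hinge]): up to
    a positive factor, both [T cos (a - phi) - ta (xz / 2)] and its analogue at
    [y] compute the power of [z] with respect to the circle of radius [rho]
    through [x] and [y]. Adding triangles one by one around a vertex gives the
    same conclusion for a chain of sides ([fan]): for each vertex [v j],
    [phi (v 0, v 1) <= phi (v 0, v j) + angle (v 0; v 1, v j)], and likewise
    in the other direction around the polygon.

    The minimal disk touches the polygon at vertices on both sides of each
    radius that ends at a contact vertex [v 0]; otherwise moving its centre
    would allow a smaller radius ([tangent_rot], [move_center]). If [v j] and
    [v j'] are such contacts, the angles of the isosceles triangles over the
    chords from [v 0] add up: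
    [angle (v 0; v j, v j') = phi (v 0, v j) + phi (v 0, v j')]
    ([contact_ang], [contact_add]). Summing the two fan inequalities and this
    equality, the interior angle at [v 0] is at least the sum of the base angles
    of its two sides, contrary to [A < phi + phi'] ([no_contacts]). A contact antipodal to [v 0] takes the role of both [v j] and [v j'], since
    then [phi] vanishes.

    Two kinds of preliminaries make this rigorous. Most of the trigonometry is
    replaced by polynomial identities between squared chords
    [q x y = 4 (s (d / 2)) ^ 2], where [d] is the distance of [x] and [y], and
    3 x 3 determinants, uniformly in the sign of [lam]. The synthetic
    hypotheses on [D] are turned into convex position: geodesic convexity and
    the description of the boundary put [D] on one side of each side line
    ([side_support]), so consecutive vertices turn in a constant direction
    ([convex_orientation]), and each point of [D] lies in a triangle spanned by
    vertices ([fan_cover]), whence a disk containing the vertices contains [D]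
    ([cone3_q_le]). *)

Set Implicit Arguments.
Unset Strict Implicit.
Unset Printing Implicit Defensive.

(** * Generalized trigonometry and Jordan's inequality *)
Lemma is_derive_gt0_lt (R : realType) (f df : R -> R) (a b : R) : a < b ->
  (forall x, a <= x <= b -> is_derive x 1 f (df x)) ->
  (forall x, a < x < b -> 0 < df x) -> f a < f b.
Proof.
move=> ab fd df0.
have fdo x : x \in `]a, b[ -> is_derive x 1 f (df x).
  by rewrite in_itv/= => /andP[ax xb]; apply: fd; rewrite !ltW.
have fc : {within `[a, b], continuous f}.
  apply: derivable_within_continuous => x; rewrite in_itv/= => xab.
  by exact: (@ex_derive _ _ _ _ _ _ _ (fd _ xab)).
have [c] := MVT ab fdo fc; rewrite in_itv/= => cab fE.
by rewrite -subr_gt0 fE mulr_gt0 ?df0// subr_gt0.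
Qed.

(** Sealed copies of the functions of the space form: unification would
    otherwise unfold the case distinction on the sign of [lam] and get lost in
    the real exponential and sine. *)
HB.lock Definition sn (R : realType) (lam t : R) : R := s_ lam t.
HB.lock Definition cs (R : realType) (lam t : R) : R := c_ lam t.
HB.lock Definition tn (R : realType) (lam t : R) : R := ta_ lam t.

Section Trig.
Variables (R : realType) (lam : R).
Implicit Types (t x y z : R).
Local Notation s := (sn lam).
Local Notation c := (cs lam).
Local Notation ta := (tn lam).

Lemma taE t : ta t = s t / c t.
Proof. by rewrite tn.unlock sn.unlock cs.unlock. Qed.

Lemma sgn_cases : [\/ 0 < lam, lam = 0 | lam < 0].
Proof. by case: (ltrgt0P lam) => ?; [apply: Or31|apply: Or33|apply: Or32]. Qed.

Lemma s_pos (l0 : 0 < lam) t : s t = sin (Num.sqrt lam * t) / Num.sqrt lam.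
Proof. by rewrite sn.unlock /s_ l0. Qed.
Lemma c_pos (l0 : 0 < lam) t : c t = cos (Num.sqrt lam * t).
Proof. by rewrite cs.unlock /c_ l0. Qed.
Lemma s_zero (l0 : lam = 0) t : s t = t.
Proof. by rewrite sn.unlock /s_ l0 ltxx eqxx. Qed.
Lemma c_zero (l0 : lam = 0) t : c t = 1.
Proof. by rewrite cs.unlock /c_ l0 ltxx eqxx. Qed.
Lemma s_neg (l0 : lam < 0) t : s t = sinh (Num.sqrt (- lam) * t) / Num.sqrt (- lam).
Proof. by rewrite sn.unlock /s_ ltNge ltW//= lt_eqF// ltr0_norm. Qed.
Lemma c_neg (l0 : lam < 0) t : c t = cosh (Num.sqrt (- lam) * t).
Proof. by rewrite cs.unlock /c_ ltNge ltW//= lt_eqF// ltr0_norm. Qed.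

Definition trig_pos l0 := (s_pos l0, c_pos l0).
Definition trig_zero l0 := (s_zero l0, c_zero l0).
Definition trig_neg l0 := (s_neg l0, c_neg l0).

Lemma is_derive_sinh (x : R) : is_derive x 1 (@sinh R) (cosh x).
Proof.
rewrite /sinh /cosh; apply: is_derive_eq.
by rewrite /GRing.scale/=; field.
Qed.

Lemma is_derive_cosh (x : R) : is_derive x 1 (@cosh R) (sinh x).
Proof.
rewrite /sinh /cosh; apply: is_derive_eq.
by rewrite /GRing.scale/=; field.
Qed.

Lemma is_derive_s (x : R) : is_derive x 1 s (c x).
Proof.
case: sgn_cases => [l0|l0|l0].
- have k0 : Num.sqrt lam != 0 by rewrite gt_eqF// sqrtr_gt0.
  rewrite (c_pos l0) (_ : s = fun t => sin (Num.sqrt lam * t) / Num.sqrt lam).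
    by apply: is_derive_eq; rewrite /GRing.scale/=; field.
  by apply/funext => t; rewrite (s_pos l0).
- rewrite (c_zero l0) (_ : s = id); first exact: is_derive_id.
  by apply/funext => t; rewrite (s_zero l0).
- have k0 : Num.sqrt (- lam) != 0 by rewrite gt_eqF// sqrtr_gt0 oppr_gt0.
  rewrite (c_neg l0) (_ : s = fun t => sinh (Num.sqrt (- lam) * t) / Num.sqrt (- lam)).
    have D := is_derive_sinh.
    by apply: is_derive_eq; rewrite /GRing.scale/=; field.
  by apply/funext => t; rewrite (s_neg l0).
Qed.

Lemma is_derive_c (x : R) : is_derive x 1 c (- lam * s x).
Proof.
case: sgn_cases => [l0|l0|l0].
- have k0 : Num.sqrt lam != 0 by rewrite gt_eqF// sqrtr_gt0.
  rewrite (s_pos l0) (_ : c = fun t => cos (Num.sqrt lam * t)).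
    apply: is_derive_eq; rewrite /GRing.scale/=.
    by rewrite -{3}[lam]sqr_sqrtr ?ltW//; field.
  by apply/funext => t; rewrite (c_pos l0).
- rewrite l0 oppr0 mul0r (_ : cs 0 = cst 1); first exact: is_derive_cst.
  by apply/funext => t; rewrite -l0 c_zero.
- have k0 : Num.sqrt (- lam) != 0 by rewrite gt_eqF// sqrtr_gt0 oppr_gt0.
  rewrite (s_neg l0) (_ : c = fun t => cosh (Num.sqrt (- lam) * t)).
    have D := is_derive_cosh.
    apply: is_derive_eq; rewrite /GRing.scale/=.
    have -> : - lam = Num.sqrt (- lam) ^+ 2 by rewrite sqr_sqrtr// oppr_ge0 ltW.
    by rewrite sqrtr_sqr ger0_norm ?sqrtr_ge0//; field.
  by apply/funext => t; rewrite (c_neg l0).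
Qed.

Lemma s0 : s 0 = 0.
Proof.
case: sgn_cases => l0; [rewrite !(trig_pos l0)|by rewrite !(trig_zero l0)|rewrite !(trig_neg l0)]; rewrite mulr0 ?sin0 ?mul0r//.
by rewrite /sinh oppr0 subrr !mul0r.
Qed.

Lemma c0 : c 0 = 1.
Proof.
case: sgn_cases => l0; [rewrite !(trig_pos l0)|by rewrite !(trig_zero l0)|rewrite !(trig_neg l0)]; rewrite mulr0 ?cos0//.
by rewrite /cosh oppr0 expR0; field.
Qed.

Lemma sD x y : s (x + y) = s x * c y + c x * s y.
Proof.
case: sgn_cases => l0; [rewrite !(trig_pos l0)|rewrite !(trig_zero l0)|rewrite !(trig_neg l0)].
- have k0 : Num.sqrt lam != 0 by rewrite gt_eqF// sqrtr_gt0.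
  by rewrite mulrDr sinD; field.
- by ring.
- have k0 : Num.sqrt (- lam) != 0 by rewrite gt_eqF// sqrtr_gt0 oppr_gt0.
  by rewrite /sinh /cosh mulrDr opprD !expRD; field.
Qed.

Lemma cD x y : c (x + y) = c x * c y - lam * (s x * s y).
Proof.
case: sgn_cases => l0; [rewrite !(trig_pos l0)|rewrite !(trig_zero l0)|rewrite !(trig_neg l0)].
- have k0 : Num.sqrt lam != 0 by rewrite gt_eqF// sqrtr_gt0.
  rewrite mulrDr cosD; congr (_ - _).
  by rewrite -{3}[lam]sqr_sqrtr ?ltW//; field.
- by rewrite l0; ring.
- have k0 : Num.sqrt (- lam) != 0 by rewrite gt_eqF// sqrtr_gt0 oppr_gt0.
  rewrite -mulNr.
  have -> : - lam = Num.sqrt (- lam) ^+ 2 by rewrite sqr_sqrtr// oppr_ge0 ltW.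
  rewrite sqrtr_sqr ger0_norm ?sqrtr_ge0//.
  by rewrite /sinh /cosh mulrDr opprD !expRD; field.
Qed.

Lemma sN x : s (- x) = - s x.
Proof.
case: sgn_cases => l0; [rewrite !(trig_pos l0)|by rewrite !(trig_zero l0)|rewrite !(trig_neg l0)]; rewrite mulrN ?sinN ?mulNr//.
by rewrite /sinh opprK; ring.
Qed.

Lemma cN x : c (- x) = c x.
Proof.
case: sgn_cases => l0; [rewrite !(trig_pos l0)|by rewrite !(trig_zero l0)|rewrite !(trig_neg l0)]; rewrite mulrN ?cosN//.
by rewrite /cosh opprK addrC.
Qed.

Lemma c2s2 x : c x ^+ 2 + lam * s x ^+ 2 = 1.
Proof. by rewrite -c0 -(subrr x) cD sN cN; ring. Qed.

Lemma s_double x : s (2 * x) = 2 * s x * c x.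
Proof. by rewrite mulr_natl mulr2n sD; ring. Qed.

Lemma c_double x : c (2 * x) = 1 - 2 * lam * s x ^+ 2.
Proof. by rewrite mulr_natl mulr2n cD; have := c2s2 x; lra. Qed.

(** The range on which [c_] is positive and [ta_] increases: distances smaller
    than a quarter of a great circle, all distances when [lam <= 0]. *)
Definition adm (t : R) := 0 < lam -> t < pi / 2 / Num.sqrt lam.

Lemma c_gt0 t : 0 <= t -> adm t -> 0 < c t.
Proof.
move=> t0 at_; case: sgn_cases => l0; [rewrite !(trig_pos l0)|rewrite !(trig_zero l0)//|rewrite !(trig_neg l0)].
- have k0 : 0 < Num.sqrt lam by rewrite sqrtr_gt0.
  apply: cos_gt0_pihalf; rewrite (mulrC _ t) -ltr_pdivlMr// (at_ l0) andbT.
  rewrite (@lt_le_trans _ _ 0)//; last by rewrite mulr_ge0// ltW.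
  by rewrite oppr_lt0 divr_gt0// pi_gt0.
- by rewrite /cosh divr_gt0// addr_gt0// expR_gt0.
Qed.

Lemma s_lt x y : 0 <= x -> x < y -> (0 < lam -> y <= pi / 2 / Num.sqrt lam) ->
  s x < s y.
Proof.
move=> x0 xy ay; apply: (@is_derive_gt0_lt _ s c) => // z.
  by move=> _; apply: is_derive_s.
move=> /andP[xz zy]; apply: c_gt0; first by rewrite (le_trans x0)// ltW.
by move=> l0; rewrite (lt_le_trans zy)// ay.
Qed.

Lemma s_gt0 x : 0 < x -> adm x -> 0 < s x.
Proof. by move=> x0 ax; rewrite -s0 s_lt// => /ax/ltW. Qed.

Lemma is_derive_ta x : c x != 0 -> is_derive x 1 ta ((c x)^-1 ^+ 2).
Proof.
move=> cx; have Ds := is_derive_s; have Dc := is_derive_c.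
rewrite (_ : ta = fun t => s t * (c t)^-1); last by apply/funext => t; rewrite taE.
apply: is_derive_eq.
rewrite /GRing.scale/=.
have -> : (c x)^-1 ^+ 2 = (c x ^+ 2 + lam * s x ^+ 2) * (c x)^-1 ^+ 2.
  by rewrite c2s2 mul1r.
by field.
Qed.

Lemma ta_lt x y : 0 <= x -> x < y -> adm y -> ta x < ta y.
Proof.
move=> x0 xy ay; apply: (@is_derive_gt0_lt _ ta (fun x => (c x)^-1 ^+ 2)) => // z.
  move=> /andP[xz zy]; apply: is_derive_ta; rewrite gt_eqF// c_gt0//.
    exact: le_trans xz.
  by move=> l0; exact: le_lt_trans (ay l0).
move=> /andP[xz zy]; rewrite exprn_gt0// invr_gt0 c_gt0//.
  by apply: le_trans (ltW xz).
by move=> l0; apply: lt_trans (ay l0).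
Qed.

Lemma ta0 : ta 0 = 0.
Proof. by rewrite taE s0 mul0r. Qed.

Lemma ta_gt0 x : 0 < x -> adm x -> 0 < ta x.
Proof. by move=> x0 ax; rewrite -ta0 ta_lt. Qed.

(** With the next lemma, this determines the sign of the derivative of
    [ta t / t], whose numerator is [t - s t * c t]. *)
Lemma s_mul_c_lt t : 0 < t -> adm t -> 0 < lam -> s t * c t < t.
Proof.
move=> t0 at_ l0; rewrite -subr_gt0 (_ : 0 = 0 - s 0 * c 0); last by rewrite s0; ring.
have Ds := is_derive_s; have Dc := is_derive_c.
apply: (@is_derive_gt0_lt _ (fun t => t - s t * c t) (fun t => 2 * lam * s t ^+ 2)) => // z.
  move=> _; apply: is_derive_eq; rewrite /GRing.scale/=.
  by have := c2s2 z; lra.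
move=> /andP[z0 zt]; rewrite !mulr_gt0// s_gt0// => _; exact: lt_trans (at_ l0).
Qed.

Lemma s_mul_c_gt t : 0 < t -> lam < 0 -> t < s t * c t.
Proof.
move=> t0 l0; rewrite -subr_gt0 (_ : 0 = s 0 * c 0 - 0); last by rewrite s0; ring.
have Ds := is_derive_s; have Dc := is_derive_c.
apply: (@is_derive_gt0_lt _ (fun t => s t * c t - t) (fun t => - (2 * lam) * s t ^+ 2)) => // z.
  move=> _; apply: is_derive_eq; rewrite /GRing.scale/=.
  by have := c2s2 z; lra.
move=> /andP[z0 zt]; rewrite mulr_gt0//; last by rewrite exprn_gt0// s_gt0// /adm ltNge ltW.
by rewrite oppr_gt0 pmulr_rlt0.
Qed.

Lemma is_derive_ta_div x : 0 < x -> adm x ->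
  is_derive x 1 (fun t => ta t / t) ((x - s x * c x) * (c x * x)^-1 ^+ 2).
Proof.
move=> x0 ax; have cx : c x != 0 by rewrite gt_eqF// c_gt0// ltW.
have xn0 : x != 0 by rewrite gt_eqF.
have Dta := is_derive_ta cx.
have Dv := is_deriveV (f := id) xn0 (is_derive_id x 1).
apply: is_derive_eq.
by rewrite /GRing.scale/= taE; field; rewrite xn0 cx.
Qed.

Lemma ta_div_lt x y : 0 < lam -> 0 < x -> x < y -> adm y -> ta x / x < ta y / y.
Proof.
move=> l0 x0 xy ay.
have A z : x <= z <= y -> 0 < z /\ adm z.
  move=> /andP[xz zy]; split; first exact: lt_le_trans xz.
  by move=> _; apply: le_lt_trans (ay l0).
apply: (@is_derive_gt0_lt _ (fun t => ta t / t) (fun x => (x - s x * c x) * (c x * x)^-1 ^+ 2)) => // [z /A[z0 az]|z /andP[xz zy]].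
  exact: is_derive_ta_div.
have [z0 az] : 0 < z /\ adm z by apply: A; rewrite !ltW.
rewrite mulr_gt0//; first by rewrite subr_gt0 s_mul_c_lt.
by rewrite exprn_gt0// invr_gt0 mulr_gt0// c_gt0// ltW.
Qed.

Lemma ta_div_gt x y : lam < 0 -> 0 < x -> x < y -> ta y / y < ta x / x.
Proof.
move=> l0 x0 xy; rewrite -ltrN2.
have A z : adm z by rewrite /adm ltNge ltW.
apply: (@is_derive_gt0_lt _ (fun t => - (ta t / t))
  (fun x => - ((x - s x * c x) * (c x * x)^-1 ^+ 2))) => // [z /andP[xz zy]|z /andP[xz zy]].
  have z0 := lt_le_trans x0 xz.
  by have D := is_derive_ta_div z0 (A z); apply: is_derive_eq.
have z0 := lt_trans x0 xz.
rewrite oppr_gt0 pmulr_llt0; first by rewrite subr_lt0 s_mul_c_gt.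
by rewrite exprn_gt0// invr_gt0 mulr_gt0// c_gt0// ltW.
Qed.

(** The derivative [1 / c ^ 2] of [ta] is below 1, for [c ^ 2 = 1 - lam s ^ 2]
    exceeds 1 here. *)
Lemma ta_lt_id x : lam < 0 -> 0 < x -> ta x < x.
Proof.
move=> l0 x0; have c1 : 1 < c x ^+ 2.
  rewrite -(c2s2 x) gtrDl pmulr_llt0// exprn_gt0// s_gt0// /adm ltNge ltW//.
rewrite -subr_gt0 (_ : 0 = 0 - ta 0); last by rewrite ta0; ring.
have A z : adm z by rewrite /adm ltNge ltW.
apply: (@is_derive_gt0_lt _ (fun t => t - ta t) (fun x => 1 - (c x)^-1 ^+ 2)) => // z.
  move=> /andP[z0 _].
  have D : is_derive z 1 ta ((c z)^-1 ^+ 2) by apply: is_derive_ta; rewrite gt_eqF// c_gt0.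
  exact: is_derive_eq.
move=> /andP[z0 _]; have cz : 0 < c z by rewrite c_gt0// ltW.
rewrite subr_gt0 exprVn invf_lt1 ?exprn_gt0//.
by rewrite -(c2s2 z) gtrDl pmulr_llt0// exprn_gt0// s_gt0.
Qed.

End Trig.

(** [sin x / x] decreases, because [x cos x < sin x], and takes the value
    [2 / pi] at [pi / 2]. *)
Lemma jordan (R : realType) (x : R) : 0 < x -> x < pi / 2 -> x < pi / 2 * sin x.
Proof.
move=> x0 xpi.
have k (y : R) : 0 < y -> y < pi / 2 -> y * cos y < sin y.
  move=> y0 ypi; rewrite -subr_gt0 (_ : 0 = sin (0 : R) - 0 * cos 0); last by rewrite sin0; ring.
  apply: (@is_derive_gt0_lt _ (fun t => sin t - t * cos t) (fun t => t * sin t)) => // z.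
    by move=> _; apply: is_derive_eq; rewrite /GRing.scale/=; ring.
  by move=> /andP[z0 zy]; rewrite mulr_gt0// sin_gt0_pihalf// z0 (lt_trans zy).
have : - (sin x / x) < - (sin (pi / 2) / (pi / 2)).
  apply: (@is_derive_gt0_lt _ (fun t => - (sin t / t))
    (fun t => (sin t - t * cos t) * t^-1 ^+ 2)) => // z /andP[xz zpi].
    have zn0 : z != 0 by rewrite gt_eqF// (lt_le_trans x0).
    have Dv := is_deriveV (f := id) zn0 (is_derive_id z 1).
    by apply: is_derive_eq; rewrite /GRing.scale/=; field.
  rewrite mulr_gt0//; first by rewrite subr_gt0 k// (lt_trans x0).
  by rewrite exprn_gt0// invr_gt0 (lt_trans x0).
have p0 : 0 < (pi : R) / 2 by rewrite divr_gt0// pi_gt0.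
rewrite ltrN2 sin_pihalf ltr_pdivrMr// mulrAC ltr_pdivlMr// mul1r.
by rewrite mulrC.
Qed.

(** * Squared chords, inner products of directions and orientation *)

(** [chord_sq] is the squared ambient chord of two points. By the law of
    cosines, [dir_dot x y z] is the inner product at [x] of the directions
    towards [y] and [z], written in terms of the three squared chords; this one
    formula serves the three geometries. [orient] is the determinant scaled so
    that [orient x y z] is, up to the choice of an orientation, the determinant
    of those two directions in the tangent plane at [x]. *)
HB.lock Definition on_space (R : realType) (lam : R) (x : 'rV[R]_3) : Prop := space_form lam x.
HB.lock Definition ip (R : realType) (lam : R) (x y : 'rV[R]_3) : R := form lam x y.
HB.lock Definition dst (R : realType) (lam : R) (x y : 'rV[R]_3) : R := dist lam x y.
HB.lock Definition dirv (R : realType) (lam : R) (x y : 'rV[R]_3) : 'rV[R]_3 := direction lam x y.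
HB.lock Definition chord_sq (R : realType) (lam : R) (x y : 'rV[R]_3) : R := ip lam (x - y) (x - y).
HB.lock Definition dir_dot (R : realType) (lam : R) (x y z : 'rV[R]_3) : R :=
  (chord_sq lam x y + chord_sq lam x z - chord_sq lam y z) / 2 - lam * chord_sq lam x y * chord_sq lam x z / 4.
HB.lock Definition det3 (R : realType) (x y z : 'rV[R]_3) : R :=
  x 0 0 * (y 0 1 * z 0 2%:R - y 0 2%:R * z 0 1)
  - x 0 1 * (y 0 0 * z 0 2%:R - y 0 2%:R * z 0 0)
  + x 0 2%:R * (y 0 0 * z 0 1 - y 0 1 * z 0 0).
HB.lock Definition orient (R : realType) (lam : R) (x y z : 'rV[R]_3) : R :=
  (if lam == 0 then 1 else Num.sqrt `|lam|) * det3 x y z.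

Section Geom.
Variables (R : realType) (lam : R).
Implicit Types (t r : R) (x y z w u : 'rV[R]_3).
Local Notation s := (sn lam).
Local Notation c := (cs lam).
Local Notation S := (on_space lam).
Local Notation form := (ip lam).
Local Notation dist := (dst lam).
Local Notation dir := (dirv lam).
Local Notation q := (chord_sq lam).
Local Notation dot := (dir_dot lam).
Local Notation crs := (orient lam).

Lemma det3E x y z : det3 x y z =
  x 0 0 * (y 0 1 * z 0 2%:R - y 0 2%:R * z 0 1)
  - x 0 1 * (y 0 0 * z 0 2%:R - y 0 2%:R * z 0 0)
  + x 0 2%:R * (y 0 0 * z 0 1 - y 0 1 * z 0 0).
Proof. by rewrite det3.unlock. Qed.

Lemma det3_rot x y z : det3 y z x = det3 x y z.
Proof. by rewrite !det3E; ring. Qed.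
Lemma det3_swap x y z : det3 x z y = - det3 x y z.
Proof. by rewrite !det3E; ring. Qed.
Lemma det3_diag x y : det3 x y y = 0.
Proof. by rewrite !det3E; ring. Qed.

Lemma row3P x y : x 0 0 = y 0 0 -> x 0 1 = y 0 1 -> x 0 2%:R = y 0 2%:R -> x = y.
Proof.
move=> e0 e1 e2; apply/rowP => -[[|[|[|//]]] ki]; rewrite ?ord1.
- by rewrite (_ : Ordinal ki = 0)//; apply: val_inj.
- by rewrite (_ : Ordinal ki = 1)//; apply: val_inj.
- by rewrite (_ : Ordinal ki = 2%:R)//; apply: val_inj.
Qed.

(** The sign that distinguishes [form] from the Euclidean inner product. *)
Definition sg : R := if lam < 0 then -1 else 1.

Lemma formE x y : form x y =
  sg * (x 0 0 * y 0 0) + x 0 1 * y 0 1 + x 0 2%:R * y 0 2%:R.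
Proof. by rewrite ip.unlock. Qed.

Lemma formC x y : form x y = form y x.
Proof. by rewrite !formE; ring. Qed.
Lemma formDl x y z : form (x + y) z = form x z + form y z.
Proof. by rewrite !formE !mxE; ring. Qed.
Lemma formZl a x y : form (a *: x) y = a * form x y.
Proof. by rewrite !formE !mxE; ring. Qed.
Lemma formNl x y : form (- x) y = - form x y.
Proof. by rewrite !formE !mxE; ring. Qed.
Lemma formDr x y z : form x (y + z) = form x y + form x z.
Proof. by rewrite !(formC x) formDl. Qed.
Lemma formZr a x y : form x (a *: y) = a * form x y.
Proof. by rewrite !(formC x) formZl. Qed.
Lemma formNr x y : form x (- y) = - form x y.
Proof. by rewrite !(formC x) formNl. Qed.
Definition form_lin := (formDl, formDr, formNl, formNr, formZl, formZr).

Lemma sgsg : sg * sg = 1.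
Proof. by rewrite /sg; case: ifP; rewrite ?mulrNN mulr1. Qed.

(** The product of two determinants is the Gram determinant of their columns, here
    for triples that share [x] and [w]. *)
Lemma gram3 x y w z : sg * (det3 x y w * det3 x w z) =
  form x x * (form y w * form w z - form y z * form w w)
  - form x w * (form y x * form w z - form y z * form w x)
  + form x z * (form y x * form w w - form y w * form w x).
Proof.
rewrite !formE !det3E; have := sgsg; rewrite /sg; case: ifP => _ _; ring.
Qed.

(** Four vectors of a three-dimensional space satisfy the linear relation whose
    coefficients are their maximal minors; here it is paired with [u]. *)
Lemma dep4 x y w z u : det3 y w z * form x u - det3 x w z * form y u
   + det3 x y z * form w u - det3 x y w * form z u = 0.
Proof. by rewrite !formE !det3E; ring. Qed.

Lemma sf_form x : lam != 0 -> S x -> lam * form x x = 1.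
Proof.
move=> l0; rewrite on_space.unlock /space_form (negbTE l0); rewrite ip.unlock; case: ifP => _ /=; first by move=> ->; rewrite divff.
by case=> -> _; rewrite divff.
Qed.

Lemma sf_zero x : lam = 0 -> S x = (x 0 0 = 1).
Proof. by rewrite on_space.unlock /space_form => ->; rewrite ltxx eqxx. Qed.

Lemma sf_neg x : lam < 0 -> S x = (form x x = lam^-1 /\ 0 < x 0 0).
Proof. by move=> l0; rewrite on_space.unlock ip.unlock /space_form ltNge ltW//= lt_eqF. Qed.

Lemma sf_pos x : 0 < lam -> S x = (form x x = lam^-1).
Proof. by rewrite on_space.unlock ip.unlock /space_form => ->. Qed.

Lemma qF x y : q x y = form (x - y) (x - y). Proof. by rewrite chord_sq.unlock. Qed.

Lemma qE x y : q x y = form x x + form y y - 2 * form x y.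
Proof. by rewrite qF !form_lin (formC y x); ring. Qed.
Lemma qC x y : q x y = q y x.
Proof. by rewrite !qE (formC y x); ring. Qed.
Lemma qxx x : q x x = 0.
Proof. by rewrite qE; ring. Qed.

Lemma q_form x y : lam != 0 -> S x -> S y -> lam * form x y = 1 - lam * q x y / 2.
Proof.
move=> l0 /(sf_form l0) xx /(sf_form l0) yy; rewrite qE.
rewrite (_ : lam * (_ + _ - _) = lam * form x x + lam * form y y - 2 * (lam * form x y)); last ring.
by rewrite xx yy; field.
Qed.

Lemma dotE x y z : dot x y z = (q x y + q x z - q y z) / 2 - lam * q x y * q x z / 4.
Proof. by rewrite dir_dot.unlock. Qed.

Lemma dotC x y z : dot x y z = dot x z y.
Proof. by rewrite !dotE (qC y z); ring. Qed.

Lemma q_third z x y : q x y = q z x + q z y - 2 * dot z x y - lam * q z x * q z y / 2.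
Proof. by rewrite !dotE; field. Qed.

Lemma dot_diag x y : dot x y y = q x y * (1 - lam * q x y / 4).
Proof. by rewrite dotE qxx; field. Qed.

Lemma dot_form x y z : lam != 0 -> S x -> S y -> S z ->
  dot x y z = form y z - lam * form x y * form x z.
Proof.
move=> l0 Sx Sy Sz; apply: (mulfI l0).
transitivity (lam * form y z - (lam * form x y) * (lam * form x z)); last by ring.
by rewrite (q_form l0 Sx Sy) (q_form l0 Sx Sz) (q_form l0 Sy Sz) !dotE; field.
Qed.

(** The scale factor of [orient], chosen so that [crs_mul] holds. *)
Definition kk : R := if lam == 0 then 1 else Num.sqrt `|lam|.
Lemma crsE x y z : crs x y z = kk * det3 x y z.
Proof. by rewrite orient.unlock. Qed.

Lemma kk_gt0 : 0 < kk.
Proof.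
by rewrite /kk; case: eqP => // /eqP l0; rewrite sqrtr_gt0 normr_gt0.
Qed.

Lemma kk2 : lam != 0 -> kk ^+ 2 = sg * lam.
Proof.
move=> l0; rewrite /kk (negbTE l0) sqr_sqrtr// /sg.
by case: (ltrgt0P lam) l0 => // ?; rewrite ?mul1r ?mulN1r ?eqxx.
Qed.

Lemma crs_rot x y z : crs y z x = crs x y z.
Proof. by rewrite !crsE det3_rot. Qed.
Lemma crs_swap x y z : crs x z y = - crs x y z.
Proof. by rewrite !crsE det3_swap; ring. Qed.
Lemma crs_diag x y : crs x y y = 0.
Proof. by rewrite !crsE det3_diag mulr0. Qed.

(** With the next lemma, the addition formulas for cosine and sine at [x]:
    [crs] and [dot] are the sine and cosine of an angle times the lengths of its
    sides, and the middle ray [w] is the one eliminated. *)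
Lemma crs_mul x y w z : S x -> S y -> S w -> S z ->
  crs x y w * crs x w z = dot x y w * dot x w z - dot x y z * dot x w w.
Proof.
have [l0 Sx Sy Sw Sz|l0 Sx Sy Sw Sz] := eqVneq lam 0; last first.
  rewrite !crsE mulrACA -expr2 kk2// (mulrC sg) -mulrA gram3.
  rewrite !dot_form//.
  have := sf_form l0 Sx.
  rewrite (formC y x) (formC w x).
  set A := form x x => lA; have -> : A = lam^-1 by rewrite -[RHS]mulr1 -lA mulKf.
  by field.
rewrite !crsE /kk l0 eqxx !mul1r; move: Sx Sy Sw Sz; rewrite !sf_zero// => Sx Sy Sw Sz.
by rewrite -l0 !dotE !qF !formE !mxE !det3E Sx Sy Sw Sz l0; field.
Qed.

Lemma crs_dot x y w z : S x -> S y -> S w -> S z ->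
  crs x y w * dot x w z + dot x y w * crs x w z = dot x w w * crs x y z.
Proof.
have [l0 Sx Sy Sw Sz|l0 Sx Sy Sw Sz] := eqVneq lam 0; last first.
  rewrite !dot_form// !crsE.
  have e1 := dep4 x y w z w; have e2 := dep4 x y w z x.
  have e3 := sf_form l0 Sx.
  move: e1 e2; rewrite (formC z w) (formC y x) (formC w x) (formC z x) => e1 e2.
  apply/eqP; rewrite -subr_eq0; apply/eqP.
  transitivity (- kk * (det3 y w z * form x w - det3 x w z * form y w
   + det3 x y z * form w w - det3 x y w * form w z) +
    kk * lam * form x w * (det3 y w z * form x x - det3 x w z * form x y
   + det3 x y z * form x w - det3 x y w * form x z)
   + kk * det3 y w z * form x w * (1 - lam * form x x)); first by ring.
  by rewrite e1 e2 e3 subrr !mulr0 !addr0.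
rewrite !crsE /kk l0 eqxx !mul1r; move: Sx Sy Sw Sz; rewrite !sf_zero// => Sx Sy Sw Sz.
by rewrite -l0 !dotE !qF !formE !mxE !det3E Sx Sy Sw Sz l0; field.
Qed.

Definition tangent x (h : 'rV[R]_3) := if lam == 0 then h 0 0 = 0 else form x h = 0.

Lemma dirE x y : dir x y = y - c (dist x y) *: x.
Proof. by rewrite dirv.unlock dst.unlock cs.unlock. Qed.

Lemma tangent_dir x y : S x -> S y -> c (dist x y) = 1 - lam * q x y / 2 ->
  tangent x (dir x y).
Proof.
move=> Sx Sy e; rewrite /tangent; case: eqP => [l0|/eqP l0].
  move: Sx Sy; rewrite !sf_zero// dirE !mxE c_zero// => -> ->; ring.
by rewrite dirE !form_lin e -(q_form l0 Sx Sy) mulrAC (sf_form l0 Sx) mul1r subrr.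
Qed.

Lemma form_ge0 u : 0 <= lam -> 0 <= form u u.
Proof.
by move=> l0; rewrite formE /sg ltNge l0/= mul1r -!expr2 !addr_ge0 ?sqr_ge0.
Qed.

(** The reversed Cauchy-Schwarz inequality for two vectors of the upper sheet of
    the hyperboloid. *)
Lemma hyp_gap x y : lam < 0 -> S x -> S y -> 1 <= lam * form x y.
Proof.
move=> l0; rewrite !sf_neg// !formE /sg l0 => -[ex x0] [ey y0].
have li0 : lam^-1 < 0 by rewrite invr_lt0.
suff : lam^-1 >= -1 * (x 0 0 * y 0 0) + x 0 1 * y 0 1 + x 0 2%:R * y 0 2%:R.
  by move=> h; rewrite -[leLHS](@mulfV _ lam) ?lt_eqF// ler_nM2l.
set a := - lam^-1; have a0 : 0 < a by rewrite oppr_gt0.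
have -> : lam^-1 = - a by rewrite opprK.
move: ex ey; have -> : lam^-1 = - a by rewrite opprK.
move: (x 0 0) (x 0 1) (x 0 2%:R) (y 0 0) (y 0 1) (y 0 2%:R) x0 y0.
move=> x0 x1 x2 y0 y1 y2 px py ex ey.
suff : x1 * y1 + x2 * y2 + a <= x0 * y0 by lra.
rewrite -[leRHS]ger0_norm; last by rewrite mulr_ge0// ltW.
rewrite (le_trans (ler_norm _))// -ler_sqr ?nnegrE// !real_normK ?num_real//.
have -> : (x0 * y0) ^+ 2 = (x1 ^+ 2 + x2 ^+ 2 + a) * (y1 ^+ 2 + y2 ^+ 2 + a).
  rewrite exprMn; congr (_ * _); lra.
have := sqr_ge0 (x1 * y2 - x2 * y1).
have := mulr_ge0 (ltW a0) (sqr_ge0 (x1 - y1)).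
have := mulr_ge0 (ltW a0) (sqr_ge0 (x2 - y2)).
nra.
Qed.

(** On the sphere a chord is at most a diameter; equality characterizes antipodal
    points. *)
Lemma lq_le x y : S x -> S y -> lam * q x y <= 4.
Proof.
move=> Sx Sy; case: (sgn_cases lam) => l0; [|by rewrite l0 mul0r|].
  have l1 : lam != 0 by rewrite gt_eqF.
  have := form_ge0 (x + y) (ltW l0).
  rewrite !form_lin (formC y x) -(pmulr_rge0 _ l0) => h.
  have := sf_form l1 Sx; have := sf_form l1 Sy; have := q_form l1 Sx Sy; lra.
have l1 : lam != 0 by rewrite lt_eqF.
have := hyp_gap l0 Sx Sy; rewrite (q_form l1 Sx Sy); lra.
Qed.

Lemma q_ge0 x y : S x -> S y -> 0 <= q x y.
Proof.
move=> Sx Sy; case: (leP 0 lam) => l0; first by rewrite qF form_ge0.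
have := hyp_gap l0 Sx Sy; rewrite (q_form _ Sx Sy) ?lt_eqF// => h.
by rewrite -(nmulr_rle0 _ l0); lra.
Qed.

Lemma cosh_arcosh (u : R) : 1 <= u -> cosh (arcosh u) = u.
Proof.
move=> u1; rewrite /cosh /arcosh.
have uu : 0 <= u ^+ 2 - 1 by nra.
have := sqr_sqrtr uu; have := sqrtr_ge0 (u ^+ 2 - 1).
move: (Num.sqrt _) => v v0 v2.
have uv : 0 < u + v by lra.
rewrite expRN lnK ?posrE//.
have uvn : u + v != 0 by rewrite gt_eqF.
have -> : (u + v)^-1 = u - v; last by field.
by apply: (mulfI uvn); rewrite mulfV//; lra.
Qed.

Lemma arcosh_ge0 (u : R) : 1 <= u -> 0 <= arcosh u.
Proof.
by move=> u1; rewrite /arcosh ln_ge0// (le_trans u1)// lerDl sqrtr_ge0.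
Qed.

Lemma q_bounds x y : S x -> S y -> 0 < lam -> -1 <= lam * form x y <= 1.
Proof.
move=> Sx Sy l0; have l1 : lam != 0 by rewrite gt_eqF.
rewrite (q_form l1 Sx Sy); have := lq_le Sx Sy; have := q_ge0 Sx Sy => q0.
have := mulr_ge0 (ltW l0) q0; lra.
Qed.

Lemma distE x y : dist x y =
  if 0 < lam then acos (lam * form x y) / Num.sqrt lam
  else if lam == 0 then Num.sqrt (form (x - y) (x - y))
  else arcosh (lam * form x y) / Num.sqrt `|lam|.
Proof. by rewrite dst.unlock ip.unlock. Qed.

Lemma c_dist x y : S x -> S y -> c (dist x y) = 1 - lam * q x y / 2.
Proof.
move=> Sx Sy; case: (sgn_cases lam) => l0.
- rewrite c_pos// distE l0 mulrC divfK ?gt_eqF ?sqrtr_gt0//.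
  by rewrite acosK -?(q_form _ Sx Sy) ?gt_eqF// in_itv/=; apply: q_bounds.
- by rewrite c_zero// l0; lra.
- rewrite c_neg// distE ltNge ltW//= lt_eqF// ltr0_norm//.
  rewrite mulrC divfK ?gt_eqF ?sqrtr_gt0 ?oppr_gt0//.
  by rewrite cosh_arcosh ?hyp_gap// (q_form _ Sx Sy)// lt_eqF.
Qed.

Lemma dist_ge0 x y : S x -> S y -> 0 <= dist x y.
Proof.
move=> Sx Sy; rewrite distE; case: ifP => l0.
  by rewrite divr_ge0 ?sqrtr_ge0// acos_ge0//; apply: q_bounds.
case: eqP => // /eqP l1; rewrite divr_ge0 ?sqrtr_ge0// arcosh_ge0//.
by apply: hyp_gap => //; rewrite lt_neqAle l1 leNgt l0.
Qed.

Lemma dist_half x y : S x -> S y -> 0 < lam -> dist x y / 2 <= pi / 2 / Num.sqrt lam.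
Proof.
move=> Sx Sy l0; rewrite mulrAC ler_pM2r ?invr_gt0// distE l0.
by rewrite ler_pM2r ?invr_gt0 ?sqrtr_gt0// acos_lepi//; apply: q_bounds.
Qed.

(** The closed version of [adm]; half of a distance always satisfies it. *)
Definition adm_le t := 0 < lam -> t <= pi / 2 / Num.sqrt lam.

Lemma s_ge0 t : 0 <= t -> adm_le t -> 0 <= s t.
Proof. by rewrite le_eqVlt => /predU1P[<- _|t0 a]; rewrite ?s0// -(s0 lam) ltW// s_lt. Qed.

Lemma s_mono t r : 0 <= t -> 0 <= r -> adm_le t -> adm_le r -> (s t <= s r) = (t <= r).
Proof.
move=> t0 r0 at_ ar; case: (ltgtP t r) => [tr|rt|->]; last by rewrite lexx.
  by rewrite ltW// s_lt.
by rewrite leNgt s_lt.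
Qed.

Lemma q_dist x y : S x -> S y -> q x y = 4 * s (dist x y / 2) ^+ 2.
Proof.
move=> Sx Sy; have [l0|l0] := eqVneq lam 0.
  rewrite s_zero// distE l0 ltxx eqxx -l0 exprMn sqr_sqrtr ?form_ge0 ?l0//.
  by rewrite -l0 qF; field.
have := c_dist Sx Sy; rewrite -[in c _](divfK (_ : (2 : R) != 0) (dist x y))// mulrC.
rewrite c_double => e.
by apply: (mulfI l0); lra.
Qed.

(** This and [dist_lt] replace distance comparisons by polynomial conditions;
    the bound on [r] keeps [s] increasing. *)
Lemma dist_le x y r : S x -> S y -> 0 <= r -> adm_le (r / 2) ->
  (dist x y <= r) = (q x y <= 4 * s (r / 2) ^+ 2).
Proof.
move=> Sx Sy r0 ar; have d0 := dist_ge0 Sx Sy.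
rewrite q_dist// ler_pM2l// ler_sqr ?nnegrE ?s_ge0 ?divr_ge0//; last exact: dist_half.
rewrite s_mono ?divr_ge0//; last exact: dist_half.
by rewrite ler_pM2r// invr_gt0.
Qed.

Lemma dist_lt x y r : S x -> S y -> 0 <= r -> adm_le (r / 2) ->
  (dist x y < r) = (q x y < 4 * s (r / 2) ^+ 2).
Proof.
move=> Sx Sy r0 ar; have d0 := dist_ge0 Sx Sy.
rewrite q_dist// ltr_pM2l// ltr_sqr ?nnegrE ?s_ge0 ?divr_ge0//; last exact: dist_half.
rewrite !ltNge s_mono ?divr_ge0//; last exact: dist_half.
by rewrite ler_pM2r// invr_gt0.
Qed.

Lemma distC x y : dist x y = dist y x.
Proof.
rewrite !distE (formC y x) (_ : form (y - x) (y - x) = form (x - y) (x - y))//.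
by rewrite -!qF qC.
Qed.

Lemma form_dir x y z : S x -> S y -> S z -> form (dir x y) (dir x z) = dot x y z.
Proof.
move=> Sx Sy Sz; rewrite !dirE !c_dist// !form_lin.
have [l0|l0] := eqVneq lam 0.
  rewrite !dotE !qE (formC y x).
  by rewrite l0; field.
rewrite -(q_form l0 Sx Sy) -(q_form l0 Sx Sz) dot_form// (formC y x).
have := sf_form l0 Sx.
set A := form x x => lA; have -> : A = lam^-1 by rewrite -[RHS]mulr1 -lA mulKf.
by field.
Qed.

(** [form] induces a Riemannian metric also on the hyperboloid: there,
    orthogonality to the timelike vector [x] makes [h] spacelike, by the Lagrange
    identity on the last two coordinates. *)
Lemma tangent_definite x h : S x -> tangent x h -> form h h <= 0 -> h = 0.
Proof.
move=> Sx; case: (leP 0 lam) => l0.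
  move=> _; rewrite formE /sg ltNge l0/= mul1r -!expr2 => h0.
  have h3 := sqr_ge0 (h 0 0); have h4 := sqr_ge0 (h 0 1); have h5 := sqr_ge0 (h 0 2%:R).
  by apply: row3P; rewrite mxE; apply/eqP; rewrite -sqrf_eq0; apply/eqP; lra.
rewrite /tangent lt_eqF// !formE /sg l0; move: Sx; rewrite sf_neg// formE /sg l0.
have li0 : lam^-1 < 0 by rewrite invr_lt0.
have h0E : forall a b : 'rV[R]_3, a 0 0 = 0 -> a 0 1 = 0 -> a 0 2%:R = 0 -> a = 0.
  by move=> a b a0 a1 a2; apply: row3P; rewrite mxE.
move=> [ex x0] eh hh.
suff [e0 [e1 e2]] : h 0 0 = 0 /\ h 0 1 = 0 /\ h 0 2%:R = 0 by apply: (h0E h h).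
move: ex x0 eh hh li0.
move: (x 0 0) (x 0 1) (x 0 2%:R) (h 0 0) (h 0 1) (h 0 2%:R) lam^-1.
move=> x0 x1 x2 h0 h1 h2 a ex px eh hh a0.
have e0 : x0 * h0 = x1 * h1 + x2 * h2 by lra.
have e1 : (x0 * h0) ^+ 2 = (x1 * h1 + x2 * h2) ^+ 2 by rewrite e0.
have e2 : x0 ^+ 2 * (h1 ^+ 2 + h2 ^+ 2 - h0 ^+ 2) =
  (- a) * (h1 ^+ 2 + h2 ^+ 2) + (x1 * h2 - x2 * h1) ^+ 2.
  have -> : x0 ^+ 2 * (h1 ^+ 2 + h2 ^+ 2 - h0 ^+ 2) =
     x0 ^+ 2 * (h1 ^+ 2 + h2 ^+ 2) - (x0 * h0) ^+ 2 by ring.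
  rewrite e1 (_ : x0 ^+ 2 = x1 ^+ 2 + x2 ^+ 2 - a); last by lra.
  by ring.
have p0 : 0 < x0 ^+ 2 by rewrite exprn_gt0.
have h3 : x0 ^+ 2 * (h1 ^+ 2 + h2 ^+ 2 - h0 ^+ 2) <= 0.
  by rewrite pmulr_rle0//; lra.
have h4 := sqr_ge0 (x1 * h2 - x2 * h1).
have h5 : (- a) * (h1 ^+ 2 + h2 ^+ 2) <= 0 by lra.
have h6 : h1 ^+ 2 + h2 ^+ 2 <= 0 by rewrite pmulr_rle0 in h5; lra.
have h7 := sqr_ge0 h1; have h8 := sqr_ge0 h2.
have z1 : h1 = 0 by apply/eqP; rewrite -sqrf_eq0; apply/eqP; lra.
have z2 : h2 = 0 by apply/eqP; rewrite -sqrf_eq0; apply/eqP; lra.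
split=> //; move/eqP: e0; rewrite z1 z2 !mulr0 addr0 mulf_eq0 gt_eqF//= => /eqP//.
Qed.

(** The direction from [x] to [y] is a tangent vector of square norm zero. *)
Lemma q_eq0 x y : S x -> S y -> q x y = 0 -> x = y.
Proof.
move=> Sx Sy q0.
have : dir x y = 0.
  apply: (@tangent_definite x) => //; first exact: tangent_dir (c_dist Sx Sy).
  by rewrite form_dir// dot_diag q0 mul0r.
by rewrite dirE c_dist// q0 mulr0 mul0r subr0 scale1r => /subr0_eq.
Qed.

Lemma q_gt0 x y : S x -> S y -> x != y -> 0 < q x y.
Proof.
move=> Sx Sy xy; rewrite lt_neqAle q_ge0// andbT eq_sym.
by apply: contra xy => /eqP/q_eq0 ->.
Qed.

Lemma dist_xx x : S x -> dist x x = 0.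
Proof.
move=> Sx; apply/eqP; rewrite eq_le dist_ge0// andbT.
have a : adm_le (0 / 2) by rewrite mul0r => l0; rewrite !divr_ge0 ?pi_ge0 ?sqrtr_ge0.
by rewrite dist_le// qxx mul0r s0 expr0n/= mulr0.
Qed.

End Geom.

(** * Segments, triangles and disks as cones of the ambient space *)
Section Seg.
Variables (R : realType) (lam : R).
Implicit Types (t r : R) (x y z w u : 'rV[R]_3).
Local Notation s := (sn lam).
Local Notation c := (cs lam).
Local Notation S := (on_space lam).
Local Notation form := (ip lam).
Local Notation dist := (dst lam).
Local Notation dir := (dirv lam).
Local Notation q := (chord_sq lam).
Local Notation dot := (dir_dot lam).
Local Notation crs := (orient lam).
Local Notation tangent := (tangent lam).

Lemma segmentE x y z : segment lam x y z <-> S z /\ dist x z + dist z y = dist x y.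
Proof. by rewrite on_space.unlock dst.unlock. Qed.

Lemma c_half_ge0 x y : S x -> S y -> 0 <= c (dist x y / 2).
Proof.
move=> Sx Sy; have d0 : 0 <= dist x y / 2 by rewrite divr_ge0// dist_ge0.
case: (sgn_cases lam) => l0.
- have := dist_half Sx Sy l0; rewrite le_eqVlt => /predU1P[->|h].
    rewrite c_pos// mulrC divfK ?cos_pihalf// gt_eqF// sqrtr_gt0//.
  by rewrite ltW// c_gt0// => _.
- by rewrite c_zero.
- by rewrite ltW// c_gt0// => l1; rewrite ltNge ltW in l0.
Qed.

Lemma s_dist_ge0 x y : S x -> S y -> 0 <= s (dist x y).
Proof.
move=> Sx Sy; rewrite -[dist x y](divfK (_ : (2 : R) != 0))// mulrC s_double.
rewrite mulr_ge0 ?c_half_ge0// mulr_ge0// s_ge0//; last exact: dist_half.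
by rewrite divr_ge0// dist_ge0.
Qed.

Lemma dot_s x y : S x -> S y -> dot x y y = s (dist x y) ^+ 2.
Proof.
move=> Sx Sy; rewrite dot_diag (q_dist Sx Sy) -[in RHS](divfK (_ : (2 : R) != 0) (dist x y))//.
rewrite [_ / 2 * 2]mulrC s_double; have := c2s2 lam (dist x y / 2).
set a := s _; set b := c _ => e.
rewrite !exprMn (_ : b ^+ 2 = 1 - lam * a ^+ 2); last by lra.
by field.
Qed.

(** The squared chord of the length [a + b]. *)
Lemma s_half_sum (a b : R) : 4 * s ((a + b) / 2) ^+ 2 =
  4 * s (a / 2) ^+ 2 + 4 * s (b / 2) ^+ 2 + 2 * s a * s b
  - 8 * lam * s (a / 2) ^+ 2 * s (b / 2) ^+ 2.
Proof.
have dbl (t : R) : s t = 2 * s (t / 2) * c (t / 2).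
  by rewrite -s_double mulrC divfK.
rewrite (dbl a) (dbl b) [(a + b) / 2]mulrDl sD.
have eA := c2s2 lam (a / 2); have eB := c2s2 lam (b / 2).
set A := s (a / 2) in eA *; set B := s (b / 2) in eB *.
set A' := c (a / 2) in eA *; set B' := c (b / 2) in eB *.
transitivity (4 * A ^+ 2 * B' ^+ 2 + 4 * B ^+ 2 * A' ^+ 2 + 8 * A * A' * B * B').
  by ring.
rewrite (_ : A' ^+ 2 = 1 - lam * A ^+ 2); last by lra.
rewrite (_ : B' ^+ 2 = 1 - lam * B ^+ 2); last by lra.
by ring.
Qed.

(** The defect in the triangle inequality, in squared chords. It vanishes exactly
    when the directions from [z] to [x] and [y] are opposite, which makes
    segments accessible to linear algebra. *)
Lemma q_sum z x y : S x -> S y -> S z ->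
  4 * s ((dist z x + dist z y) / 2) ^+ 2 - q x y =
  2 * (s (dist z x) * s (dist z y) + dot z x y).
Proof.
by move=> Sx Sy Sz; rewrite s_half_sum (q_third _ z) (q_dist Sz Sx) (q_dist Sz Sy); field.
Qed.

(** The Cauchy-Schwarz inequality in the tangent plane at [z]: the defect is the
    square of [crs]. *)
Lemma dot_sqr_le z x y : S x -> S y -> S z ->
  dot z x y ^+ 2 <= (s (dist z x) * s (dist z y)) ^+ 2.
Proof.
move=> Sx Sy Sz; rewrite exprMn -(dot_s Sz Sx) -(dot_s Sz Sy) mulrC.
have := crs_mul Sz Sx Sy Sx; rewrite (crs_swap _ z x y) (dotC _ z y x) mulrN -expr2 => e.
have := sqr_ge0 (crs z x y); lra.
Qed.

Lemma dot_ge x y z : S x -> S y -> S z ->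
  0 <= s (dist z x) * s (dist z y) + dot z x y.
Proof.
move=> Sx Sy Sz; have := dot_sqr_le Sx Sy Sz.
rewrite -ler_sqrt ?sqr_ge0// !sqrtr_sqr.
rewrite (ger0_norm (mulr_ge0 _ _)) ?s_dist_ge0//.
by move=> h; have := ler_norm (- dot z x y); rewrite normrN; lra.
Qed.

Lemma dist_triangle z x y : S x -> S y -> S z -> dist x y <= dist z x + dist z y.
Proof.
move=> Sx Sy Sz; have dx := dist_ge0 Sz Sx; have dy := dist_ge0 Sz Sy.
case: (pselect (adm_le lam ((dist z x + dist z y) / 2))) => [a|].
  rewrite dist_le ?addr_ge0// -subr_ge0 q_sum// pmulr_rge0//; exact: dot_ge.
rewrite /adm_le => /not_implyP[l0 /negP]; rewrite -ltNge => h.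
by have := dist_half Sx Sy l0; lra.
Qed.

Lemma tangentD x h h' : tangent x h -> tangent x h' -> tangent x (h + h').
Proof.
rewrite /tangent; case: eqP => _; rewrite ?mxE ?form_lin => -> ->; exact: addr0.
Qed.

Lemma tangentZ x a h : tangent x h -> tangent x (a *: h).
Proof.
rewrite /tangent; case: eqP => _; rewrite ?mxE ?form_lin => ->; exact: mulr0.
Qed.

Lemma tangent_self x a : S x -> tangent x (a *: x) -> a = 0.
Proof.
move=> Sx; rewrite /tangent; case: eqP => [l0|/eqP l0].
  by move: Sx; rewrite sf_zero// mxE => ->; rewrite mulr1.
rewrite form_lin => e; have := sf_form l0 Sx => e2.
by rewrite -[a]mulr1 -e2 mulrCA e mulr0.
Qed.

Lemma dir_tangent x y : S x -> S y -> tangent x (dir x y).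
Proof. by move=> Sx Sy; apply: tangent_dir => //; apply: c_dist. Qed.

(** Each ray from the origin meets the model in at most one point. *)
Lemma scale_sf x a : S x -> S (a *: x) -> 0 <= a -> a = 1.
Proof.
move=> Sx Sax a0; have [l0|l0] := eqVneq lam 0.
  by move: Sx Sax; rewrite !sf_zero// mxE => ->; rewrite mulr1.
have := sf_form l0 Sax; rewrite !form_lin !(mulrCA lam) (sf_form l0 Sx) mulr1 -expr2.
by move=> /eqP; rewrite sqrp_eq1// => /eqP.
Qed.

(** The directions at [z] to [x] and [y] are opposite, as [x] and [y] have
    nonnegative coefficients. So the chords add; on the sphere one must still
    exclude that [dist z x + dist z y] goes more than half way around. *)
Lemma cone_segment x y z a b : S x -> S y -> S z -> 0 <= a -> 0 <= b ->
  z = a *: x + b *: y -> segment lam x y z.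
Proof.
move=> Sx Sy Sz a0 b0 zE; apply/segmentE; split=> //; rewrite (distC _ x z).
move: a0; rewrite le_eqVlt => /predU1P[a0|a0].
  have zb : z = b *: y by rewrite zE -a0 scale0r add0r.
  have b1 : b = 1 by apply: (scale_sf Sy) => //; rewrite -zb.
  by rewrite zb b1 scale1r dist_xx// addr0 distC.
move: b0; rewrite le_eqVlt => /predU1P[b0|b0].
  have za : z = a *: x by rewrite zE -b0 scale0r addr0.
  have a1 : a = 1 by apply: (scale_sf Sx) => //; rewrite -?za// ltW.
  by rewrite za a1 scale1r dist_xx// add0r.
have e0 : a *: dir z x + b *: dir z y = (1 - a * c (dist z x) - b * c (dist z y)) *: z.
  by rewrite !dirE !scalerBr !scalerBl addrACA -zE !scalerA scale1r addrA.
have t0 : 1 - a * c (dist z x) - b * c (dist z y) = 0.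
  by apply: (tangent_self Sz); rewrite -e0; apply: tangentD; apply: tangentZ; apply: dir_tangent.
rewrite t0 scale0r in e0.
have eu : a *: dir z x = - (b *: dir z y) by apply/eqP; rewrite -addr_eq0 e0.
have sx := s_dist_ge0 Sz Sx; have sy := s_dist_ge0 Sz Sy.
have ab : a * s (dist z x) = b * s (dist z y).
  apply/eqP; rewrite -(@eqrXn2 _ 2) ?mulr_ge0 ?(ltW a0) ?(ltW b0)// !exprMn -(dot_s Sz Sx) -(dot_s Sz Sy) -!form_dir//.
  have := congr1 (fun u => form u u) eu; rewrite !form_lin opprK => e.
  by apply/eqP; rewrite !expr2 -!mulrA.
have dE : dot z x y = - (s (dist z x) * s (dist z y)).
  have := congr1 (fun u => form u (dir z y)) eu; rewrite !form_lin !form_dir// (dot_s Sz Sy) => e.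
  apply: (mulfI (lt0r_neq0 a0)); rewrite e mulrN (mulrA a (s _)) ab; ring.
have qE : 4 * s ((dist z x + dist z y) / 2) ^+ 2 = q x y.
  by apply/eqP; rewrite -subr_eq0 q_sum// dE subrr mulr0.
have dx := dist_ge0 Sz Sx; have dy := dist_ge0 Sz Sy; have dxy := dist_ge0 Sx Sy.
(* Otherwise the sine of the sum of the distances is both nonpositive and
   nonnegative, so both distances are half a great circle. But then the tangential
   coefficient [t0] reads [1 + a + b = 0]. *)
have A : adm_le lam ((dist z x + dist z y) / 2).
  move=> l0; rewrite leNgt; apply/negP => h.
  have k0 : 0 < Num.sqrt lam by rewrite sqrtr_gt0.
  have ss : 0 <= s (dist z x + dist z y).
    rewrite -(pmulr_rge0 _ b0) sD mulrDr [b * (c _ * _)]mulrCA -ab.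
    rewrite (_ : _ + _ = s (dist z x) * (a * c (dist z x) + b * c (dist z y))); last by ring.
    by rewrite mulr_ge0// (_ : _ + _ = 1)//; lra.
  have hx := dist_half Sz Sx l0; have hy := dist_half Sz Sy l0.
  set th := Num.sqrt lam * (dist z x + dist z y).
  have th1 : pi < th.
    rewrite /th mulrC -ltr_pdivrMr//; move: h; rewrite mulrAC ltr_pM2r ?invr_gt0//.
  have e1 : Num.sqrt lam * dist z x <= pi.
    by rewrite mulrC -ler_pdivlMr//; move: hx; rewrite !(mulrAC _ (2^-1)) ler_pM2r ?invr_gt0.
  have e2 : Num.sqrt lam * dist z y <= pi.
    by rewrite mulrC -ler_pdivlMr//; move: hy; rewrite !(mulrAC _ (2^-1)) ler_pM2r ?invr_gt0.
  have th2 : th <= pi *+ 2 by rewrite /th mulrDr mulr2n lerD.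
  have sth : sin (th - pi) <= 0.
    move: ss; rewrite s_pos// pmulr_lge0 ?invr_gt0// -/th.
    by rewrite -{1}(subrK pi th) sinDpi oppr_ge0.
  have thE : th - pi = pi.
    apply/eqP; rewrite eq_le; apply/andP; split; first by rewrite mulr2n in th2; lra.
    rewrite leNgt; apply/negP => h2.
    suff : 0 < sin (th - pi) by rewrite ltNge sth.
    by apply: sin_gt0_pi; rewrite h2 subr_gt0 th1.
  have dzx : Num.sqrt lam * dist z x = pi.
    by move: thE; rewrite /th mulrDr; lra.
  have dzy : Num.sqrt lam * dist z y = pi.
    by move: thE; rewrite /th mulrDr dzx; lra.
  by move: t0; rewrite !c_pos// dzx dzy cospi; lra.
apply/eqP; rewrite eq_le; apply/andP; split; last by apply: dist_triangle.
have qd := q_dist Sx Sy; rewrite -qE in qd.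
have e3 : s ((dist z x + dist z y) / 2) ^+ 2 = s (dist x y / 2) ^+ 2 by lra.
have : (dist z x + dist z y) / 2 <= dist x y / 2.
  rewrite -(@s_mono _ lam) ?divr_ge0 ?addr_ge0//; last exact: dist_half.
  rewrite -ler_sqr ?nnegrE ?s_ge0 ?divr_ge0 ?addr_ge0 ?e3//; exact: dist_half.
lra.
Qed.

Lemma s_dist_gt0 x y : S x -> S y -> x != y -> lam * q x y < 4 -> 0 < s (dist x y).
Proof.
move=> Sx Sy xy h; rewrite lt_neqAle s_dist_ge0// andbT eq_sym -sqrf_eq0 -(dot_s Sx Sy).
by rewrite gt_eqF// dot_diag mulr_gt0 ?q_gt0//; lra.
Qed.

(** The directions from [z] to the endpoints are opposite, which gives the
    spherical interpolation formula
    [s (dist x y) * z = s (dist z y) * x + s (dist z x) * y]. *)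
Lemma segment_cone x y z : S x -> S y -> x != y -> lam * q x y < 4 ->
  segment lam x y z -> exists a b, [/\ 0 <= a, 0 <= b & z = a *: x + b *: y].
Proof.
move=> Sx Sy xy h /segmentE[Sz]; rewrite (distC _ x z) => e.
have sd := s_dist_gt0 Sx Sy xy h.
have sx := s_dist_ge0 Sz Sx; have sy := s_dist_ge0 Sz Sy.
have dE : dot z x y = - (s (dist z x) * s (dist z y)).
  have := q_sum Sx Sy Sz; rewrite e -(q_dist Sx Sy) subrr; lra.
have w0 : s (dist z y) *: dir z x + s (dist z x) *: dir z y = 0.
  apply: (@tangent_definite _ lam z) => //.
    by apply: tangentD; apply: tangentZ; apply: dir_tangent.
  rewrite !form_lin !form_dir// (dotC _ z y x) dE (dot_s Sz Sx) (dot_s Sz Sy).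
  by rewrite le_eqVlt; apply/orP; left; apply/eqP; ring.
have zE : s (dist x y) *: z = s (dist z y) *: x + s (dist z x) *: y.
  have := w0; rewrite !dirE !scalerBr addrACA !scalerA -opprD -scalerDl => /subr0_eq ->.
  by rewrite -e sD; congr (_ *: _); ring.
exists (s (dist z y) / s (dist x y)), (s (dist z x) / s (dist x y)).
split; rewrite ?divr_ge0// ?(ltW sd)//.
apply: (scalerI (lt0r_neq0 sd)); rewrite zE scalerDr !scalerA.
by congr (_ *: _ + _ *: _); rewrite mulrC divfK// gt_eqF.
Qed.

(** A disk of radius at most a quarter great circle is convex, for triangles. In
    the curved cases, being in a disk is a linear inequality on [form C z], and
    the coefficients satisfy [a + b + g >= 1] on the sphere and [<= 1] on the
    hyperboloid; the condition on [Q] gives the bound the matching sign. *)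
Lemma cone3_q_le C x y w z a b g Q : S C -> S x -> S y -> S w -> S z ->
  0 <= a -> 0 <= b -> 0 <= g -> z = a *: x + b *: y + g *: w ->
  (0 < lam -> lam * Q <= 2) ->
  q C x <= Q -> q C y <= Q -> q C w <= Q -> q C z <= Q.
Proof.
move=> SC Sx Sy Sw Sz a0 b0 g0 zE lQ qx qy qw.
have [l0|l0] := eqVneq lam 0.
  have abg : a + b + g = 1.
    by move: Sx Sy Sw Sz; rewrite zE !sf_zero// !mxE => -> -> ->; rewrite !mulr1.
  have CE : C - z = a *: (C - x) + b *: (C - y) + g *: (C - w).
    rewrite zE -[C in LHS]scale1r -abg; apply/rowP => i; rewrite !mxE; ring.
  rewrite qF CE; rewrite !qF in qx qy qw.
  have P (u v : 'rV[R]_3) : form u u <= Q -> form v v <= Q -> form u v <= Q.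
    have : 0 <= form (u - v) (u - v) by apply: form_ge0; rewrite l0.
    rewrite !form_lin (formC _ v u); lra.
  have h1 := P _ _ qx qy; have h2 := P _ _ qx qw; have h3 := P _ _ qy qw.
  move: qx qy qw h1 h2 h3; move: (C - x) (C - y) (C - w) => X' Y' W'.
  rewrite !form_lin (formC _ Y' X') (formC _ W' X') (formC _ W' Y').
  move: (form X' X') (form Y' Y') (form W' W') (form X' Y') (form X' W') (form Y' W').
  move=> X Y W XY XW YW.
  move=> hX hY hW hXY hXW hYW.
  rewrite -[leRHS]mul1r (_ : 1 = (a + b + g) ^+ 2); last by rewrite abg expr1n.
  rewrite -subr_ge0.
  rewrite (_ : _ - _ = a ^+ 2 * (Q - X) + b ^+ 2 * (Q - Y) + g ^+ 2 * (Q - W)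
     + 2 * (a * b * (Q - XY) + a * g * (Q - XW) + b * g * (Q - YW))); last by ring.
  by repeat first [by [] | by rewrite subr_ge0 | apply: mulr_ge0 | apply: addr_ge0].
have Cz : lam * form C z = a * (lam * form C x) + b * (lam * form C y) + g * (lam * form C w).
  by rewrite zE !form_lin; ring.
rewrite (q_form l0 SC Sz) (q_form l0 SC Sx) (q_form l0 SC Sy) (q_form l0 SC Sw) in Cz.
have n1 : (a + b + g) ^+ 2 = 1 + a * b * (lam * q x y) + a * g * (lam * q x w) + b * g * (lam * q y w).
  rewrite -(sf_form l0 Sz) zE !form_lin (formC _ y x) (formC _ w x) (formC _ w y).
  transitivity (a ^+ 2 * (lam * form x x) + b ^+ 2 * (lam * form y y) + g ^+ 2 * (lam * form w w)
    + 2 * (a * b * (lam * form x y) + a * g * (lam * form x w) + b * g * (lam * form y w))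
    + a * b * (lam * q x y) + a * g * (lam * q x w) + b * g * (lam * q y w)); last by ring.
  rewrite (q_form l0 Sx Sy) (q_form l0 Sx Sw) (q_form l0 Sy Sw).
  by rewrite (sf_form l0 Sx) (sf_form l0 Sy) (sf_form l0 Sw); field.
have qxy := q_ge0 Sx Sy; have qxw := q_ge0 Sx Sw; have qyw := q_ge0 Sy Sw.
case: (ltrgt0P lam) l0 => // l0 _.
  have A1 : 1 <= a + b + g.
    rewrite -(@expr_ge1 _ 2) ?addr_ge0// n1 -!addrA lerDl.
    by rewrite !(addr_ge0, mulr_ge0)// ltW.
  have {}lQ := lQ l0.
  suff : 1 - lam * q C z / 2 >= 1 - lam * Q / 2.
    by rewrite -subr_ge0 => h; rewrite -(ler_pM2l l0); lra.
  rewrite Cz.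
  have hx : 1 - lam * q C x / 2 >= 1 - lam * Q / 2 by rewrite -(ler_pM2l l0) in qx; lra.
  have hy : 1 - lam * q C y / 2 >= 1 - lam * Q / 2 by rewrite -(ler_pM2l l0) in qy; lra.
  have hw : 1 - lam * q C w / 2 >= 1 - lam * Q / 2 by rewrite -(ler_pM2l l0) in qw; lra.
  have hQ : 0 <= 1 - lam * Q / 2 by lra.
  have h1 := ler_wpM2l a0 hx; have h2 := ler_wpM2l b0 hy; have h3 := ler_wpM2l g0 hw.
  have h4 := ler_wpM2r hQ A1; lra.
have A1 : a + b + g <= 1.
  have h1 : a * b * (lam * q x y) <= 0 by rewrite mulr_ge0_le0 ?mulr_ge0// mulr_le0_ge0// ltW.
  have h2 : a * g * (lam * q x w) <= 0 by rewrite mulr_ge0_le0 ?mulr_ge0// mulr_le0_ge0// ltW.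
  have h3 : b * g * (lam * q y w) <= 0 by rewrite mulr_ge0_le0 ?mulr_ge0// mulr_le0_ge0// ltW.
  by rewrite -(@expr_le1 _ 2) ?addr_ge0// n1; lra.
suff : 1 - lam * q C z / 2 <= 1 - lam * Q / 2.
  by rewrite -subr_ge0 => h; rewrite -(ler_nM2l l0); lra.
rewrite Cz.
have hx : 1 - lam * q C x / 2 <= 1 - lam * Q / 2 by rewrite -(ler_nM2l l0) in qx; lra.
have hy : 1 - lam * q C y / 2 <= 1 - lam * Q / 2 by rewrite -(ler_nM2l l0) in qy; lra.
have hw : 1 - lam * q C w / 2 <= 1 - lam * Q / 2 by rewrite -(ler_nM2l l0) in qw; lra.
have hQ : 0 <= 1 - lam * Q / 2.
  have : lam * Q <= 0 by rewrite mulr_le0_ge0 ?(ltW l0)// (le_trans _ qx)// q_ge0.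
  lra.
have h1 := ler_wpM2l a0 hx; have h2 := ler_wpM2l b0 hy; have h3 := ler_wpM2l g0 hw.
have h4 := ler_wpM2r hQ A1; lra.
Qed.

Lemma cone2_normal x y a b : S x -> S y -> 0 < a -> 0 < b -> lam * q x y < 4 ->
  exists2 N, 0 < N & S (N^-1 *: (a *: x + b *: y)).
Proof.
move=> Sx Sy a0 b0 h; have [l0|l0] := eqVneq lam 0.
  exists (a + b); first exact: addr_gt0.
  move: Sx Sy; rewrite !sf_zero// !mxE => -> ->.
  by rewrite !mulr1 mulVf// gt_eqF// addr_gt0.
set e := a *: x + b *: y.
have e0 : 0 < lam * form e e.
  rewrite /e !form_lin (formC _ y x).
  rewrite (_ : lam * _ = a ^+ 2 * (lam * form x x) + b ^+ 2 * (lam * form y y)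
    + 2 * (a * b) * (lam * form x y)); last by ring.
  rewrite (sf_form l0 Sx) (sf_form l0 Sy) (q_form l0 Sx Sy).
  have h1 : 0 < a * b by rewrite mulr_gt0.
  have h2 : a * b * (lam * q x y) < a * b * 4 by rewrite ltr_pM2l.
  have := sqr_ge0 (a - b); lra.
exists (Num.sqrt (lam * form e e)); first by rewrite sqrtr_gt0.
set N := Num.sqrt _; have N0 : 0 < N by rewrite sqrtr_gt0.
have N2 : N ^+ 2 = lam * form e e by rewrite sqr_sqrtr// ltW.
have ne : form (N^-1 *: e) (N^-1 *: e) = lam^-1.
  apply: (mulfI l0); rewrite formZl formZr !(mulrCA lam) -N2 divff//.
  by field; rewrite gt_eqF.
case: (ltrgt0P lam) l0 => // l0 _; first by rewrite sf_pos.
rewrite sf_neg//; split=> //; move: Sx Sy; rewrite !sf_neg// => -[_ x0] [_ y0].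
by rewrite !mxE mulr_gt0 ?invr_gt0// addr_gt0// mulr_gt0.
Qed.

(** Geodesic convexity fills triangles: normalize [a x + b y] to a point of the
    side, then join it to [z]. *)
Lemma cone3_mem (D : set 'rV[R]_3) x y z p a b g : D `<=` S -> geodesically_convex lam D ->
  D x -> D y -> D z -> S p -> lam * q x y < 4 -> 0 < a -> 0 < b -> 0 <= g ->
  p = a *: x + b *: y + g *: z -> D p.
Proof.
move=> DS Dc Dx Dy Dz Sp h a0 b0 g0 pE.
have [N N0 SN] := cone2_normal (DS _ Dx) (DS _ Dy) a0 b0 h.
set e := N^-1 *: _ in SN.
have De : D e.
  apply: (Dc x y) => //; apply: (@cone_segment x y e (N^-1 * a) (N^-1 * b)); rewrite ?mulr_ge0 ?invr_ge0 ?ltW//; try exact: DS.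
  by rewrite /e scalerDr !scalerA.
apply: (Dc e z) => //; apply: (@cone_segment e z p N g) => //; try exact: DS; first exact: ltW.
by rewrite /e scalerA divff ?gt_eqF// scale1r.
Qed.

End Seg.

(** * The hinge inequality *)

(** [tau x y] is the tangent of half the distance and [phi x y] the base angle
    of the isosceles triangle over [x y] whose legs have tangent [T]. *)
HB.lock Definition ang (R : realType) (lam : R) (x y z : 'rV[R]_3) : R := angle lam x y z.
HB.lock Definition tau (R : realType) (lam : R) (x y : 'rV[R]_3) : R := tn lam (dst lam x y / 2).
HB.lock Definition phi (R : realType) (lam T : R) (x y : 'rV[R]_3) : R := acos (tau lam x y / T).

Section HingeNum.
Variables (R : realType) (lam T : R).
Implicit Types (p r m w a b : R).

(** The power of the vertex [z] with respect to the circle with diameter [x y],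
    computed along the side from [x] (left) and from [y] (right). Here [p], [r],
    [m] are half-side tangents, [Qp], [Qr], [Qm] quarters of squared chords, and
    [ca], [cb] cosines of the angles at [x] and [y] times [m / (1 + lam m ^ 2)],
    [r / (1 + lam r ^ 2)]. *)
Lemma power_eq p r m ca cb P Qp Qr Qm : P = 1 + lam * p ^+ 2 -> 0 < P ->
  Qp * P = p ^+ 2 ->
  4 * p * ca = P * (2 * (Qp + Qm - Qr) - 4 * lam * Qp * Qm) ->
  4 * p * cb = P * (2 * (Qp + Qr - Qm) - 4 * lam * Qp * Qr) ->
  p * ca - Qm = p * cb - Qr.
Proof.
move=> PE P0 QpE ea eb.
have l1 : lam * (Qp * P) = P - 1 by rewrite QpE PE; ring.
have h1 : lam * Qp * P * Qm = (P - 1) * Qm by rewrite -l1; ring.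
have h2 : lam * Qp * P * Qr = (P - 1) * Qr by rewrite -l1; ring.
lra.
Qed.

(** In [hinge_num], [ca] and [sa] are the cosine and sine of the angle [b] at
    [y]. The circle cuts on the ray from [y] a chord with half-tangent [u], and
    the vertex [z] lies beyond it, while [r <= T]. The conclusion is the sign of
    [p sin a - w cos a], expressed through [b]. *)
Lemma far_side_ge0 p r w ca sa u y : 0 < p -> 0 < r -> r <= T -> 0 <= w -> 0 <= sa ->
  T ^+ 2 = p ^+ 2 + w ^+ 2 -> ca ^+ 2 + sa ^+ 2 = 1 -> -1 < lam * T ^+ 2 -> 0 < T ->
  u = p * ca + w * sa -> y = w * ca - p * sa -> 0 <= y -> 0 < ca -> p <= T * ca ->
  u <= r ->
  0 <= p * (1 + lam * p ^+ 2) * r * sa - w * p * (1 - lam * r ^+ 2)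
       + w * r * ca * (1 - lam * p ^+ 2).
Proof.
move=> p0 r0 rT w0 sa0 T2 cs1 lT T0 uE yE y0 ca0 pT ur.
set g := p * sa + w * ca.
have u0 : 0 <= u by rewrite uE addr_ge0// mulr_ge0// ltW.
have g0 : 0 <= g by rewrite /g addr_ge0 ?mulr_ge0// ltW.
have wupy : w * u - p * y = T ^+ 2 * sa by rewrite uE yE T2; ring.
have -> : p * (1 + lam * p ^+ 2) * r * sa - w * p * (1 - lam * r ^+ 2)
       + w * r * ca * (1 - lam * p ^+ 2) =
  T ^+ 2 * sa * (ca + lam * p * u) + (r - u) * (g - lam * p ^+ 2 * y + lam * w * p * (r + u)).
  have -> : T ^+ 2 * sa * (ca + lam * p * u) = (p ^+ 2 + w ^+ 2) * sa * ca + lam * p * u * (w * u - p * y).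
    by rewrite wupy T2; ring.
  transitivity (p * (1 + lam * p ^+ 2) * r * sa - w * p * (ca ^+ 2 + sa ^+ 2) + w * p * lam * r ^+ 2
       + w * r * ca * (1 - lam * p ^+ 2)); first by rewrite cs1; ring.
  by rewrite /g uE yE; ring.
apply: addr_ge0; apply: mulr_ge0; rewrite ?subr_ge0//.
  by rewrite mulr_ge0// sqr_ge0.
  case: (leP 0 lam) => l0; first by rewrite addr_ge0 ?(ltW ca0)// !mulr_ge0// ltW.
  have uT : u <= T by rewrite (le_trans ur).
  have h1 : - lam * p * u <= - lam * p * T.
    by rewrite ler_wpM2l// mulr_ge0// ?ltW// oppr_gt0.
  have h2 : - lam * p * T * T <= p.
    rewrite (_ : _ * T * T = p * (- (lam * T ^+ 2))); last by ring.
    by rewrite ger_pMr//; lra.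
  have h3 : - lam * p * T <= ca.
    by rewrite -(ler_pM2r T0) (le_trans h2)// mulrC.
  lra.
case: (leP 0 lam) => l0.
  have -> : g - lam * p ^+ 2 * y + lam * w * p * (r + u) = g + lam * p * (w * r + (w * u - p * y)) by ring.
  rewrite addr_ge0// mulr_ge0//; first by rewrite mulr_ge0// ltW.
  by rewrite addr_ge0 ?mulr_ge0 ?(ltW r0)// wupy mulr_ge0// sqr_ge0.
have [h|h] := leP 0 (p ^+ 2 * y - w * p * (r + u)).
  have -> : g - lam * p ^+ 2 * y + lam * w * p * (r + u) = g + (- lam) * (p ^+ 2 * y - w * p * (r + u)) by ring.
  by rewrite addr_ge0// mulr_ge0// oppr_ge0 ltW.
have T20 : 0 < T ^+ 2 by rewrite exprn_gt0.
rewrite -(pmulr_rge0 _ T20).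
have -> : T ^+ 2 * (g - lam * p ^+ 2 * y + lam * w * p * (r + u)) =
  (T ^+ 2 * g + p ^+ 2 * y - w * p * (T + u)) + w * p * (T - r)
  + (1 + lam * T ^+ 2) * - (p ^+ 2 * y - w * p * (r + u)) by ring.
have -> : T ^+ 2 * g + p ^+ 2 * y - w * p * (T + u) = w * T * (T * ca - p).
  transitivity (w * (T ^+ 2 * ca - p * T)); last by ring.
  by rewrite T2 /g uE yE; ring.
apply: addr_ge0; first apply: addr_ge0.
- by rewrite !mulr_ge0 ?subr_ge0// ltW.
- by rewrite !mulr_ge0 ?subr_ge0// ltW.
- by rewrite mulr_ge0//; lra.
Qed.

Lemma acos_div_itv t : 0 <= t -> t <= T -> 0 < T ->
  0 <= acos (t / T) <= pi / 2 /\ cos (acos (t / T)) = t / T.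
Proof.
move=> t0 tT T0; have h0 : 0 <= t / T by rewrite divr_ge0// ltW.
have h1 : t / T <= 1 by rewrite ler_pdivrMr// mul1r.
have hb : -1 <= t / T <= 1 by rewrite h1 andbT (le_trans _ h0)// lerN10.
have cE : cos (acos (t / T)) = t / T by rewrite acosK// in_itv.
split=> //; rewrite acos_ge0//= leNgt; apply/negP => h.
have : cos (acos (t / T)) < cos (pi / 2).
  have p0 := pi_gt0 R.
  by rewrite ltr_cos// in_itv/= ?acos_ge0 ?acos_lepi//; apply/andP; split; lra.
by rewrite cE cos_pihalf ltNge h0.
Qed.

Lemma cos_le a b : 0 <= a -> a <= b -> b <= pi -> cos b <= cos a.
Proof.
move=> a0 ab bpi; rewrite leNgt ltr_cos ?in_itv/= ?a0 ?bpi ?(le_trans ab)//.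
  by rewrite -leNgt.
by rewrite (le_trans a0).
Qed.

Lemma cos_le_inv a b : 0 <= a <= pi -> 0 <= b <= pi -> cos a <= cos b -> b <= a.
Proof. by move=> ha hb; rewrite leNgt ltr_cos ?in_itv//= -leNgt. Qed.

(** By [pow2], the vertex [z] is in the disk of radius [rho] through [x] and [y]
    as seen from [x] if and only if it is so as seen from [y]. If
    [b >= phi_p - phi_r] it is in the disk, and seen from [x] this means
    [|a - phi_p| <= phi_m]. If [b < phi_p - phi_r] it is outside, beyond the far
    arc, and then [a >= phi_p] already. *)
Lemma hinge_num p r m a b : 0 < T -> -1 < lam * T ^+ 2 ->
  0 < p -> p <= T -> 0 < r -> r <= T -> 0 < m -> m <= T ->
  0 < 1 + lam * p ^+ 2 -> 0 < 1 + lam * r ^+ 2 -> 0 < 1 + lam * m ^+ 2 ->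
  let Q t := t ^+ 2 / (1 + lam * t ^+ 2) in
  let L t := t / (1 + lam * t ^+ 2) in
  cos a * L p * L m = (Q p + Q m - Q r) / 2 - lam * Q p * Q m ->
  cos b * L p * L r = (Q p + Q r - Q m) / 2 - lam * Q p * Q r ->
  sin a * L m = sin b * L r ->
  0 <= a <= pi -> 0 <= b <= pi ->
  b < acos (p / T) + acos (r / T) ->
  acos (p / T) <= a + acos (m / T).
Proof.
move=> T0 lT p0 pT r0 rT m0 mT P0 R0 M0 Q L ea eb es /andP[a0 api] /andP[b0 bpi].
have [/andP[fp0 fp2] cfp] := acos_div_itv (ltW p0) pT T0.
have [/andP[fr0 fr2] cfr] := acos_div_itv (ltW r0) rT T0.
have [/andP[fm0 fm2] cfm] := acos_div_itv (ltW m0) mT T0.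
set fp := acos (p / T) in fp0 fp2 cfp *; set fr := acos (r / T) in fr0 fr2 cfr *.
set fm := acos (m / T) in fm0 fm2 cfm * => bfr.
have pi0 := pi_gt0 R.
have Tn : T != 0 by rewrite gt_eqF.
set w := T * sin fp.
have pE : T * cos fp = p by rewrite cfp mulrC divfK.
have sfp0 : 0 <= sin fp by rewrite sin_ge0_pi// fp0/=; lra.
have w0 : 0 <= w by rewrite mulr_ge0// ltW.
have T2 : T ^+ 2 = p ^+ 2 + w ^+ 2.
  by rewrite -pE /w !exprMn -mulrDr cos2Dsin2 mulr1.
have Pn : 1 + lam * p ^+ 2 != 0 by rewrite gt_eqF.
have Rn : 1 + lam * r ^+ 2 != 0 by rewrite gt_eqF.
have Mn : 1 + lam * m ^+ 2 != 0 by rewrite gt_eqF.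
have pn : p != 0 by rewrite gt_eqF.
have pow : p * (cos a * L m) - Q m = p * (cos b * L r) - Q r.
  apply: (@power_eq p r m _ _ _ (Q p) (Q r) (Q m) erefl P0).
  - by rewrite /Q divfK.
  - rewrite (_ : 4 * p * _ = 4 * (1 + lam * p ^+ 2) * (cos a * L p * L m)); last first.
      by rewrite /L; field; rewrite Pn Mn.
    by rewrite ea; field; rewrite ?Pn.
  - rewrite (_ : 4 * p * _ = 4 * (1 + lam * p ^+ 2) * (cos b * L p * L r)); last first.
      by rewrite /L; field; rewrite Pn Rn.
    by rewrite eb; field; rewrite ?Pn.
(* [T * cos (t - fp)] is the half-chord tangent of the circle on the ray at angle
   [t]; it is [p] on the side itself and [w] on the perpendicular ray. *)
have cD t : T * cos (t - fp) = p * cos t + w * sin t.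
  by rewrite cosB mulrDr /w -{1}pE; ring.
have pow2 : L m * (T * cos (a - fp) - m) = L r * (T * cos (b - fp) - r).
  rewrite !cD; transitivity (p * (cos a * L m) - Q m + w * (sin a * L m)).
    by rewrite /Q /L; field.
  by rewrite pow es /Q /L; field.
have Lm0 : 0 < L m by rewrite divr_gt0.
have Lr0 : 0 < L r by rewrite divr_gt0.
have [|] := leP (fp - fr) b => hb.
  have h1 : 0 <= T * cos (b - fp) - r.
    rewrite subr_ge0 mulrC -ler_pdivrMr// -cfr -(cos_norm (b - fp)).
    by rewrite cos_le ?normr_ge0// ?ler_norml; [apply/andP; split|]; lra.
  have h2 : 0 <= T * cos (a - fp) - m.
    by rewrite -(pmulr_rge0 _ Lm0) pow2 mulr_ge0// ltW.
  have [h2'|afp] := leP fp a; first by rewrite (le_trans h2')// lerDl.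
  rewrite subr_ge0 mulrC -ler_pdivrMr// -cfm in h2.
  suff : fp - a <= fm by lra.
  by apply: cos_le_inv; [lra|lra|rewrite -(opprB a) cosN].
suff : fp <= a by move=> h; rewrite (le_trans h)// lerDl.
rewrite leNgt; apply/negP => afp.
have X0 : 0 < w * cos a - p * sin a.
  rewrite (_ : _ - _ = T * sin (fp - a)).
    by rewrite mulr_gt0// sin_gt0_pi//; apply/andP; split; lra.
  by rewrite sinB mulrBr /w -[in LHS]pE; ring.
have sb0 : 0 <= sin b by rewrite sin_ge0_pi// b0 bpi.
have yE : w * cos b - p * sin b = T * sin (fp - b).
  by rewrite sinB mulrBr /w -{1}pE; ring.
have cb : p / T <= cos b.
  rewrite -cfp leNgt ltr_cos ?in_itv/= ?fp0 ?b0 ?bpi//=; last by lra.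
  by rewrite -leNgt; lra.
have uE : p * cos b + w * sin b <= r.
  rewrite -cD -(opprB fp) cosN.
  have : cos (fp - b) <= cos fr by rewrite cos_le//; lra.
  by rewrite cfr ler_pdivlMr// mulrC.
have := @far_side_ge0 p r w (cos b) (sin b) _ _ p0 r0 rT w0 sb0 T2 (cos2Dsin2 b) lT T0 erefl erefl.
rewrite yE => /(_ _ _ _ uE) far.
have {far} : 0 <= p * (1 + lam * p ^+ 2) * r * sin b - w * p * (1 - lam * r ^+ 2)
       + w * r * cos b * (1 - lam * p ^+ 2).
  apply: far; last by rewrite mulrC -ler_pdivrMr.
    by rewrite mulr_ge0 ?(ltW T0)// sin_ge0_pi//; apply/andP; split; lra.
  by rewrite (lt_le_trans _ cb)// divr_gt0.
apply/negP; rewrite -ltNge -oppr_gt0.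
(* Eliminates [a] and [m] in favour of [b], to reach the expression in [far]. *)
have e1 : p * (cos a * L m) * ((1 + lam * p ^+ 2) * (1 + lam * r ^+ 2)) =
   p ^+ 2 * (1 - lam * r ^+ 2) - p * r * cos b * (1 - lam * p ^+ 2).
  have qm : Q m = Q p + Q r - 2 * lam * Q p * Q r - 2 * (cos b * L p * L r) by rewrite eb; field.
  have -> : p * (cos a * L m) = p * (cos b * L r) - Q r + Q m by rewrite -pow; ring.
  by rewrite qm /Q /L; field; rewrite Pn Rn.
rewrite -(pmulr_rgt0 _ p0).
rewrite [ltRHS](_ : _ = (1 + lam * p ^+ 2) * (1 + lam * r ^+ 2) * (p * L m * (w * cos a - p * sin a))).
  exact: mulr_gt0 (mulr_gt0 P0 R0) (mulr_gt0 (mulr_gt0 p0 Lm0) X0).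
transitivity (w * (p * (cos a * L m) * ((1 + lam * p ^+ 2) * (1 + lam * r ^+ 2)))
  - p ^+ 2 * (1 + lam * p ^+ 2) * (1 + lam * r ^+ 2) * (sin a * L m)); last by ring.
by rewrite e1 es /L; field.
Qed.

End HingeNum.

(** * Angles and comparison along a fan *)
Section Angles.
Variables (R : realType) (lam : R).
Implicit Types (t r e : R) (x y z w u : 'rV[R]_3).
Local Notation s := (sn lam).
Local Notation c := (cs lam).
Local Notation S := (on_space lam).
Local Notation form := (ip lam).
Local Notation dist := (dst lam).
Local Notation dir := (dirv lam).
Local Notation q := (chord_sq lam).
Local Notation dot := (dir_dot lam).
Local Notation crs := (orient lam).
Local Notation ang := (ang lam).
Local Notation tau := (tau lam).
Local Notation reg x y := (0 < s (dist x y)).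

Lemma angE x y z : S x -> S y -> S z ->
  ang x y z = acos (dot x y z / (s (dist x y) * s (dist x z))).
Proof.
move=> Sx Sy Sz; rewrite ang.unlock /angle.
have dE u : direction lam x u = dir x u by rewrite dirv.unlock.
have fE u v : Defs.form lam u v = form u v by rewrite ip.unlock.
rewrite !dE !fE !form_dir// (dot_s Sx Sy) (dot_s Sx Sz).
by rewrite !sqrtr_sqr !ger0_norm// s_dist_ge0.
Qed.

Lemma angC x y z : ang x y z = ang x z y.
Proof.
rewrite ang.unlock /angle.
move: (direction lam x y) (direction lam x z) => u v.
have -> : Defs.form lam u v = Defs.form lam v u by have := formC lam u v; rewrite ip.unlock.
by rewrite (mulrC (Num.sqrt (Defs.form lam u u))).
Qed.

Lemma ang_spec x y z : S x -> S y -> S z -> reg x y -> reg x z ->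
  [/\ 0 <= ang x y z <= pi,
      cos (ang x y z) * (s (dist x y) * s (dist x z)) = dot x y z
    & sin (ang x y z) * (s (dist x y) * s (dist x z)) = `|crs x y z| ].
Proof.
move=> Sx Sy Sz ry rz; rewrite angE//; have L0 := mulr_gt0 ry rz.
have d2 := dot_sqr_le Sy Sz Sx.
set L := s _ * s _ in d2 L0 *.
have b1 : -1 <= dot x y z / L <= 1.
  rewrite ler_pdivlMr// ler_pdivrMr// mul1r mulN1r -ler_norml.
  by rewrite -ler_sqr ?nnegrE// ?(ltW L0)// real_normK ?num_real.
have Ln : L != 0 by rewrite gt_eqF.
split; first by rewrite acos_ge0//= acos_lepi.
  by rewrite acosK ?in_itv//= divfK.
rewrite sin_acos// -sqrtr_sqr -[X in _ * X]gtr0_norm// -[`|L|]sqrtr_sqr -sqrtrM; last first.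
  by rewrite subr_ge0 expr_div_n ler_pdivrMr ?exprn_gt0// mul1r.
congr (Num.sqrt _); rewrite mulrBl mul1r expr_div_n divfK ?sqrf_eq0//.
have := crs_mul Sx Sy Sz Sy; rewrite (crs_swap _ x y z) (dotC _ x z y) mulrN -expr2 (dot_s Sx Sy) (dot_s Sx Sz) => e.
by rewrite /L exprMn; lra.
Qed.

(** Additivity of angles inside a convex angle. The sign [e] is the orientation;
    cosine and sine of the sum come from [crs_mul] and [crs_dot], and the sign
    of the sine selects the determination. *)
Lemma ang_add e x a b d : S x -> S a -> S b -> S d -> reg x a -> reg x b -> reg x d ->
  e * e = 1 -> 0 <= e * crs x a b -> 0 <= e * crs x b d -> 0 <= e * crs x a d ->
  ang x a b < pi -> ang x a d = ang x a b + ang x b d.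
Proof.
move=> Sx Sa Sb Sd ra rb rd ee h1 h2 h3 lp.
have [/andP[A0 A1] Ac As] := ang_spec Sx Sa Sb ra rb.
have [/andP[B0 B1] Bc Bs] := ang_spec Sx Sb Sd rb rd.
have [/andP[C0 C1] Cc _] := ang_spec Sx Sa Sd ra rd.
have ne : `|e| = 1.
  by apply/eqP; rewrite -sqrp_eq1 ?normr_ge0// real_normK ?num_real// expr2 ee.
have nE (u : R) : 0 <= e * u -> `|u| = e * u by move=> eu; rewrite -(ger0_norm eu) normrM ne mul1r.
rewrite (nE _ h1) in As; rewrite (nE _ h2) in Bs.
set A := ang x a b in A0 A1 Ac As lp *; set B := ang x b d in B0 B1 Bc Bs *.
set C := ang x a d in C0 C1 Cc *.
have L0 : 0 < s (dist x a) * s (dist x b) ^+ 2 * s (dist x d) by rewrite !mulr_gt0// exprn_gt0.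
have cE : cos C = cos (A + B).
  apply: (mulfI (lt0r_neq0 L0)).
  have e1 : (e * crs x a b) * (e * crs x b d) =
      dot x a b * dot x b d - s (dist x b) ^+ 2 * dot x a d.
    by rewrite mulrACA ee mul1r crs_mul// (dot_s Sx Sb); ring.
  by rewrite -As -Bs -Ac -Bc -Cc in e1; rewrite cosD; lra.
have sE : 0 <= sin (A + B).
  rewrite -(pmulr_rge0 _ L0).
  have e1 : (e * crs x a b) * dot x b d + dot x a b * (e * crs x b d) =
      s (dist x b) ^+ 2 * (e * crs x a d).
    by have := crs_dot Sx Sa Sb Sd; rewrite (dot_s Sx Sb) => e1; rewrite [RHS]mulrCA -e1; ring.
  have e2 : 0 <= s (dist x b) ^+ 2 * (e * crs x a d) by apply: mulr_ge0 => //; exact: sqr_ge0.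
  by rewrite -e1 -As -Bs -Ac -Bc in e2; rewrite sinD; lra.
apply: cos_inj => //; rewrite in_itv/= ?C0 ?C1// addr_ge0//= leNgt; apply/negP => h.
have : 0 < sin (A + B - pi) by apply: sin_gt0_pi; apply/andP; split; lra.
by rewrite -oppr_lt0 -sinDpi subrK ltNge sE.
Qed.

Lemma ang_self x a : S x -> S a -> reg x a -> ang x a a = 0.
Proof.
move=> Sx Sa ra; rewrite angE// (dot_s Sx Sa) expr2 divff ?acos1//.
by rewrite mulf_neq0// gt_eqF.
Qed.

Lemma ang_lt_pi x y z : S x -> S y -> S z -> reg x y -> reg x z -> crs x y z != 0 ->
  0 < ang x y z < pi.
Proof.
move=> Sx Sy Sz ry rz cn; have [/andP[A0 A1] _ sA] := ang_spec Sx Sy Sz ry rz.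
have sn0 : sin (ang x y z) != 0.
  by apply: contraNneq cn => h; rewrite -normr_eq0 -sA h mul0r.
rewrite !lt_neqAle A0 A1 !andbT; apply/andP; split.
  by apply: contraNneq sn0 => <-; rewrite sin0.
by apply: contraNneq sn0 => ->; rewrite sinpi.
Qed.

(** Half-angle formulas: squared chord and sine of the distance as rational
    functions of [tau]. *)
Lemma tau_spec x y : S x -> S y -> reg x y ->
  [/\ 0 < tau x y, 0 < 1 + lam * tau x y ^+ 2,
      q x y = 4 * (tau x y ^+ 2 / (1 + lam * tau x y ^+ 2))
    & s (dist x y) = 2 * (tau x y / (1 + lam * tau x y ^+ 2))].
Proof.
move=> Sx Sy; rewrite -[X in s X](divfK (_ : (2 : R) != 0))// mulrC s_double => r0.
have ch := c_half_ge0 Sx Sy.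
have cp : 0 < c (dist x y / 2).
  by rewrite lt_neqAle ch andbT eq_sym; apply: contraTneq r0 => ->; rewrite mulr0 ltxx.
have sp : 0 < s (dist x y / 2) by move: r0; rewrite pmulr_lgt0// pmulr_rgt0.
have cn : c (dist x y / 2) != 0 by rewrite gt_eqF.
have e : 1 + lam * tau x y ^+ 2 = (c (dist x y / 2))^-1 ^+ 2.
  transitivity ((c (dist x y / 2) ^+ 2 + lam * s (dist x y / 2) ^+ 2) *
    (c (dist x y / 2))^-1 ^+ 2); last by rewrite c2s2 mul1r.
  by rewrite tau.unlock taE; field; rewrite cn.
have e0 : 0 < 1 + lam * tau x y ^+ 2 by rewrite e exprn_gt0// invr_gt0.
split=> //; first by rewrite tau.unlock taE divr_gt0.
- rewrite (q_dist Sx Sy) e tau.unlock taE; field.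
  by rewrite cn.
- by rewrite e tau.unlock taE; field; rewrite cn.
Qed.

Lemma tauC x y : tau x y = tau y x.
Proof. by rewrite tau.unlock distC. Qed.

Section Fan.
Variable T : R.
Hypotheses (T0 : 0 < T) (lT : -1 < lam * T ^+ 2).
Local Notation phi := (phi lam T).

Lemma phiC x y : phi x y = phi y x.
Proof. by rewrite phi.unlock tauC. Qed.

(** The geometric form of [hinge_num]: the cosine hypotheses are the laws of
    cosines at [x] and [y], the sine hypothesis is the law of sines, and the
    conclusion says that the interior angle at [x] is at least
    [phi x y - phi x z]. *)
Lemma hinge x y z : S x -> S y -> S z -> reg x y -> reg y z -> reg x z ->
  tau x y <= T -> tau y z <= T -> tau x z <= T ->
  ang y x z < phi x y + phi y z -> phi x y <= ang x y z + phi x z.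
Proof.
move=> Sx Sy Sz rxy ryz rxz txy tyz txz; rewrite phi.unlock.
have ryx : reg y x by rewrite distC.
have [p0 P0 qp sp] := tau_spec Sx Sy rxy.
have [r0 R0 qr sr] := tau_spec Sy Sz ryz.
have [m0 M0 qm sm] := tau_spec Sx Sz rxz.
have [a0 ca sa] := ang_spec Sx Sy Sz rxy rxz.
have [b0 cb sb] := ang_spec Sy Sx Sz ryx ryz.
rewrite (distC _ y x) in cb sb.
have crs_eq : `|crs x y z| = `|crs y x z|.
  by rewrite -(crs_rot _ x y z) crs_swap normrN.
apply: (hinge_num T0 lT p0 txy r0 tyz m0 txz P0 R0 M0) => //.
- move: ca; rewrite dotE sp sm qp qm qr.
    set X := tau x y ^+ 2 / _; set Y := tau x z ^+ 2 / _; set Z := tau y z ^+ 2 / _.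
  by move=> h; lra.
- move: cb; rewrite dotE sp sr (qC _ y x) qp qm qr.
    set X := tau x y ^+ 2 / _; set Y := tau x z ^+ 2 / _; set Z := tau y z ^+ 2 / _.
  by move=> h; lra.
- apply: (mulfI (lt0r_neq0 rxy)).
  have : sin (ang x y z) * (s (dist x y) * s (dist x z)) =
         sin (ang y x z) * (s (dist x y) * s (dist y z)) by rewrite sa sb crs_eq.
  rewrite sm sr; set B := _ / _; set C := _ / _; move: (s _) => L; lra.
Qed.

(** Induction on the fan of triangles from [w 0]. The angle at [w k.+1] in the
    triangle of [w 0], [w k.+1], [w k.+2] is what the previous triangle leaves of
    the sharp angle of the polygon. The second induction claim, at the
    other end of the diagonal, is what keeps that remainder small enough to apply
    [hinge] to the next triangle. *)
Lemma fan e (w : nat -> 'rV[R]_3) (N : nat) : e * e = 1 ->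
  (forall k, S (w k)) ->
  (forall j k, (j < k <= N)%N -> reg (w j) (w k) /\ tau (w j) (w k) <= T) ->
  (forall k, (0 < k < N)%N -> 0 < e * crs (w 0) (w k) (w k.+1)) ->
  (forall k, (1 < k <= N)%N -> 0 < e * crs (w 0) (w 1) (w k)) ->
  (forall k, (k.+1 < N)%N -> 0 < e * crs (w k) (w k.+1) (w k.+2)) ->
  (forall k, (k.+1 < N)%N ->
     ang (w k.+1) (w k) (w k.+2) < phi (w k) (w k.+1) + phi (w k.+1) (w k.+2)) ->
  forall k, (0 < k <= N)%N ->
    phi (w 0) (w 1) <= phi (w 0) (w k) + ang (w 0) (w 1) (w k).
Proof.
move=> ee Sw rt o1 o2 o3 hA k kN.
have reg_ j l : (j < l <= N)%N -> reg (w j) (w l) by move=> /rt[].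
have regr j l : (j < l <= N)%N -> reg (w l) (w j) by rewrite distC; apply: reg_.
have tau_ j l : (j < l <= N)%N -> tau (w j) (w l) <= T by move=> /rt[].
(* The second claim bounds from below the part of the angle at [w k] that lies on
   the near side of the diagonal from [w 0]. *)
suff : phi (w 0) (w 1) <= phi (w 0) (w k) + ang (w 0) (w 1) (w k) /\
    phi (w k.-1) (w k) <= phi (w 0) (w k) + ang (w k) (w k.-1) (w 0) by case.
elim: k kN => // -[_ kN|k IH kN].
  have r01 : reg (w 0) (w 1) by apply: reg_.
  have r10 : reg (w 1) (w 0) by apply: regr.
  by rewrite /= !ang_self// addr0.
have kN' : (0 < k.+1 <= N)%N by rewrite /= ltnW.
have kN2 : (k.+1 < N)%N by case/andP: kN.
have [IH1 IH2] := IH kN'.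
have rk : reg (w 0) (w k.+1) by apply: reg_.
have rk2 : reg (w 0) (w k.+2) by apply: reg_.
have rkk : reg (w k.+1) (w k.+2) by apply: reg_; rewrite ltnS leqnn.
have r01 : reg (w 0) (w 1) by apply: reg_; rewrite (leq_trans _ kN2).
have tk : tau (w 0) (w k.+1) <= T by apply: tau_.
have tk2 : tau (w 0) (w k.+2) <= T by apply: tau_.
have tkk : tau (w k.+1) (w k.+2) <= T by apply: tau_; rewrite ltnS leqnn.
have b_lt : ang (w k.+1) (w 0) (w k.+2) < phi (w 0) (w k.+1) + phi (w k.+1) (w k.+2).
  have hk := hA k kN2.
  case: k IH1 IH2 kN' kN2 kN hk rk rk2 rkk tk tk2 tkk {IH} => [//|k] IH1 IH2 kN' kN2 kN hk rk rk2 rkk tk tk2 tkk.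
  have rk0 : reg (w k.+2) (w 0) by rewrite distC.
  have rk1 : reg (w k.+2) (w k.+1) by apply: regr; rewrite ltnS leqnn.
  have c1 : 0 < e * crs (w 0) (w k.+1) (w k.+2) by apply: o1; rewrite /= ltnW.
  have c2 : 0 < e * crs (w 0) (w k.+2) (w k.+3) by apply: o1; rewrite /=.
  have c3 : 0 < e * crs (w k.+1) (w k.+2) (w k.+3) by apply: o3.
  have n1 : crs (w k.+2) (w k.+1) (w 0) != 0.
    rewrite crs_swap oppr_eq0 -crs_rot -crs_rot crs_rot crs_rot.
    by apply: contraTneq c1; rewrite -crs_rot => h; rewrite -[crs _ _ _]crs_rot crs_rot h mulr0 ltxx.
  have ll := ang_lt_pi (Sw _) (Sw _) (Sw _) rk1 rk0 n1.
  have ne : (- e) * (- e) = 1 by rewrite mulrNN.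
  have := ang_add (Sw _) (Sw _) (Sw _) (Sw _) rk1 rk0 rkk ne.
  move=> /(_ _ _ _ _) add.
  have E : ang (w k.+2) (w k.+1) (w k.+3) =
      ang (w k.+2) (w k.+1) (w 0) + ang (w k.+2) (w 0) (w k.+3).
    apply: add; last by case/andP: ll.
    - rewrite crs_swap mulrNN -[crs _ _ _]crs_rot; exact: ltW.
    - by rewrite (crs_swap _ _ (w k.+3) (w 0)) mulrNN crs_rot ltW.
    - by rewrite (crs_swap _ _ (w k.+3) (w k.+1)) mulrNN crs_rot ltW.
  by move: hk IH2; rewrite E /=; lra.
have h1 := hinge (Sw 0) (Sw k.+1) (Sw k.+2) rk rkk rk2 tk tkk tk2 b_lt.
have h2 : phi (w k.+2) (w k.+1) <= ang (w k.+2) (w k.+1) (w 0) + phi (w k.+2) (w 0).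
  apply: hinge => //; rewrite ?(distC _ (w k.+2)) ?(distC _ (w k.+1) (w 0)) ?(tauC (w k.+2)) ?(tauC (w k.+1) (w 0)) //.
  by rewrite angC !(phiC _ (w k.+1)) (phiC (w k.+1) (w 0)) addrC.
split; last by rewrite /= phiC (phiC (w 0)) addrC.
have -> : ang (w 0) (w 1) (w k.+2) = ang (w 0) (w 1) (w k.+1) + ang (w 0) (w k.+1) (w k.+2).
  case: k IH1 IH2 kN' kN2 kN rk rk2 rkk tk tk2 tkk b_lt h1 h2 {IH} => [|k] IH1 IH2 kN' kN2 kN rk rk2 rkk tk tk2 tkk b_lt h1 h2.
    by rewrite ang_self// add0r.
  have c1 : 0 < e * crs (w 0) (w 1) (w k.+2) by apply: o2; rewrite /= ltnW.
  apply: (ang_add (e := e)) => //; rewrite ?(ltW c1)//.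
  - by rewrite ltW// o1.
  - by rewrite ltW// o2.
  - have n1 : crs (w 0) (w 1) (w k.+2) != 0 by apply: contraTneq c1 => ->; rewrite mulr0 ltxx.
    by have /andP[] := ang_lt_pi (Sw _) (Sw _) (Sw _) r01 rk n1.
lra.
Qed.

End Fan.
End Angles.

(** * Moving the centre of a disk *)

(** The first-order term of a quadratic expression decides its sign near zero
    when the constant term does not. *)
Lemma small_quad (R : realType) (a b M : R) : a < 0 \/ (a <= 0 /\ b < 0) ->
  \forall k \near (0 : R)^'+, a + k * (b + k * M) < 0.
Proof.
suff H : a < 0 \/ (a <= 0 /\ b < 0) ->
    exists2 d : R, 0 < d & forall k, 0 < k -> k < d -> a + k * (b + k * M) < 0.
  move=> /H[d d0 hd]; near=> k; apply: hd; near: k.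
    exact: nbhs_right_gt.
  exact: nbhs_right_lt.
have M0 := normr_ge0 M; have Mn := ler_norm M.
move=> [a0|[a0 b0]].
  have b0 := normr_ge0 b; have bn := ler_norm b.
  set B := `|b| + `|M| + 1; have B0 : 0 < B by rewrite /B; lra.
  exists (Num.min 1 (- a / B)); first by rewrite lt_min ltr01 divr_gt0// oppr_gt0.
  move=> k k0; rewrite lt_min ltr_pdivlMr// => /andP[k1 kB].
  have h1 : k * M <= `|M|.
    by rewrite (le_trans (ler_wpM2l (ltW k0) Mn))// ler_piMl// ltW.
  have h2 : k * (b + k * M) <= k * B by rewrite ler_pM2l// /B; lra.
  lra.
set B := `|M| + 1; have B0 : 0 < B by rewrite /B; lra.
exists (- b / B); first by rewrite divr_gt0// oppr_gt0.
move=> k k0; rewrite ltr_pdivlMr// => kB.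
have h1 : k * M <= k * B by rewrite ler_pM2l// /B; lra.
have h2 : k * (b + k * M) < 0 by rewrite pmulr_rlt0//; lra.
lra.
Unshelve. all: by end_near. Qed.

Section Motion.
Variables (R : realType) (lam : R).
Implicit Types (t r k : R) (x y z w u : 'rV[R]_3).
Local Notation s := (sn lam).
Local Notation S := (on_space lam).
Local Notation form := (ip lam).
Local Notation dist := (dst lam).
Local Notation dir := (dirv lam).
Local Notation q := (chord_sq lam).
Local Notation dot := (dir_dot lam).
Local Notation crs := (orient lam).
Local Notation tangent := (tangent lam).

(** The quarter turn of the direction towards [x]: pairing with it computes
    [crs]. *)
Lemma tangent_rot O x : S O -> S x ->
  exists2 h, tangent O h & forall y, S y -> form h (dir O y) = crs O x y.
Proof.
move=> SO Sx.
have mk3 (a b g : R) : exists h : 'rV[R]_3, [/\ h 0 0 = a, h 0 1 = b & h 0 2%:R = g].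
  by exists (\row_(i < 3) [:: a; b; g]`_i); rewrite !mxE.
have [l0|l0] := eqVneq lam 0.
  have [h [h0 h1 h2]] := mk3 0 (- (x 0 2%:R - O 0 2%:R)) (x 0 1 - O 0 1).
  exists h; first by rewrite /tangent l0 eqxx.
  move=> y Sy; rewrite dirE (c_zero l0) scale1r crsE /kk l0 eqxx mul1r formE det3E !mxE h0 h1 h2.
  by move: SO Sx Sy; rewrite !sf_zero// => -> -> ->; ring.
have [h [h0 h1 h2]] := mk3 (kk lam * sg lam * (O 0 1 * x 0 2%:R - O 0 2%:R * x 0 1))
  (kk lam * (O 0 2%:R * x 0 0 - O 0 0 * x 0 2%:R)) (kk lam * (O 0 0 * x 0 1 - O 0 1 * x 0 0)).
have hE y : form h y = crs O x y.
  rewrite formE h0 h1 h2 crsE det3E.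
  transitivity ((sg lam * sg lam) * kk lam * (O 0 1 * x 0 2%:R - O 0 2%:R * x 0 1) * y 0 0 +
   kk lam * (O 0 2%:R * x 0 0 - O 0 0 * x 0 2%:R) * y 0 1 + kk lam * (O 0 0 * x 0 1 - O 0 1 * x 0 0) * y 0 2%:R).
    by ring.
  by rewrite sgsg; ring.
have hO : form h O = 0 by rewrite hE -crs_rot crs_diag.
exists h; first by rewrite /tangent (negbTE l0) formC hO.
by move=> y Sy; rewrite dirE !form_lin hO mulr0 subr0 hE.
Qed.

(** A point on the geodesic from [O] with initial velocity [h], parametrized so
    that [k] times the length of [h] is [ta] of half the distance travelled; this
    keeps squared chords rational in [k]. *)
Definition moved O h k : 'rV[R]_3 :=
  (1 + lam * k ^+ 2 * form h h)^-1 *: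
  ((1 - lam * k ^+ 2 * form h h) *: O + (2 * k) *: h).

(** The condition of being on the upper sheet is an open one, so it
    survives small moves. *)
Lemma moved_sf O h : S O -> tangent O h ->
  \forall k \near (0 : R)^'+, 0 < 1 + lam * k ^+ 2 * form h h /\ S (moved O h k).
Proof.
move=> SO tO; set eta := form h h.
have upper : \forall k \near (0 : R)^'+, lam < 0 ->
    - O 0 0 + k * (- 2 * h 0 0 + k * (lam * eta * O 0 0)) < 0.
  have [l0|l0] := ltP lam 0; last by near=> k.
  have O0 : 0 < O 0 0 by move: SO; rewrite sf_neg// => -[].
  suff : \forall k \near (0 : R)^'+,
    - O 0 0 + k * (- 2 * h 0 0 + k * (lam * eta * O 0 0)) < 0 by apply: filterS.
  by apply: small_quad; left; rewrite oppr_lt0.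
near=> k.
have N0 : 0 < 1 + lam * k ^+ 2 * eta.
  have : -1 + k * (0 + k * (- (lam * eta))) < 0.
    by near: k; apply: small_quad; left; rewrite oppr_lt0.
  lra.
have up : lam < 0 -> - O 0 0 + k * (- 2 * h 0 0 + k * (lam * eta * O 0 0)) < 0.
  by near: k.
split=> //; rewrite /moved -/eta; set N := 1 + _ in N0 *.
have Nn : N != 0 by rewrite gt_eqF.
have [l0|l0] := eqVneq lam 0.
  move: SO tO; rewrite /tangent !sf_zero// l0 eqxx !mxE => -> ->.
  by rewrite /N l0 !mul0r addr0 subr0 invr1; ring.
have oh : form O h = 0 by move: tO; rewrite /tangent (negbTE l0).
have fE : form (N^-1 *: ((1 - lam * k ^+ 2 * eta) *: O + (2 * k) *: h))
    (N^-1 *: ((1 - lam * k ^+ 2 * eta) *: O + (2 * k) *: h)) = lam^-1.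
  rewrite !form_lin (formC _ h O) oh -/eta.
  have := sf_form l0 SO; set A := form O O => lA; have -> : A = lam^-1 by rewrite -[RHS]mulr1 -lA mulKf.
  by rewrite /N; field; rewrite l0 Nn.
case: (ltrgt0P lam) l0 => // l0 _; first by rewrite sf_pos.
rewrite sf_neg//; split=> //; rewrite !mxE mulr_gt0 ?invr_gt0//.
have : - O 0 0 + k * (- 2 * h 0 0 + k * (lam * eta * O 0 0)) < 0 by apply: up.
lra.
Unshelve. all: by end_near. Qed.

Lemma moved_q O h k v : S O -> tangent O h -> S v ->
  0 < 1 + lam * k ^+ 2 * form h h -> S (moved O h k) ->
  q (moved O h k) v * (1 + lam * k ^+ 2 * form h h) =
  4 * k ^+ 2 * form h h + q O v * (1 - lam * k ^+ 2 * form h h) - 4 * k * form h (dir O v).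
Proof.
move=> SO tO Sv N0 Sm; have [l0|l0] := eqVneq lam 0.
  have mE : moved O h k = O + (2 * k) *: h.
    by rewrite /moved l0 !mul0r addr0 subr0 invr1 !scale1r.
  rewrite mE l0 !mul0r addr0 subr0 !mulr1 -l0 !qF dirE (c_zero l0) scale1r.
  rewrite !form_lin !(formC _ v) (formC _ h O); ring.
apply: (mulfI l0); move: (Sm); rewrite /moved.
set eta := form h h in N0 *; set N := 1 + _ in N0 *.
have Nn : N != 0 by rewrite gt_eqF.
set O' := N^-1 *: _ => SO'.
have e1 : lam * q O' v = 2 - 2 * (lam * form O' v) by rewrite (q_form l0 SO' Sv); field.
have e2 : lam * q O v = 2 - 2 * (lam * form O v) by rewrite (q_form l0 SO Sv); field.
have oh : form O h = 0 by move: tO; rewrite /tangent (negbTE l0).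
have hd : form h (dir O v) = form h v by rewrite dirE !form_lin (formC _ h O) oh mulr0 subr0.
rewrite mulrA e1 hd.
rewrite [RHS](_ : _ = 4 * lam * k ^+ 2 * eta + (lam * q O v) * (1 - lam * k ^+ 2 * eta) - 4 * k * lam * form h v); last by ring.
rewrite e2 /O' !form_lin /N; field; exact: Nn.
Qed.

(** If [h] makes an acute angle with the direction of each point at the largest
    distance from [O], a small move along [h] brings all points closer: the
    first-order term of [moved_q] is [- 4 k <h, dir>]. *)
Lemma move_center (n : nat) (v : 'I_n -> 'rV[R]_3) O h Q : S O -> tangent O h ->
  (forall i, S (v i)) -> (forall i, q O (v i) <= Q) ->
  (forall i, q O (v i) = Q -> 0 < form h (dir O (v i))) ->
  exists2 O', S O' & forall i, q O' (v i) < Q.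
Proof.
move=> SO tO Sv qQ ct.
have : \forall k \near (0 : R)^'+, S (moved O h k) /\ forall i, q (moved O h k) (v i) < Q.
  near=> k.
  have [N0 Sm] : 0 < 1 + lam * k ^+ 2 * form h h /\ S (moved O h k).
    by near: k; apply: moved_sf.
  split=> // i; rewrite -(ltr_pM2r N0) moved_q//; move: i.
  near: k; apply: filter_forall => i.
  have : \forall k \near (0 : R)^'+, (q O (v i) - Q) + k * (- 4 * form h (dir O (v i)) +
    k * (4 * form h h - lam * form h h * (q O (v i) + Q))) < 0.
    apply: small_quad; have := qQ i; rewrite le_eqVlt => /predU1P[e|l].
      by right; split; [rewrite e subrr|have := ct i e; lra].
    by left; rewrite subr_lt0.
  by apply: filterS => k; lra.
move=> H; have [k [Sk hk]] := @filter_ex _ _ (at_right_proper_filter (0 : R)) _ H.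
by exists (moved O h k).
Unshelve. all: by end_near. Qed.

(** * Convex position of the vertices *)
Lemma lin_continuous (a b g : R) :
  continuous (fun p : 'rV[R]_3 => p 0 0 * a + p 0 1 * b + p 0 2%:R * g).
Proof.
have C i (r : R) : continuous (fun p : 'rV[R]_3 => p 0 i * r).
  by move=> p; apply: (@continuousM _ _ (fun p : 'rV[R]_3 => p 0 i) (cst r));
    [exact: coord_continuous|exact: cst_continuous].
move=> p; apply: (@continuousD _ _ _ (fun p : 'rV[R]_3 => p 0 0 * a + p 0 1 * b)
  (fun p => p 0 2%:R * g)); last exact: C.
by apply: (@continuousD _ _ _ (fun p : 'rV[R]_3 => p 0 0 * a) (fun p => p 0 1 * b)); exact: C.
Qed.

Lemma det3_near y z p : 0 < det3 p y z -> \forall p' \near p, 0 < det3 p' y z.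
Proof.
set a := y 0 1 * z 0 2%:R - y 0 2%:R * z 0 1.
set b := - (y 0 0 * z 0 2%:R - y 0 2%:R * z 0 0).
set g := y 0 0 * z 0 1 - y 0 1 * z 0 0.
have E p' : det3 p' y z = p' 0 0 * a + p' 0 1 * b + p' 0 2%:R * g.
  by rewrite det3E /a /b /g; ring.
rewrite E => h.
have := @lin_continuous a b g p; move=> /cvgr_gt /(_ 0 h).
by apply: filterS => p'; rewrite E.
Qed.

(** Cramer's rule: the coefficients of a point in a triangle are ratios of
    orientations. *)
Lemma cramer x y z w : det3 x y z *: w =
  det3 w y z *: x + det3 x w z *: y + det3 x y w *: z.
Proof. by apply: row3P; rewrite !mxE !det3E; ring. Qed.

Lemma cramer_div x y z w : det3 x y z != 0 -> w =
  (det3 w y z / det3 x y z) *: x + (det3 x w z / det3 x y z) *: y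
  + (det3 x y w / det3 x y z) *: z.
Proof.
move=> d0; apply: (scalerI d0); rewrite cramer !scalerDr !scalerA.
by rewrite !(mulrC (det3 x y z)) !divfK.
Qed.

(** If [D] had points [w] and [z] strictly on both sides of the line [x y], the
    triangles [x y w] and [x y z] would be contained in [D] and would cover a
    neighbourhood of the midpoint of the side, which is nevertheless in the
    closure of the complement of [D]. *)
Lemma side_support (D : set 'rV[R]_3) x y : D `<=` S -> geodesically_convex lam D ->
  S x -> S y -> D x -> D y -> x != y -> lam * q x y < 4 ->
  segment lam x y `<=` closure (S `\` D) ->
  (forall z, D z -> 0 <= det3 x y z) \/ (forall z, D z -> det3 x y z <= 0).
Proof.
move=> DS Dc Sx Sy Dx Dy xy lq sc.
have [|/existsNP[z /not_implyP[Dz /negP]]] := pselect (forall z, D z -> 0 <= det3 x y z).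
  by left.
rewrite -ltNge => z0; right=> w Dw; rewrite leNgt; apply/negP => w0.
have [N N0 Sp] := cone2_normal Sx Sy ltr01 ltr01 lq.
set p := N^-1 *: _ in Sp.
have pE : p = N^-1 *: x + N^-1 *: y by rewrite /p !scale1r scalerDr.
have Ni : 0 < N^-1 by rewrite invr_gt0.
have /sc pcl : segment lam x y p by apply: cone_segment pE => //; exact: ltW.
have D1 u : det3 p y u = N^-1 * det3 x y u by rewrite pE !det3E !mxE; ring.
have D2 u : det3 p u x = N^-1 * det3 x y u by rewrite pE !det3E !mxE; ring.
have [p' [[Sp' nDp'] [[[h1 h2] h3] h4]]] :
    (S `\` D) `&` [set p' | ((0 < det3 p' y w /\ 0 < det3 p' w x) /\ 0 < det3 p' z y) /\ 0 < det3 p' x z] !=set0.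
  apply: pcl; apply: filterI; first apply: filterI; first apply: filterI.
  - by apply: det3_near; rewrite D1 mulr_gt0.
  - by apply: det3_near; rewrite D2 mulr_gt0.
  - by apply: det3_near; rewrite det3_swap oppr_gt0 D1 pmulr_rlt0.
  - by apply: det3_near; rewrite det3_swap oppr_gt0 D2 pmulr_rlt0.
(* By Cramer's rule the nearby point [p'] lies in one of the two triangles,
   according to its own side of the line. *)
apply: nDp'.
have [g0|g0] := leP 0 (det3 x y p').
  apply: (cone3_mem DS Dc Dx Dy Dw Sp' lq _ _ _ (@cramer_div x y w p' _)).
  - by rewrite divr_gt0.
  - by rewrite divr_gt0// -det3_rot.
  - by rewrite divr_ge0// ltW.
  - by rewrite gt_eqF.
have e3 : det3 p' y z < 0 by rewrite -oppr_gt0 -det3_swap.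
have e4 : det3 x p' z < 0 by rewrite -det3_rot -oppr_gt0 -det3_swap.
apply: (cone3_mem DS Dc Dx Dy Dz Sp' lq _ _ _ (@cramer_div x y z p' _)).
- by rewrite -mulrNN -invrN divr_gt0 ?oppr_gt0.
- by rewrite -mulrNN -invrN divr_gt0 ?oppr_gt0.
- by rewrite -mulrNN -invrN divr_ge0// oppr_ge0 ltW.
- by rewrite lt_eqF.
Qed.

Lemma segment_sym x y : segment lam x y = segment lam y x.
Proof.
have H a b : segment lam a b `<=` segment lam b a.
  move=> z /segmentE[Sz e]; apply/segmentE; split=> //.
  by rewrite (distC _ b a) -e (distC _ b z) (distC _ z a) addrC.
by apply/seteqP; split; apply: H.
Qed.

Lemma segment_l x y : S x -> segment lam x y x.
Proof. by move=> Sx; apply/segmentE; split=> //; rewrite dist_xx// add0r. Qed.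

Lemma segment_r x y : S y -> segment lam x y y.
Proof. by move=> Sy; rewrite segment_sym; apply: segment_l. Qed.

(** Two segments from [x] in the same direction overlap: [y] and [z] have the
    chord of the difference of their distances to [x]. *)
Lemma same_ray x y z : S x -> S y -> S z ->
  dot x y z = s (dist x y) * s (dist x z) -> dist x y <= dist x z ->
  segment lam x z y.
Proof.
move=> Sx Sy Sz dE le; apply/segmentE; split=> //.
have dxy := dist_ge0 Sx Sy; have dxz := dist_ge0 Sx Sz; have dyz := dist_ge0 Sy Sz.
have qE : q y z = 4 * s ((dist x z - dist x y) / 2) ^+ 2.
  rewrite s_half_sum sN mulNr sN sqrrN -(q_dist Sx Sz) -(q_dist Sx Sy) (q_third _ x) dE.
  have e1 := q_dist Sx Sz; have e2 := q_dist Sx Sy.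
  rewrite (_ : 8 * lam * s (dist x z / 2) ^+ 2 * s (dist x y / 2) ^+ 2 =
    lam * (4 * s (dist x z / 2) ^+ 2) * (4 * s (dist x y / 2) ^+ 2) / 2); last by field.
  by rewrite -e1 -e2; ring.
have a1 : adm_le lam ((dist x z - dist x y) / 2).
  by move=> l0; have := dist_half Sx Sz l0; lra.
have h : dist y z = dist x z - dist x y.
  apply/eqP; rewrite eq_le (dist_le Sy Sz) ?subr_ge0// qE lexx/= leNgt.
  by rewrite (dist_lt Sy Sz) ?subr_ge0// qE ltxx.
by rewrite h addrC subrK.
Qed.

End Motion.

Section Cyclic.
Variables (T : Type) (n : nat) (n0 : (0 < n)%N) (v : 'I_n -> T).

(** Indexing cyclic sequences by all natural numbers avoids
    arithmetic on ordinals. *)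
Definition ordm k : 'I_n := Ordinal (ltn_pmod k n0).
Definition cyc k : T := v (ordm k).

Lemma ordmK (i : 'I_n) : ordm i = i.
Proof. by apply: val_inj; rewrite /= modn_small. Qed.

Lemma ordmS k : ordS (ordm k) = ordm k.+1.
Proof. by apply: val_inj; rewrite /= -addn1 modnDml addn1. Qed.

Lemma ordm_pred k : ord_pred (ordm k.+1) = ordm k.
Proof. by rewrite -ordmS ordSK. Qed.

Lemma cycD k : cyc (k + n) = cyc k.
Proof. by congr v; apply: val_inj; rewrite /= modnDr. Qed.

Lemma ordm_eq j k : (ordm j == ordm k) = (j == k %[mod n]).
Proof. by rewrite -val_eqE. Qed.

End Cyclic.

(** In this section only the combinatorial consequences of convexity are used: [D]
    is on one side of each side line, consecutive sides turn, and a side meets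
    no further vertex. *)
Section ConvexPosition.
Variables (R : realType) (lam : R).
Local Notation S := (on_space lam).
Local Notation crs := (orient lam).
Variables (n : nat) (w : nat -> 'rV[R]_3) (D : set 'rV[R]_3).
Hypotheses (n3 : (2 < n)%N) (wD : forall k, w (k + n)%N = w k) (Sw : forall k, S (w k)).
Hypothesis Dw : forall k, D (w k).
Hypothesis turn : forall k, crs (w k) (w k.+1) (w k.+2) != 0.
Hypothesis one_sided : forall k, (forall z, D z -> 0 <= crs (w k) (w k.+1) z) \/
                                 (forall z, D z -> crs (w k) (w k.+1) z <= 0).
Hypothesis on_side : forall a k, segment lam (w a) (w a.+1) (w k) ->
  k = a %[mod n] \/ k = a.+1 %[mod n].

(** Two consecutive turns have the same sign, for both [w k] and [w k.+3] lie on the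
    same side of the line of [w k.+1] and [w k.+2]. *)
Lemma convex_orientation : exists2 e, e * e = 1 &
  (forall k, 0 < e * crs (w k) (w k.+1) (w k.+2)) /\
  (forall k z, D z -> 0 <= e * crs (w k) (w k.+1) z).
Proof.
set e := Num.sg (crs (w 0%N) (w 1%N) (w 2%N)).
have ee : e * e = 1.
  by rewrite /e; have := turn 0; case: sgrP => // _ _; rewrite ?mulr1 ?mulrNN ?mulr1.
have pos k : 0 < e * crs (w k) (w k.+1) (w k.+2).
  elim: k => [|k IH]; first by rewrite /e -normrEsg normr_gt0.
  have tk := turn k; have tk1 := turn k.+1.
  have r : crs (w k.+1) (w k.+2) (w k) = crs (w k) (w k.+1) (w k.+2) by rewrite crs_rot.
  have [h|h] := one_sided k.+1; have h1 := h _ (Dw k); have h2 := h _ (Dw k.+3); rewrite r in h1.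
    have p1 : 0 < crs (w k) (w k.+1) (w k.+2) by rewrite lt_neqAle eq_sym tk.
    have p2 : 0 < crs (w k.+1) (w k.+2) (w k.+3) by rewrite lt_neqAle eq_sym tk1.
    by rewrite pmulr_lgt0// in IH; rewrite mulr_gt0.
  have p1 : crs (w k) (w k.+1) (w k.+2) < 0 by rewrite lt_neqAle tk.
  have p2 : crs (w k.+1) (w k.+2) (w k.+3) < 0 by rewrite lt_neqAle tk1.
  by rewrite nmulr_lgt0// in IH; rewrite nmulr_lgt0.
exists e => //; split=> // k z Dz; have [h|h] := one_sided k.
  have := h _ (Dw k.+2); rewrite le_eqVlt eq_sym (negbTE (turn k))/= => p.
  by have := pos k; rewrite pmulr_lgt0// => e0; rewrite mulr_ge0 ?h// ltW.
have := h _ (Dw k.+2); rewrite le_eqVlt (negbTE (turn k))/= => p.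
by have := pos k; rewrite nmulr_lgt0// => e0; rewrite mulr_le0 ?h// ltW.
Qed.

Variable e : R.
Hypotheses (ee : e * e = 1) (pos : forall k, 0 < e * crs (w k) (w k.+1) (w k.+2))
  (nneg : forall k z, D z -> 0 <= e * crs (w k) (w k.+1) z).

Lemma crs_det3_pos x y z : (0 < e * crs x y z) = (0 < e * det3 x y z).
Proof. by rewrite crsE mulrCA pmulr_rgt0// kk_gt0. Qed.
Lemma crs_det3_nneg x y z : (0 <= e * crs x y z) = (0 <= e * det3 x y z).
Proof. by rewrite crsE mulrCA pmulr_rge0// kk_gt0. Qed.

Lemma ratio_ge0 (a b : R) : 0 <= e * a -> 0 < e * b -> 0 <= a / b.
Proof.
move=> ha hb; have bn : b != 0 by apply: contraTneq hb => ->; rewrite mulr0 ltxx.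
have en : e != 0 by apply: contraTneq hb => ->; rewrite mul0r ltxx.
have -> : a / b = (e * a) / (e * b) by field; rewrite bn en.
by rewrite divr_ge0// ltW.
Qed.

(** A vertex on the line of a side would be, by the two neighbouring side lines, in
    the cone of its two endpoints, that is, on the side itself. *)
Lemma strict_side a k : k <> a %[mod n] -> k <> a.+1 %[mod n] ->
  0 < e * crs (w a) (w a.+1) (w k).
Proof.
move=> ka ka1; rewrite lt_neqAle nneg// andbT eq_sym; apply/negP => /eqP z0.
have en : e != 0 by apply: contra_eq_neq ee => ->; rewrite mul0r eq_sym oner_neq0.
have d0 : det3 (w a) (w a.+1) (w k) = 0.
  apply/eqP; move/eqP: z0; rewrite crsE !mulf_eq0 (negbTE en)/=.
  by rewrite gt_eqF ?kk_gt0.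
have p2 := pos a; rewrite crs_det3_pos in p2.
have d2 : det3 (w a) (w a.+1) (w a.+2) != 0 by apply: contraTneq p2 => ->; rewrite mulr0 ltxx.
have := @cramer_div _ _ _ _ (w k) d2; rewrite d0 mul0r scale0r addr0.
set al := _ / _; set be := _ / _ => wE.
have al0 : 0 <= al.
  apply: ratio_ge0 => //; rewrite -crs_det3_nneg -(crs_rot lam).
  by rewrite nneg.
have be0 : 0 <= be.
  have h := nneg (a + n.-1) (Dw k).
  have e1 : w (a + n.-1).+1 = w a by rewrite (_ : (a + n.-1).+1 = a + n)%N ?wD//; lia.
  rewrite e1 crs_det3_nneg wE in h.
  have h2 := pos (a + n.-1); have e2 : w (a + n.-1).+2 = w a.+1.
    by rewrite (_ : (a + n.-1).+2 = a.+1 + n)%N ?wD//; lia.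
  rewrite e1 e2 crs_det3_pos in h2.
  rewrite (_ : det3 _ _ _ = be * det3 (w (a + n.-1)%N) (w a) (w a.+1)) in h; last first.
    by rewrite !det3E !mxE; ring.
  by move: h; rewrite mulrCA pmulr_lge0.
have /on_side[] : segment lam (w a) (w a.+1) (w k) by apply: cone_segment wE.
  exact: ka.
exact: ka1.
Qed.

Lemma sign_change (g : nat -> R) m : 0 <= g 0%N -> g m <= 0 -> (0 < m)%N ->
  exists2 k, (k < m)%N & 0 <= g k /\ g k.+1 <= 0.
Proof.
elim: m => // m IH g0 gm _; have [gm0|gm0] := leP 0 (g m); first by exists m.
case: m IH gm gm0 => [|m] IH gm gm0; first by move: g0; rewrite leNgt gm0.
by have [k km hk] := IH g0 (ltW gm0) isT; exists k => //; rewrite ltnW.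
Qed.

(** The rays from [w 0] through the other vertices cut [D] into triangles: the
    orientation of [w 0], [w k], [z] changes sign for some [k]. *)
Lemma fan_cover z : D z -> exists k a b g, [/\ 0 <= a, 0 <= b, 0 <= g &
  z = a *: w 0%N + b *: w k + g *: w k.+1].
Proof.
move=> Dz; pose g k := e * det3 (w 0%N) (w k.+1) z.
have n1 : n = n.-2.+2 by lia.
have g0 : 0 <= g 0%N by rewrite /g -crs_det3_nneg nneg.
have gm : g n.-2 <= 0.
  have h := nneg n.-2.+1 Dz.
  have wn : w n.-2.+2 = w 0%N by rewrite -n1 -[n in w n]add0n wD.
  rewrite wn crs_det3_nneg -det3_rot det3_swap mulrN oppr_ge0 in h.
  exact: h.
have [|k kn [h1 h2]] := sign_change g0 gm; first by case: (n) n3 => [|[|[|]]].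
have d0 : 0 < e * det3 (w 0%N) (w k.+1) (w k.+2).
  rewrite -det3_rot -crs_det3_pos; apply: strict_side.
    by rewrite mod0n modn_small//; lia.
  by rewrite mod0n modn_small//; lia.
have dn : det3 (w 0%N) (w k.+1) (w k.+2) != 0 by apply: contraTneq d0 => ->; rewrite mulr0 ltxx.
exists k.+1, (det3 z (w k.+1) (w k.+2) / det3 (w 0%N) (w k.+1) (w k.+2)),
  (det3 (w 0%N) z (w k.+2) / det3 (w 0%N) (w k.+1) (w k.+2)),
  (det3 (w 0%N) (w k.+1) z / det3 (w 0%N) (w k.+1) (w k.+2)).
split; last exact: cramer_div.
- by apply: ratio_ge0 => //; rewrite -det3_rot -crs_det3_nneg nneg.
- by apply: ratio_ge0 => //; rewrite det3_swap mulrN oppr_ge0.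
- exact: ratio_ge0.
Qed.

End ConvexPosition.

(** * Contacts of the minimal disk *)

(** Jordan's inequality at [pi / 2 - acos x]. *)
Lemma acos_ge_lin (R : realType) (x : R) : 0 < x <= 1 ->
  pi / 2 * (1 - x) <= acos x /\ (x < 1 -> pi / 2 * (1 - x) < acos x).
Proof.
move=> /andP[x0 x1].
have [/andP[a0 a1] ca] : 0 <= acos x <= pi / 2 /\ cos (acos x) = x.
  by have := @acos_div_itv _ (1 : R) x (ltW x0) x1 ltr01; rewrite divr1.
have p0 := pi_gt0 R.
have H : x < 1 -> pi / 2 * (1 - x) < acos x.
  move=> xl; have apos : 0 < acos x by rewrite acos_gt0// xl andbT; lra.
  have ax : acos x < pi / 2.
    rewrite lt_neqAle a1 andbT; apply/eqP => h.
    by move: ca x0; rewrite h cos_pihalf => <-; rewrite ltxx.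
  have := @jordan _ (pi / 2 - acos x); rewrite subr_gt0 ax => /(_ isT).
  rewrite (_ : sin (pi / 2 - acos x) = x); last first.
    by rewrite sinB sin_pihalf cos_pihalf mul1r mul0r subr0 ca.
  by move=> h; have {h} := h _; lra.
split=> //; move: x1; rewrite le_eqVlt => /predU1P[->|/H/ltW//].
by rewrite subrr mulr0 acos1.
Qed.

Section Contact.
Variables (R : realType) (lam : R).
Implicit Types (x y z O : 'rV[R]_3).
Local Notation s := (sn lam).
Local Notation c := (cs lam).
Local Notation ta := (tn lam).
Local Notation S := (on_space lam).
Local Notation form := (ip lam).
Local Notation dist := (dst lam).
Local Notation q := (chord_sq lam).
Local Notation dot := (dir_dot lam).
Local Notation crs := (orient lam).
Local Notation ang := (ang lam).
Local Notation reg x y := (0 < s (dist x y)).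

(** The centre and two contact points form an isosceles triangle with legs [rho],
    and [phi] is its base angle. *)
Lemma contact_ang O x y (rho : R) : S O -> S x -> S y -> reg x y -> 0 < s rho -> c rho != 0 ->
  dist O x = rho -> dist O y = rho -> ang x y O = phi lam (ta rho) x y.
Proof.
move=> SO Sx Sy rxy rr cn dx dy; rewrite angE// phi.unlock; congr acos.
have [t0 P0 qE sE] := tau_spec Sx Sy rxy.
have qO : q x O = q y O by rewrite !(qC _ _ O) (q_dist SO Sx) (q_dist SO Sy) dx dy.
have cE : 1 - lam * q x O / 2 = c rho by rewrite -(c_dist Sx SO) distC dx.
rewrite (distC _ x O) dx dotE -qO.
rewrite (_ : _ - _ = q x y / 2 * (1 - lam * q x O / 2)); last by field.
rewrite cE qE sE taE; field.
by rewrite cn (gt_eqF rr) (gt_eqF t0) (gt_eqF P0).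
Qed.

(** For two contacts [x] and [y] on different sides of the radius that ends at [u],
    the radius splits the angle [x u y] into two base angles. The orientation of
    [u], [x], [y] is positive since both base angles are acute. *)
Lemma contact_add e O u x y (rho : R) : e * e = 1 -> S O -> S u -> S x -> S y ->
  reg u x -> reg u y -> 0 < s rho -> 0 < c rho ->
  dist O u = rho -> dist O x = rho -> dist O y = rho ->
  0 < e * crs u x O -> 0 < e * crs u O y ->
  0 < e * crs u x y /\ ang u x y = phi lam (ta rho) u x + phi lam (ta rho) u y.
Proof.
move=> ee SO Su Sx Sy rx ry rr cr0 du dx dy h1 h2.
have cn : c rho != 0 by rewrite gt_eqF.
have rO : reg u O by rewrite distC du.
have dpos z : S z -> reg u z -> dist O z = rho -> 0 < dot u z O.
  move=> Sz rz dz; have [t0 P0 qE _] := tau_spec Su Sz rz; rewrite dotE.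
  have qO : q u O = q z O by rewrite !(qC _ _ O) (q_dist SO Su) (q_dist SO Sz) du dz.
  have cE : 1 - lam * q u O / 2 = c rho by rewrite -(c_dist Su SO) distC du.
  rewrite -qO (_ : _ - _ = q u z / 2 * (1 - lam * q u O / 2)); last by field.
  rewrite cE mulr_gt0// divr_gt0// qE mulr_gt0// divr_gt0// exprn_gt0//.
have cp : 0 < e * crs u x y.
  have dO : 0 < dot u O O by rewrite (dot_s Su SO) exprn_gt0.
  rewrite -(pmulr_rgt0 _ dO) mulrCA -(crs_dot Su Sx SO Sy).
  rewrite mulrDr mulrA mulrCA addr_gt0// mulr_gt0//; first by rewrite dotC dpos.
  exact: dpos.
split=> //.
have n1 : crs u x O != 0 by apply: contraTneq h1 => ->; rewrite mulr0 ltxx.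
have /andP[_ ap] := ang_lt_pi Su Sx SO rx rO n1.
rewrite (@ang_add _ lam e u x O y)// ?(ltW h1) ?(ltW h2) ?(ltW cp)//.
rewrite (contact_ang SO Su Sx rx rr cn du dx) (angC _ u O y).
by rewrite (contact_ang SO Su Sy ry rr cn du dy).
Qed.

End Contact.

Section Compare.
Variables (R : realType) (lam : R).
Local Notation s := (sn lam).
Local Notation S := (on_space lam).
Local Notation dist := (dst lam).
Local Notation crs := (orient lam).
Local Notation ang := (ang lam).
Local Notation tau := (tau lam).
Local Notation reg x y := (0 < s (dist x y)).
Variables (n : nat) (w : nat -> 'rV[R]_3) (e T : R).
Hypotheses (n3 : (2 < n)%N) (wD : forall k, w (k + n)%N = w k) (Sw : forall k, S (w k)).
Hypotheses (T0 : 0 < T) (lT : -1 < lam * T ^+ 2) (ee : e * e = 1).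
Hypothesis strict : forall a k, k <> a %[mod n] -> k <> a.+1 %[mod n] ->
  0 < e * crs (w a) (w a.+1) (w k).
Hypothesis chord : forall j k, j <> k %[mod n] -> reg (w j) (w k) /\ tau (w j) (w k) <= T.
Local Notation phi := (phi lam T).
Hypothesis sharp : forall k,
  ang (w k.+1) (w k) (w k.+2) < phi (w k) (w k.+1) + phi (w k.+1) (w k.+2).

Lemma fan_fwd j : (0 < j < n)%N ->
  phi (w 0%N) (w 1%N) <= phi (w 0%N) (w j) + ang (w 0%N) (w 1%N) (w j).
Proof.
move=> /andP[j0 jn].
apply: (@fan R lam T T0 lT e w n.-1) => //.
- by move=> a b /andP[ab bn]; apply: chord; rewrite !modn_small; lia.
- by move=> k /andP[k0 kn]; rewrite -crs_rot; apply: strict; rewrite ?mod0n modn_small; lia.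
- by move=> k /andP[k0 kn]; apply: strict; rewrite !modn_small; lia.
- move=> k kn; apply: strict; rewrite !modn_small; lia.
- by rewrite j0; lia.
Qed.

(** [fan_fwd] for the polygon traversed in the opposite direction, which reverses
    the orientation. *)
Lemma fan_bwd j : (0 < j < n)%N ->
  phi (w 0%N) (w n.-1) <= phi (w 0%N) (w j) + ang (w 0%N) (w n.-1) (w j).
Proof.
move=> /andP[j0 jn].
have wn : w n = w 0%N by rewrite -[n]add0n wD.
have ne : (- e) * (- e) = 1 by rewrite mulrNN.
have swp x y z : - e * crs z y x = e * crs x y z.
  by rewrite mulNr -mulrN -crs_swap -crs_rot.
have := @fan R lam T T0 lT (- e) (fun k => w (n - k)%N) n.-1 ne (fun k => Sw _).
rewrite subn0 wn subn1 => F.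
rewrite -{1 2}(_ : (n - (n - j) = j)%N); last by lia.
apply: F.
- by move=> a b /andP[ab bn]; apply: chord; case: a ab => [|a] ab;
    rewrite ?subn0 ?modnn !modn_small; lia.
- move=> k /andP[k0 kn].
  rewrite (_ : crs _ _ _ = crs (w n) (w (n - k)%N) (w (n - k.+1)%N)); last by rewrite wn.
  rewrite -(crs_rot _ (w n)) -[X in - e * X]crs_rot swp (_ : (n - k = (n - k.+1).+1)%N); last by lia.
  by rewrite crs_rot; apply: strict; rewrite modnn modn_small; lia.
- move=> k /andP[k0 kn].
  have -> : crs (w 0%N) (w n.-1) (w (n - k)%N) = crs (w (n - k)%N) (w n) (w n.-1).
    by rewrite wn crs_rot.
  rewrite swp (_ : n = n.-1.+1); last by lia.
  by apply: strict; rewrite /= ?prednK 1?modnn ?modn_small; lia.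
- move=> k kn; rewrite swp (_ : (n - k = (n - k.+2).+2)%N); last by lia.
  rewrite (_ : (n - k.+1 = (n - k.+2).+1)%N); last by lia.
  apply: strict; case: k kn => [|k] kn.
  + rewrite (_ : (n - 2).+2 = n)%N; last by lia.
    by rewrite modnn modn_small; lia.
  + by rewrite !modn_small; lia.
  + rewrite (_ : (n - 2).+2 = n)%N; last by lia.
    by rewrite modnn modn_small; lia.
  + by rewrite !modn_small; lia.
- move=> k kn; rewrite (_ : (n - k = (n - k.+2).+2)%N); last by lia.
  rewrite (_ : (n - k.+1 = (n - k.+2).+1)%N); last by lia.
  set m := (n - k.+2)%N; have := sharp m.
  by rewrite angC (phiC _ _ (w m)) (phiC _ _ (w m.+1) (w m.+2)) addrC.
- by lia.
Qed.

(** The interior angle at [w 0] splits along the diagonals to [w j] and [w j']. The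
    two fans bound the outer parts from below and the contact condition bounds
    the middle one, so that the angle is at least the sum of the two base
    angles of its sides, contrary to [sharp]. The first alternative is that of
    a contact antipodal to [w 0], where the middle part is missing. *)
Lemma no_contacts j j' : (0 < j < n)%N -> (0 < j' < n)%N ->
  (j = j' /\ phi (w 0%N) (w j) = 0) \/
  (0 < e * crs (w 0%N) (w j) (w j') /\
   phi (w 0%N) (w j) + phi (w 0%N) (w j') <= ang (w 0%N) (w j) (w j')) -> False.
Proof.
move=> hj hj'; have f1 := fan_fwd hj; have f2 := fan_bwd hj'.
have wn : w n = w 0%N by rewrite -[n]add0n wD.
have reg0 i : (0 < i < n)%N -> reg (w 0%N) (w i).
  by move=> /andP[i0 il]; have [] := @chord 0%N i => //; rewrite mod0n modn_small; lia.
have n1 : (0 < n.-1 < n)%N by lia.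
have o1 : (0 < 1 < n)%N by lia.
have first_side i : (0 < i < n)%N ->
    0 <= e * crs (w 0%N) (w 1%N) (w i) /\ ang (w 0%N) (w 1%N) (w i) < pi.
  move=> hi; have ri := reg0 _ hi; have r1 := reg0 _ o1.
  have [i1|i1] := eqVneq i 1%N.
    by rewrite i1 crs_diag mulr0 lexx ang_self// pi_gt0.
  have h : 0 < e * crs (w 0%N) (w 1%N) (w i).
    by apply: strict; rewrite ?mod0n modn_small ?modn_small; lia.
  have hn : crs (w 0%N) (w 1%N) (w i) != 0 by apply: contraTneq h => ->; rewrite mulr0 ltxx.
  by have /andP[_ ->] := ang_lt_pi (Sw _) (Sw _) (Sw _) r1 ri hn; rewrite ltW.
have last_side i : (0 < i < n)%N -> 0 <= e * crs (w 0%N) (w i) (w n.-1).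
  move=> hi; have [->|i1] := eqVneq i n.-1; first by rewrite crs_diag mulr0.
  rewrite -wn -crs_rot crs_rot -[crs _ _ _]crs_rot crs_rot.
  have -> : crs (w n) (w i) (w n.-1) = crs (w n.-1) (w n.-1.+1) (w i).
    by rewrite crs_rot prednK//; lia.
  by rewrite ltW//; apply: strict; rewrite ?prednK ?modnn ?modn_small; lia.
have total i : (0 < i < n)%N -> ang (w 0%N) (w 1%N) (w n.-1) =
    ang (w 0%N) (w 1%N) (w i) + ang (w 0%N) (w i) (w n.-1).
  move=> hi; have [c1 a1] := first_side _ hi; have [c2 _] := first_side _ n1.
  by apply: (ang_add (e := e)) => //; [exact: reg0|exact: reg0|exact: reg0|exact: last_side].
have A0 : ang (w 0%N) (w 1%N) (w n.-1) < phi (w 0%N) (w n.-1) + phi (w 0%N) (w 1%N).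
  have := sharp n.-1; rewrite (_ : n.-1.+1 = n); last by lia.
  by rewrite wn -[n.+1]add1n wD angC (phiC _ _ (w 0%N) (w n.-1)).
have tj' := total _ hj'.
rewrite (angC _ (w 0%N) (w n.-1)) in f2.
move=> [[jj pj]|[cp le]].
  by rewrite -jj in f2 tj'; move: f1 f2; rewrite pj; lra.
have [c1 a1] := first_side _ hj; have [c2 _] := first_side _ hj'.
have : ang (w 0%N) (w 1%N) (w j') = ang (w 0%N) (w 1%N) (w j) + ang (w 0%N) (w j) (w j').
  by apply: (ang_add (e := e)) => //; try exact: reg0; rewrite ltW.
lra.
Qed.

End Compare.

(** * Proper polygons *)

(** The curvature condition bounds [A] by [pi - ka (l1 + l2) / 2], and
    [acos_ge_lin] bounds the base angles from below by [pi / 2 - ka l / 2]. All is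
    strict unless both base angles vanish, in which case this bound on [A] is not
    positive. *)
Lemma angle_lt_base_angles (R : realType) (T t1 t2 l1 l2 ka A : R) : 0 < T ->
  0 < t1 -> t1 <= T -> 0 < t2 -> t2 <= T -> 0 < A -> 0 < l1 + l2 ->
  ka <= 2 * (pi - A) / (l1 + l2) ->
  pi / 2 * t1 <= ka * (l1 / 2) * T -> pi / 2 * t2 <= ka * (l2 / 2) * T ->
  A < acos (t1 / T) + acos (t2 / T).
Proof.
move=> T0 t10 t1T t20 t2T A0 l0; rewrite ler_pdivlMr// => hk k1 k2.
have b1 : 0 < t1 / T <= 1 by rewrite divr_gt0//= ler_pdivrMr// mul1r.
have b2 : 0 < t2 / T <= 1 by rewrite divr_gt0//= ler_pdivrMr// mul1r.
have [j1 s1] := acos_ge_lin b1; have [j2 s2] := acos_ge_lin b2.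
have {}k1 : pi / 2 * (t1 / T) <= ka * (l1 / 2) by rewrite mulrA ler_pdivrMr.
have {}k2 : pi / 2 * (t2 / T) <= ka * (l2 / 2) by rewrite mulrA ler_pdivrMr.
have [e1|n1] := eqVneq (t1 / T) 1; last first.
  by have := s1 _; rewrite lt_neqAle n1; case/andP: b1 => _ -> /(_ isT); lra.
have [e2|n2] := eqVneq (t2 / T) 1; last first.
  by have := s2 _; rewrite lt_neqAle n2; case/andP: b2 => _ -> /(_ isT); lra.
by move: k1 k2; rewrite e1 e2 acos1; lra.
Qed.

Lemma mod_neq0 n j : (0 < j < n)%N -> 0%N <> j %[mod n].
Proof. by move=> /andP[j0 jn]; rewrite mod0n modn_small// => j00; rewrite -j00 in j0. Qed.

Section Proper.
Variables (R : realType) (lam : R).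
Local Notation s := (sn lam).
Local Notation c := (cs lam).
Local Notation ta := (tn lam).
Local Notation S := (on_space lam).
Local Notation form := (ip lam).
Local Notation dist := (dst lam).
Local Notation dir := (dirv lam).
Local Notation q := (chord_sq lam).
Local Notation dot := (dir_dot lam).
Local Notation crs := (orient lam).
Local Notation ang := (ang lam).
Local Notation tau := (tau lam).
Local Notation reg x y := (0 < s (dist x y)).

Lemma diskE x r y : disk lam x r y <-> S y /\ dist x y <= r.
Proof. by rewrite on_space.unlock dst.unlock. Qed.

(** On the sphere, a disk of radius [pi / sqrt lam] is everything, so the
    circumradius is at most that, and [ta rho > 0] puts it in the first
    quarter. *)
Lemma circumradius_adm (D : set 'rV[R]_3) rho x : D `<=` S -> D x ->
  is_circumradius lam D rho -> 0 < ta rho -> 0 < rho /\ adm lam rho.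
Proof.
move=> DS Dx [[ O SO DO] min] T0.
have {}SO : S O by rewrite on_space.unlock.
have r0 : 0 <= rho.
  by have /diskE[_] := DO _ Dx; apply: le_trans; apply: dist_ge0 => //; exact: DS.
have rp : 0 < rho.
  by rewrite lt_neqAle r0 andbT; apply: contraTneq T0 => <-; rewrite ta0 ltxx.
split=> // l0; have k0 : 0 < Num.sqrt lam by rewrite sqrtr_gt0.
have rpi : rho <= pi / Num.sqrt lam.
  apply: min; exists O; first by rewrite on_space.unlock in SO.
  move=> y Dy; apply/diskE; split; first exact: DS.
  have := dist_half SO (DS _ Dy) l0; rewrite mulrAC ler_pM2r ?invr_gt0//.
rewrite ltNge; apply/negP => h; move: T0; rewrite taE.
have a1 : pi / 2 <= Num.sqrt lam * rho by rewrite [leRHS]mulrC -ler_pdivrMr.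
have a2 : Num.sqrt lam * rho <= pi by rewrite mulrC -ler_pdivlMr.
have p0 := pi_gt0 R.
have s_ge : 0 <= s rho.
  by rewrite s_pos// divr_ge0 ?(ltW k0)// sin_ge0_pi// a2 andbT; lra.
have c_le : c rho <= 0.
  rewrite c_pos// -(cos_pihalf R); apply: cos_le => //; lra.
by rewrite ltNge mulr_ge0_le0// invr_le0.
Qed.

Variables (n : nat) (v : 'I_n -> 'rV[R]_3) (D : set 'rV[R]_3) (ka rho : R).
Hypotheses (hP : is_proper_convex_polygon lam v D) (ka0 : 0 < ka)
  (hk : forall i, ka <= vertex_curvature lam v i)
  (hrho : is_circumradius lam D rho) (T0 : 0 < ta rho)
  (hT : forall i, pi / 2 * ta (side_length lam v i / 2) <= ka * (side_length lam v i / 2) * ta rho).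

Let n3 : (2 < n)%N. Proof. by case: hP. Qed.
Let n0 : (0 < n)%N. Proof. exact: ltn_trans n3. Qed.
Let w k := cyc n0 v k.

Let Sw k : S (w k).
Proof. by rewrite on_space.unlock; case: hP => _ h _ _ _; exact: h. Qed.

Let wD k : w (k + n)%N = w k. Proof. exact: cycD. Qed.

Let inj j k : w j = w k -> j = k %[mod n].
Proof. by case: hP => _ _ [vi _] _ _ /vi/eqP; rewrite ordm_eq => /eqP. Qed.

Let DS : D `<=` S.
Proof. by case: hP => _ _ _ [h _ _] _; rewrite on_space.unlock. Qed.

Let sideE k : side lam v (ordm n0 k) = segment lam (w k) (w k.+1).
Proof. by rewrite /side ordmS. Qed.

Let side_bd k : segment lam (w k) (w k.+1) `<=` D `&` closure (S `\` D).
Proof.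
have -> : S = space_form lam by apply/funext => x; rewrite on_space.unlock.
by case: hP => _ _ _ _ ->; rewrite -sideE => z hz; exists (ordm n0 k).
Qed.

Let Dw k : D (w k).
Proof. by have [] : (D `&` closure (S `\` D)) (w k) by apply: (@side_bd k); apply: segment_l. Qed.

Let rho_spec : 0 < rho /\ adm lam rho.
Proof. exact: circumradius_adm (Dw 0) hrho T0. Qed.

Let diam x y : D x -> D y -> dist x y / 2 <= rho.
Proof.
case: hrho => -[ O SO DO] _ Dx Dy; have {}SO : S O by rewrite on_space.unlock.
have /diskE[Sx dx] := DO _ Dx; have /diskE[Sy dy] := DO _ Dy.
have := dist_triangle Sx Sy SO; lra.
Qed.

(** Two points of [D] are closer than antipodal, as both lie in a disk whose radius
    is less than a quarter great circle. *)
Let Dpair x y : D x -> D y -> x != y ->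
  [/\ reg x y, tau x y <= ta rho & lam * q x y < 4].
Proof.
move=> Dx Dy xy; have [r0 ra] := rho_spec; have h := diam Dx Dy.
have Sx := DS Dx; have Sy := DS Dy.
have d0 : 0 < dist x y / 2.
  rewrite lt_neqAle divr_ge0 ?dist_ge0// andbT eq_sym.
  apply: contra xy => /eqP e0; apply/eqP; apply: (q_eq0 Sx Sy).
  by rewrite (q_dist Sx Sy) e0 s0 expr0n mulr0.
have da : adm lam (dist x y / 2) by move=> l0; exact: le_lt_trans (ra l0).
have sp := s_gt0 d0 da; have cp := c_gt0 (ltW d0) da.
split.
- by rewrite -[dist x y](divfK (_ : (2 : R) != 0))// mulrC s_double !mulr_gt0.
- rewrite tau.unlock; move: h; rewrite le_eqVlt => /predU1P[->//|h].
  by rewrite ltW// ta_lt// ltW.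
- rewrite (q_dist Sx Sy); have := c2s2 lam (dist x y / 2).
  have : 0 < c (dist x y / 2) ^+ 2 by rewrite exprn_gt0.
  lra.
Qed.

Let chord j k : j <> k %[mod n] -> reg (w j) (w k) /\ tau (w j) (w k) <= ta rho.
Proof.
move=> jk; have [] := Dpair (Dw j) (Dw k); last by [].
by apply: contra_notN jk => /eqP/inj.
Qed.

Let next_neq k : k <> k.+1 %[mod n].
Proof.
move=> /eqP; rewrite -[k in X in X == _]addn0 -[k.+1]addn1 eqn_modDl mod0n modn_small//; lia.
Qed.

Let next2_neq k : k <> k.+2 %[mod n].
Proof.
move=> /eqP; rewrite -[k in X in X == _]addn0 -[k.+2]addn2 eqn_modDl mod0n modn_small//; lia.
Qed.

Let on_side a k : segment lam (w a) (w a.+1) (w k) -> k = a %[mod n] \/ k = a.+1 %[mod n].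
Proof.
move=> h; have [->|ka'] := eqVneq (k %% n)%N (a %% n)%N; first by left.
case: hP => _ _ [vi simp] _ _; have := simp (ordm n0 a) (ordm n0 k).
rewrite ordm_eq eq_sym => /(_ ka' (w k)) /=.
rewrite !sideE => /(_ (conj h (segment_l _ (Sw k)))) [] /= [/inj ->|]; first by left.
by rewrite ordmS => /inj ->; right.
Qed.

Let interiorE k : interior_angle lam v (ordm n0 k.+1) = ang (w k.+1) (w k) (w k.+2).
Proof. by rewrite ang.unlock /interior_angle ordm_pred ordmS. Qed.

Let curvatureE k : vertex_curvature lam v (ordm n0 k.+1) =
  2 * (pi - ang (w k.+1) (w k) (w k.+2)) / (dist (w k) (w k.+1) + dist (w k.+1) (w k.+2)).
Proof.
by rewrite /vertex_curvature interiorE ordm_pred /side_length !ordmS dst.unlock.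
Qed.

Let dpos j k : j <> k %[mod n] -> 0 < dist (w j) (w k).
Proof.
move=> /chord[r _]; rewrite lt_neqAle dist_ge0// andbT.
by apply: contraTneq r => <-; rewrite s0 ltxx.
Qed.

(** A straight angle has curvature zero, which is below [ka]; in a zero angle
    two sides overlap, so that a vertex lies on a side to which it does not
    belong. *)
Let turn k : crs (w k) (w k.+1) (w k.+2) != 0.
Proof.
apply/negP => /eqP z0.
have [r1 _] := chord (@next_neq k.+1).
have [r0 _] : reg (w k.+1) (w k) /\ tau (w k.+1) (w k) <= ta rho.
  by apply: chord => h; apply: (@next_neq k).
have [/andP[A0 A1] cA sA] := ang_spec (Sw k.+1) (Sw k) (Sw k.+2) r0 r1.
have cz : crs (w k.+1) (w k) (w k.+2) = 0.
  by rewrite crs_swap crs_rot z0 oppr0.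
have {}sA : sin (ang (w k.+1) (w k) (w k.+2)) = 0.
  move/eqP: sA; rewrite cz normr0 mulf_eq0 => /orP[/eqP//|].
  by rewrite gt_eqF// mulr_gt0.
have [Apos|Anp] := ltP 0 (ang (w k.+1) (w k) (w k.+2)).
  have Api : ang (w k.+1) (w k) (w k.+2) = pi.
    apply/eqP; rewrite eq_le A1/= leNgt; apply/negP => h.
    by have := @sin_gt0_pi _ (ang (w k.+1) (w k) (w k.+2)); rewrite Apos h sA ltxx => /(_ isT).
  by have := hk (ordm n0 k.+1); rewrite curvatureE Api subrr mulr0 mul0r leNgt ka0.
have Az : ang (w k.+1) (w k) (w k.+2) = 0 by apply/eqP; rewrite eq_le Anp.
rewrite Az cos0 mul1r in cA.
have [le|le] := leP (dist (w k.+1) (w k)) (dist (w k.+1) (w k.+2)).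
  have /on_side[/esym/esym h|h] : segment lam (w k.+1) (w k.+2) (w k).
      by apply: same_ray.
    exact: (@next_neq k).
  exact: (@next2_neq k).
have : segment lam (w k.+1) (w k) (w k.+2).
  by apply: same_ray => //; rewrite 1?dotC -?cA 1?mulrC// ltW.
rewrite segment_sym => /on_side[h|h]; first exact: (@next2_neq k).
exact: (@next_neq k.+1).
Qed.

Let one_sided k : (forall z, D z -> 0 <= crs (w k) (w k.+1) z) \/
                  (forall z, D z -> crs (w k) (w k.+1) z <= 0).
Proof.
have Dc : geodesically_convex lam D by case: hP => _ _ _ [].
have wn : w k != w k.+1 by apply/negP => /eqP/inj; exact: next_neq.
have [_ _ lq] := Dpair (Dw k) (Dw k.+1) wn.
have [h|h] := side_support DS Dc (Sw k) (Sw k.+1) (Dw k) (Dw k.+1) wn lq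
   (fun z hz => (side_bd hz).2).
- by left=> z Dz; rewrite crsE mulr_ge0 ?h// ltW// kk_gt0.
- by right=> z Dz; rewrite crsE mulr_ge0_le0 ?h// ltW// kk_gt0.
Qed.

Let sharp k :
  ang (w k.+1) (w k) (w k.+2) <
    phi lam (ta rho) (w k) (w k.+1) + phi lam (ta rho) (w k.+1) (w k.+2).
Proof.
have [r1 t1] := chord (@next_neq k); have [r2 t2] := chord (@next_neq k.+1).
have [p1 _ _ _] := tau_spec (Sw k) (Sw k.+1) r1.
have [p2 _ _ _] := tau_spec (Sw k.+1) (Sw k.+2) r2.
have d1 := dpos (@next_neq k); have d2 := dpos (@next_neq k.+1).
have cn : crs (w k.+1) (w k) (w k.+2) != 0 by rewrite crs_swap crs_rot oppr_eq0 turn.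
have r1' : reg (w k.+1) (w k) by rewrite distC.
have /andP[A0 _] := ang_lt_pi (Sw _) (Sw _) (Sw _) r1' r2 cn.
rewrite phi.unlock; apply: (@angle_lt_base_angles _ _ _ _ (dist (w k) (w k.+1)) (dist (w k.+1) (w k.+2)) ka) => //.
- exact: addr_gt0.
- by rewrite -curvatureE.
- by have := hT (ordm n0 k); rewrite /side_length ordmS tau.unlock dst.unlock.
- by have := hT (ordm n0 k.+1); rewrite /side_length ordmS tau.unlock dst.unlock.
Qed.

(** The hypothesis [hT] is what the inequality opposite to the theorem's gives at
    each side. The rest is the choice of the two contact points for
    [no_contacts]. *)
Lemma proper_contradiction : False.
Proof.
have [r0 ra] := rho_spec.
have cr0 : 0 < c rho by rewrite c_gt0// ltW.
have sr0 : 0 < s rho by rewrite s_gt0.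
have lT : -1 < lam * ta rho ^+ 2.
  have : 0 < 1 + lam * ta rho ^+ 2; last by lra.
  have -> : 1 + lam * ta rho ^+ 2 = (c rho)^-1 ^+ 2.
    transitivity ((c rho ^+ 2 + lam * s rho ^+ 2) * (c rho)^-1 ^+ 2); last by rewrite c2s2 mul1r.
    by rewrite taE; field; rewrite gt_eqF.
  by rewrite exprn_gt0// invr_gt0.
have [e ee [pos nneg]] := convex_orientation Dw turn one_sided.
have strict := strict_side n3 wD Sw Dw on_side ee pos nneg.
have cover := fan_cover n3 wD Sw Dw on_side ee pos nneg.
have adm2 (r : R) : 0 <= r -> r <= rho -> adm_le lam (r / 2).
  move=> r_0 rr l0; have := ra l0; have : r / 2 <= rho by lra.
  by move=> h1 h2; rewrite ltW// (le_lt_trans h1).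
set Q := 4 * s (rho / 2) ^+ 2.
have lQ : 0 < lam -> lam * Q <= 2.
  move=> l0; have := c_double lam (rho / 2); rewrite mulrC divfK// => e1.
  by rewrite /Q; lra.
(* Otherwise a smaller disk would contain the vertices, and then all of [D] by
   [fan_cover] and the convexity of disks. *)
have minv O' : S O' -> exists i, Q <= q O' (v i).
  move=> SO'; apply: contrapT => /forallNP H.
  have Sv i : S (v i) by rewrite on_space.unlock; case: hP => _ h _ _ _; exact: h.
  have dlt i : dist O' (v i) < rho.
    rewrite (dist_lt SO' (Sv i)) ?(ltW r0)//; last by apply: adm2; rewrite ?(ltW r0).
    by rewrite ltNge; apply/negP; exact: H.
  pose r' := \big[Num.max/0]_i dist O' (v i).
  have r'lt : r' < rho by apply: bigmax_lt.
  have r'0 : 0 <= r' by apply: bigmax_ge_id.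
  have dr i : dist O' (v i) <= r' by apply: le_bigmax_cond.
  have a' : adm_le lam (r' / 2) by apply: adm2 => //; exact: ltW.
  set Q' := 4 * s (r' / 2) ^+ 2.
  have qr k : q O' (w k) <= Q' by rewrite -(dist_le SO' (Sw k))//; exact: dr.
  have lQ' : 0 < lam -> lam * Q' <= 2.
    move=> l0; have := c_double lam (r' / 2); rewrite mulrC divfK// => e1.
    have : 0 < c r' by apply: c_gt0 => // _; apply: lt_trans (ra l0).
    by rewrite /Q'; lra.
  have : rho <= r'.
    case: hrho => _; apply; exists O'; first by rewrite on_space.unlock in SO'.
    move=> z Dz; have Sz := DS Dz; apply/diskE; split=> //.
    have [k [a [b [g [a0 b0 g0 zE]]]]] := cover _ Dz.
    by rewrite (dist_le SO' Sz)//; apply: (cone3_q_le SO' (Sw 0) (Sw k) (Sw k.+1) Sz a0 b0 g0 zE).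
  by rewrite leNgt r'lt.
case: (hrho) => -[ O SO' DO] _; have SO : S O by rewrite on_space.unlock.
have dO k : dist O (w k) <= rho by have /diskE[] := DO _ (Dw k).
have qO k : q O (w k) <= Q.
  by rewrite -(dist_le SO (Sw k)) ?(ltW r0)//; apply: adm2; rewrite ?(ltW r0).
have vw (i : 'I_n) : v i = w i by rewrite /w /cyc ordmK.
have contact_dist k : Q <= q O (w k) -> dist O (w k) = rho.
  move=> h; apply/eqP; rewrite eq_le dO/= leNgt (dist_lt SO (Sw k)) ?(ltW r0)//.
    by rewrite -leNgt.
  by apply: adm2; rewrite ?(ltW r0).
have [b /[!vw] hb] := minv _ SO.
have db := contact_dist _ hb.
(* If all contacts other than [w b] were strictly on one side of this radius, the
   centre could move: towards them, perpendicularly to the radius, and slightly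
   towards [w b]. *)
have both (sg : R) : exists2 i : 'I_n, i != b & Q <= q O (w i) /\ sg * crs O (w b) (w i) <= 0.
  apply: contrapT => H.
  have {}H (i : 'I_n) : i != b -> Q <= q O (w i) -> 0 < sg * crs O (w b) (w i).
    by move=> ib hi; rewrite ltNge; apply/negP => hc; apply: H; exists i.
  have [h th hE] := tangent_rot SO (Sw b).
  have : \forall k \near (0 : R)^'+, forall i : 'I_n, Q <= q O (w i) ->
      0 < form (sg *: h + k *: dir O (w b)) (dir O (w i)).
    near=> k => i hi; rewrite !form_lin hE// form_dir//.
    have k0 : 0 < k by near: k; exact: nbhs_right_gt.
    have [->|ib] := eqVneq i b.
      rewrite crs_diag mulr0 add0r mulr_gt0// (dot_s SO (Sw b)) exprn_gt0// db//.
    suff : - (sg * crs O (w b) (w i)) + k * (- dot O (w b) (w i) + k * 0) < 0 by lra.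
    move: i hi ib; near: k; apply: filter_forall => i.
    have [hi|hi] := pselect (Q <= q O (w i)); last by near=> k.
    have [ib|ib] := eqVneq i b; first by near=> k.
    have : \forall k \near (0 : R)^'+, - (sg * crs O (w b) (w i)) + k * (- dot O (w b) (w i) + k * 0) < 0.
      by apply: small_quad; left; rewrite oppr_lt0; exact: H.
    by apply: filterS.
  move=> N; have [k hk'] := @filter_ex _ _ (at_right_proper_filter (0 : R)) _ N.
  have tk : tangent lam O (sg *: h + k *: dir O (w b)).
    by apply: tangentD; apply: tangentZ => //; apply: dir_tangent.
  have [ O' SO2 hO'] := move_center SO tk (fun i => Sw i) (fun i => qO i)
     (fun (i : 'I_n) (e0 : q O (w i) = Q) => hk' i (eq_ind_r (fun t => Q <= t) (lexx Q) e0)).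
  have [i] := minv _ SO2; rewrite vw leNgt hO'//.
have w_mod j k : j = k %[mod n] -> w j = w k.
  by move=> jk; congr v; apply: val_inj.
pose u k := w (k + b)%N.
have uD k : u (k + n)%N = u k by rewrite /u addnAC wD.
have u_strict a k : k <> a %[mod n] -> k <> a.+1 %[mod n] -> 0 < e * crs (u a) (u a.+1) (u k).
  by move=> h1 h2; apply: strict => /eqP; rewrite -?addSn eqn_modDr => /eqP.
have u_chord j k : j <> k %[mod n] -> reg (u j) (u k) /\ tau (u j) (u k) <= ta rho.
  by move=> jk; apply: chord => /eqP; rewrite eqn_modDr => /eqP.
have shift (i : 'I_n) : i != b -> exists2 j, (0 < j < n)%N & u j = w i.
  move=> ib; exists ((i + (n - b)) %% n)%N; last first.
    apply: w_mod; rewrite modnDml -addnA subnK ?modnDr//; exact: ltnW.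
  rewrite ltn_mod n0 andbT lt0n; apply: contra ib => /eqP h.
  have : (i + (n - b) + b)%N = b %[mod n] by rewrite -modnDml h add0n.
  rewrite -addnA subnK ?modnDr; last exact: ltnW.
  by rewrite !modn_small// => /val_inj ->.
have u0 : u 0%N = w b by [].
have none := no_contacts n3 uD (fun k => Sw _) T0 lT ee u_strict u_chord (fun k => sharp _).
have cn : c rho != 0 by rewrite gt_eqF.
have regb j : (0 < j < n)%N -> reg (w b) (u j).
  by move=> hj; have [] := u_chord 0%N j (mod_neq0 hj).
(* A contact on the line of [w b] and [O], other than [w b], is antipodal to it in
   the disk, since its base angle is acute and has sine zero. *)
have antipodal j : (0 < j < n)%N -> Q <= q O (u j) -> crs (w b) (u j) O = 0 ->
    phi lam (ta rho) (u 0%N) (u j) = 0.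
  move=> hj hc z0; have rb := regb _ hj; have rO : reg (w b) O by rewrite distC db.
  have [_ _ sA] := ang_spec (Sw b) (Sw _) SO rb rO.
  rewrite (contact_ang SO (Sw b) (Sw _) rb sr0 cn db (contact_dist _ hc)) z0 normr0 in sA.
  have [t0 _ _ _] := tau_spec (Sw b) (Sw _) rb.
  have [_ tT] : reg (w b) (u j) /\ tau (w b) (u j) <= ta rho.
    exact: (u_chord 0%N j (mod_neq0 hj)).
  have [/andP[p0 p1] _] := acos_div_itv (ltW t0) tT T0.
  apply/eqP; rewrite eq_le u0; apply/andP; split; last by rewrite phi.unlock.
  rewrite leNgt; apply/negP => pp; move/eqP: sA; rewrite mulf_eq0 [X in _ || X]gt_eqF ?mulr_gt0// orbF.
  rewrite gt_eqF// sin_gt0_pi// pp/= phi.unlock (le_lt_trans p1)//.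
  by have := pi_gt0 R; lra.
have [i1 i1b [c1 s1]] := both (- e); have [i2 i2b [c2 s2]] := both e.
have [j hj uj] := shift _ i1b; have [j' hj' uj'] := shift _ i2b.
rewrite -uj in c1 s1; rewrite -uj' in c2 s2.
have {}s1 : 0 <= e * crs (w b) (u j) O by rewrite crs_rot; move: s1; rewrite mulNr oppr_le0.
have {}s2 : 0 <= e * crs (w b) O (u j') by rewrite crs_swap crs_rot mulrN oppr_ge0.
have en : e != 0 by apply: contra_eq_neq ee => ->; rewrite mul0r eq_sym oner_neq0.
have [z1|z1] := eqVneq (crs (w b) (u j) O) 0.
  by apply: (none j j) => //; left; split=> //; apply: antipodal.
have [z2|z2] := eqVneq (crs (w b) O (u j')) 0.
  apply: (none j' j') => //; left; split=> //; apply: antipodal => //.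
  by rewrite crs_swap z2 oppr0.
have {}s1 : 0 < e * crs (w b) (u j) O by rewrite lt_neqAle s1 andbT eq_sym mulf_neq0.
have {}s2 : 0 < e * crs (w b) O (u j') by rewrite lt_neqAle s2 andbT eq_sym mulf_neq0.
apply: (none j j') => //; right; rewrite u0.
have [h1 ->] := contact_add ee SO (Sw b) (Sw _) (Sw _) (regb _ hj) (regb _ hj') sr0 cr0 db
  (contact_dist _ c1) (contact_dist _ c2) s1 s2.
by split.
Unshelve. all: by end_near. Qed.

End Proper.

(** * Doubly covered segments *)
Section TwoGon.
Variables (R : realType) (lam : R).
Local Notation c := (cs lam).
Local Notation S := (on_space lam).
Local Notation form := (ip lam).
Local Notation dist := (dst lam).
Local Notation q := (chord_sq lam).
Local Notation ang := (ang lam).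

(** The disk about the midpoint contains the segment by the convexity of disks, and
    no smaller disk contains both ends, by the triangle inequality. *)
Lemma segment_circumradius (x y : 'rV[R]_3) rho : S x -> S y -> x != y ->
  adm lam (dist x y / 2) -> is_circumradius lam (segment lam x y) rho ->
  rho = dist x y / 2.
Proof.
move=> Sx Sy xy ad [[ O SO DO] min].
have {}SO : S O by rewrite on_space.unlock.
set d := dist x y; have d0 : 0 < d.
  rewrite lt_neqAle dist_ge0// andbT eq_sym; apply: contra xy => /eqP e0; apply/eqP.
  by apply: (q_eq0 Sx Sy); rewrite (q_dist Sx Sy) -/d e0 mul0r s0 expr0n mulr0.
have d20 : 0 < d / 2 by rewrite divr_gt0.
have lq : lam * q x y < 4.
  rewrite (q_dist Sx Sy); have := c2s2 lam (d / 2).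
  have : 0 < c (d / 2) ^+ 2 by rewrite exprn_gt0// c_gt0// ltW.
  by rewrite -/d; lra.
apply/eqP; rewrite eq_le; apply/andP; split; last first.
  have /diskE[_ dx] := DO _ (segment_l y Sx); have /diskE[_ dy] := DO _ (segment_r x Sy).
  by have := dist_triangle Sx Sy SO; rewrite -/d; lra.
have [N N0 Sp] := cone2_normal Sx Sy ltr01 ltr01 lq.
set p := N^-1 *: _ in Sp.
have pE : p = N^-1 *: x + N^-1 *: y by rewrite /p !scale1r scalerDr.
have Ni : 0 < N^-1 by rewrite invr_gt0.
have /segmentE[_] : segment lam x y p by apply: cone_segment pE => //; exact: ltW.
rewrite (distC _ x p) => dpE.
have qpE : q p x = q p y.
  have [l0|l0] := eqVneq lam 0.
    have N2 : N^-1 = 2^-1.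
      by move: Sx Sy Sp; rewrite pE !sf_zero// !mxE => -> ->; lra.
    have yE : p - y = - (p - x).
      by rewrite pE N2; apply/rowP => i; rewrite !mxE; field.
    by rewrite !qF yE formNl formNr opprK.
  apply: (mulfI l0).
  have ex : lam * q p x = 2 - 2 * (lam * form p x) by rewrite (q_form l0 Sp Sx); field.
  have ey : lam * q p y = 2 - 2 * (lam * form p y) by rewrite (q_form l0 Sp Sy); field.
  have xx := sf_form l0 Sx; have yy := sf_form l0 Sy.
  rewrite ex ey pE !form_lin (formC _ y x).
  rewrite (_ : lam * (N^-1 * form x x + N^-1 * form x y) = N^-1 * (lam * form x x) + lam * (N^-1 * form x y)); last by ring.
  rewrite (_ : lam * (N^-1 * form x y + N^-1 * form y y) = N^-1 * (lam * form y y) + lam * (N^-1 * form x y)); last by ring.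
  by rewrite xx yy.
have a4 : adm_le lam (d / 2 / 2).
  by move=> l0; have := ad l0; rewrite -/d => h; rewrite ltW// (le_lt_trans _ h)//; lra.
have dp_eq : dist p x = dist p y.
  have := dist_ge0 Sp Sx; have := dist_ge0 Sp Sy => py px.
  have h1 := dist_half Sp Sx; have h2 := dist_half Sp Sy.
  apply/eqP; rewrite eq_le (dist_le Sp Sx py h2) (dist_le Sp Sy px h1).
  by rewrite -(q_dist Sp Sx) -(q_dist Sp Sy) qpE lexx.
have dpx : dist p x = d / 2 by move: dpE; rewrite -dp_eq -/d; lra.
have dpy : dist p y = d / 2 by rewrite -dp_eq.
apply: min; exists p; first by rewrite on_space.unlock in Sp.
move=> z zs; have [Sz _] : S z /\ dist x z + dist z y = dist x y by apply/segmentE.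
apply/diskE; split=> //.
have [a [b [a0 b0 zE]]] := segment_cone Sx Sy xy lq zs.
rewrite (dist_le Sp Sz) ?(ltW d20)//.
apply: (@cone3_q_le _ lam p x y x z a b 0) => //.
- by rewrite scale0r addr0.
- move=> l0; have := c_double lam (d / 2 / 2); rewrite [2 * _]mulrC divfK// => e1.
  have : 0 < c (d / 2) by rewrite c_gt0// ltW.
  by lra.
- by rewrite (q_dist Sp Sx) dpx.
- by rewrite (q_dist Sp Sy) dpy.
- by rewrite (q_dist Sp Sx) dpx.
Qed.

Lemma two_gon (n : nat) (v : 'I_n -> 'rV[R]_3) (D : set 'rV[R]_3) rho :
  is_two_covered_segment lam v D -> is_circumradius lam D rho ->
  (0 < lam -> forall i, side_length lam v i < pi / Num.sqrt lam) ->
  (exists i : 'I_n, true) /\ exists d, [/\ 0 < d, rho = d / 2, adm lam (d / 2),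
    forall i, side_length lam v i = d & forall i, vertex_curvature lam v i = pi / d].
Proof.
move=> [n2 Sv vi DE] hr hs; subst n; split; first by exists ord0.
have SS k : ordS (ordS k) = k :> 'I_2 by apply: val_inj; case: k => -[|[|//]].
have PS k : ord_pred k = ordS k :> 'I_2 by rewrite -{1}[k]SS ordSK.
have Sne k : ordS k != k :> 'I_2 by case: k => -[|[|//]].
have {}Sv k : S (v k) by rewrite on_space.unlock.
have slE k : side_length lam v k = dist (v k) (v (ordS k)) by rewrite /side_length dst.unlock.
pose d := dist (v ord0) (v (ordS ord0)).
have sl k : side_length lam v k = d.
  have [->|k0] := eqVneq k ord0; first exact: slE.
  have -> : k = ordS ord0 by apply: val_inj; case: k k0 => -[|[|//]].
  by rewrite slE SS distC.
have vne : v ord0 != v (ordS ord0).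
  by apply/negP => /eqP/vi h; have := Sne ord0; rewrite -h eqxx.
have da : adm lam (d / 2).
  move=> l0; have := hs l0 ord0; rewrite sl -[in X in _ -> X]mulrA (mulrC 2^-1) mulrA.
  by rewrite ltr_pM2r ?invr_gt0.
have d0 : 0 < d.
  rewrite lt_neqAle dist_ge0// andbT eq_sym; apply: contra vne => /eqP e0; apply/eqP.
  by apply: (q_eq0 (Sv _) (Sv _)); rewrite (q_dist (Sv _) (Sv _)) -/d e0 mul0r s0 expr0n mulr0.
exists d; split=> //.
  by rewrite (DE ord0) in hr; apply: segment_circumradius hr.
move=> k; rewrite /vertex_curvature /interior_angle !sl PS.
have -> : angle lam (v k) (v (ordS k)) (v (ordS k)) = 0.
  transitivity (ang (v k) (v (ordS k)) (v (ordS k))); first by rewrite ang.unlock.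
  apply: ang_self => //; rewrite -slE sl.
  by rewrite -[d](divfK (_ : (2 : R) != 0))// mulrC s_double !mulr_gt0 ?s_gt0 ?c_gt0 ?divr_gt0// ltW// divr_gt0.
have -> : d + d = 2 * d by ring.
by rewrite subr0; field; rewrite gt_eqF.
Qed.

End TwoGon.

Lemma ta_div_le (R : realType) (lam e t : R) : lam != 0 -> 0 < t -> 0 < e ->
  (0 < lam -> t <= e) -> adm lam e -> (lam < 0 -> e <= t) ->
  tn lam t / t <= tn lam e / e /\ (tn lam t / t = tn lam e / e -> t = e).
Proof.
move=> l0 t0 e0 hp ae hn.
have [->|te] := eqVneq t e; first by rewrite lexx.
case: (ltrgt0P lam) l0 => // l0 _.
  have tl : t < e by rewrite lt_neqAle te hp.
  have := ta_div_lt l0 t0 tl ae => h; split; first exact: ltW.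
  by move=> h2; move: h; rewrite h2 ltxx.
have tl : e < t by rewrite lt_neqAle eq_sym te hn.
have := ta_div_gt l0 e0 tl => h; split; first exact: ltW.
by move=> h2; move: h; rewrite h2 ltxx.
Qed.

Unset Implicit Arguments.

Theorem theorem4 (R : realType) (lam kappa0 e : R)
  (n : nat) (v : 'I_n -> 'rV[R]_3) (D : set 'rV[R]_3) (rho : R)
  (hP : is_kappa_convex_polygon lam v kappa0 D)
  (hpos : 0 < lam ->
     (forall i, side_length lam v i <= 2 * e) /\ 2 * e < pi / Num.sqrt lam)
  (hneg : lam < 0 ->
     [/\ Num.sqrt (- lam) < kappa0, 0 < 2 * e
       & forall i, 2 * e <= side_length lam v i])
  (hrho : is_circumradius lam D rho) :
  [/\ lam = 0 ->
        rho <= pi / (2 * kappa0) /\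
        (rho = pi / (2 * kappa0) <->
         is_two_covered_segment lam v D /\
         (exists i, vertex_curvature lam v i = kappa0)),
      lam != 0 ->
        ta_ lam rho <= ta_ lam e / e * (pi / (2 * kappa0)) /\
        (ta_ lam rho = ta_ lam e / e * (pi / (2 * kappa0)) <->
         [/\ is_two_covered_segment lam v D,
             (exists i, vertex_curvature lam v i = kappa0)
           & (exists i, side_length lam v i = 2 * e)])
    & lam < 0 -> 0 < e ->
        ta_ lam e / e * (pi / (2 * kappa0)) < pi / (2 * kappa0)].
Proof.
case: hP => hP k0 hk; have p0 := pi_gt0 R.
have taU t : ta_ lam t = tn lam t by rewrite tn.unlock.
rewrite !taU.
have pk0 : 0 < pi / (2 * kappa0) by rewrite divr_gt0// mulr_gt0.
have side_ratio : lam != 0 -> forall i, 0 < side_length lam v i ->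
    [/\ 0 < e, adm lam e,
        tn lam (side_length lam v i / 2) / (side_length lam v i / 2) <= tn lam e / e
      & tn lam (side_length lam v i / 2) / (side_length lam v i / 2) = tn lam e / e ->
        side_length lam v i = 2 * e].
  move=> l0 i li.
  have [e0 ae h1 h2] : [/\ 0 < e, adm lam e, (0 < lam -> side_length lam v i / 2 <= e)
      & (lam < 0 -> e <= side_length lam v i / 2)].
    case: (ltrgt0P lam) l0 => // l0 _.
      have [hl he] := hpos l0; have := hl i => hi.
      split=> //; [by lra| |by lra].
      by move=> _; rewrite -mulrA (mulrC 2^-1) mulrA ltr_pdivlMr// mulrC.
    have [_ he hl] := hneg l0; have := hl i => hi.
    by split=> //; [lra|move=> h; move: l0; rewrite ltNge ltW|lra].
  have l2 : 0 < side_length lam v i / 2 by rewrite divr_gt0.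
  have [r1 r2] := ta_div_le l0 l2 e0 h1 ae h2.
  by split=> // /r2; lra.
case: hP => hP.
- have hs : 0 < lam -> forall i, side_length lam v i < pi / Num.sqrt lam.
    by move=> l0 i; have [hl he] := hpos l0; exact: le_lt_trans he.
  have [[i0 _] [d [d0 rE da sl kE]]] := two_gon hP hrho hs.
  have dk : d / 2 <= pi / (2 * kappa0).
    have := hk i0; rewrite kE ler_pdivlMr// => h.
    by rewrite ler_pdivlMr ?mulr_gt0//; lra.
  have dkE : (exists i, vertex_curvature lam v i = kappa0) <-> d / 2 = pi / (2 * kappa0).
    split=> [[i]|h]; last exists i0; rewrite kE.
      by move=> h; have -> : pi = kappa0 * d by [rewrite -h divfK// gt_eqF]; field; rewrite gt_eqF.
    have -> : d = pi / kappa0.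
      by rewrite -[d](divfK (_ : (2 : R) != 0))// h; field; rewrite gt_eqF.
    by rewrite invf_div mulrCA divff ?mulr1// gt_eqF.
  split.
  + move=> l0; rewrite rE; split=> //; split=> [h|[_ /dkE]//].
    by split=> //; apply/dkE.
  + move=> l0; rewrite rE.
    have := side_ratio l0 i0; rewrite sl => /(_ d0)[e0 ae r1 r2].
    have d20 : 0 < d / 2 by rewrite divr_gt0.
    have te : 0 < tn lam e / e by rewrite divr_gt0// ta_gt0.
    have tE : tn lam (d / 2) = tn lam (d / 2) / (d / 2) * (d / 2) by rewrite divfK// gt_eqF.
    have m1 : tn lam (d / 2) / (d / 2) * (d / 2) <= tn lam e / e * (d / 2) by rewrite ler_pM2r.
    have m2 : tn lam e / e * (d / 2) <= tn lam e / e * (pi / (2 * kappa0)) by rewrite ler_pM2l.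
    split; first by rewrite tE (le_trans m1).
    split=> [h|[_ /dkE h [i]]].
      have e1 : tn lam (d / 2) / (d / 2) * (d / 2) = tn lam e / e * (d / 2).
        by apply/eqP; rewrite eq_le m1/= -tE h.
      have e2 : tn lam e / e * (d / 2) = tn lam e / e * (pi / (2 * kappa0)) by rewrite -e1 -tE.
      split=> //.
        by apply/dkE; apply: (mulfI (lt0r_neq0 te)).
      by exists i0; rewrite sl; apply: r2; apply: (mulIf (lt0r_neq0 d20)).
    rewrite sl => de; rewrite -h de [2 * e]mulrC mulfK// divfK// gt_eqF//.
  + move=> l0 e0; rewrite gtr_pMl// ltr_pdivrMr// mul1r; exact: ta_lt_id.
- have n3 : (2 < n)%N by case: hP.
  have ntc : ~ is_two_covered_segment lam v D by case=> n2 _ _ _; move: n3; rewrite n2.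
  have sl0 i : 0 < side_length lam v i.
    have Sv k : on_space lam (v k) by rewrite on_space.unlock; case: hP => _ h _ _ _; exact: h.
    have := dist_ge0 (Sv i) (Sv (ordS i)); rewrite {1}dst.unlock -/(side_length lam v i).
    rewrite le_eqVlt => /predU1P[d0|//].
    have /(q_eq0 (Sv _) (Sv _)) : chord_sq lam (v i) (v (ordS i)) = 0.
      by rewrite q_dist// dst.unlock -/(side_length lam v i) -d0 mul0r s0 expr0n mulr0.
    case: hP => _ _ [vi _] _ _ /vi /(congr1 val) /= /eqP.
    rewrite -{1}(modn_small (ltn_ord i)) -[X in (X == _ %[mod _])%N]addn0 -addn1 eqn_modDl mod0n modn_small//.
    by rewrite (ltn_trans _ n3).
  have strict0 : lam = 0 -> rho < pi / (2 * kappa0).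
    move=> l0; rewrite ltNge; apply/negP => h.
    have tE t : tn lam t = t by rewrite taE s_zero// c_zero// divr1.
    apply: (@proper_contradiction _ lam _ v D kappa0 rho) => //.
      by rewrite tE (lt_le_trans pk0).
    move=> i; rewrite !tE; move: h; rewrite ler_pdivrMr ?mulr_gt0// => h.
    have := ler_wpM2r (ltW (sl0 i)) h; lra.
  have strict1 : lam != 0 -> tn lam rho < tn lam e / e * (pi / (2 * kappa0)).
    move=> l0; rewrite ltNge; apply/negP => h.
    have i0 : 'I_n by exists 0%N; exact: ltn_trans n3.
    have [e0 ae _ _] := side_ratio l0 i0 (sl0 i0).
    have te : 0 < tn lam e / e by rewrite divr_gt0// ta_gt0.
    apply: (@proper_contradiction _ lam _ v D kappa0 rho) => //.
      by rewrite (lt_le_trans _ h)// mulr_gt0.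
    move=> i; have [_ _ r1 _] := side_ratio l0 i (sl0 i).
    have l2 : 0 < side_length lam v i / 2 by rewrite divr_gt0.
    have kl : 0 < kappa0 * (side_length lam v i / 2) by rewrite mulr_gt0.
    rewrite ler_pdivrMr// in r1.
    apply: le_trans (ler_wpM2l (ltW kl) h).
    rewrite (_ : kappa0 * _ * _ = pi / 2 * (tn lam e / e * (side_length lam v i / 2))).
      by rewrite ler_pM2l// divr_gt0.
    by field; rewrite (gt_eqF k0) (gt_eqF e0).
  split.
  + move=> l0; have h := strict0 l0; split; first exact: ltW.
    by split=> [h2|[]//]; move: h; rewrite h2 ltxx.
  + move=> l0; have h := strict1 l0; split; first exact: ltW.
    by split=> [h2|[]//]; move: h; rewrite h2 ltxx.
  + move=> l0 e0; rewrite gtr_pMl// ltr_pdivrMr// mul1r; exact: ta_lt_id.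
Qed.
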